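(* Let $m_1\ge3$, $m_2\ge3$, $m_3\ge3$ and let $G$ be the group of type $\mathcal{D}_5$ $$G=\langle t_1,t_2,t_3,x,y\mid t_1^{2^{m_1}}=t_2^{2^{m_2}}=t_3^{2^{m_3}}=1,\ x^2=t_2,\ y^2=t_3,\ t_1,t_2,t_3\text{ central},\ (x,y)=t_1^{2^{m_1-1}}=s\rangle.$$ Denote by $N_1$ the number of cyclic subgroups of the centre $\mathcal{Z}(G)$ and by $N_2,N_3,N_4$ the numbers of $\mathbb{Q}$-classes of $G$ involving $x$, $y$ and $xy$, respectively. Let $N=N_1+N_2+N_3+N_4$ and let $N_0$ be the number of cyclic subgroups of $G/G'$. Then $\mathbb{Q}G$ is the direct sum of $N_0$ fields and $N-N_0$ quaternion algebras. Let $K$ be a finite field of odd order $q$. Then there are at least $2N-36$ simple components in the Wedderburn decomposition of $KG$. This minimal number is realized if $q\equiv3\pmod8$, in which case $KG$ is the direct sum of $2N_0-36$ fields and $2(N-N_0)$ quaternion algebras, each necessarily a $2\times2$ matrix ring (over a field).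
   Context: $(x,y)$ denotes the group commutator; $G'=\{1,s\}$ is the commutator subgroup and $\mathcal{Z}(G)=\langle t_1\rangle\times\langle t_2\rangle\times\langle t_3\rangle\cong C_{2^{m_1}}\times C_{2^{m_2}}\times C_{2^{m_3}}$. The conjugacy classes of $G$ are $\{a\}$ for $a\in\mathcal{Z}(G)$ and $\{w,sw\}$ for $w\notin\mathcal{Z}(G)$. $K$-classes: let $G$ be a finite group of exponent $e$, $K$ a field with characteristic not dividing $|G|$ and $\zeta$ a primitive $e$th root of unity. Each $\sigma\in\mathrm{Gal}(K(\zeta)/K)$ satisfies $\sigma(\zeta)=\zeta^r$ for some $r$, and the maps $g\mapsto g^r$ so obtained act on the set of conjugacy classes of $G$; the orbits are the $K$-classes of $G$. For a noncentral element $z$ of $G$, the $\mathbb{Q}$-classes ''involving $z$'' are those corresponding to (consisting of) conjugacy classes of the form $\{az,saz\}$ with $a\in\mathcal{Z}(G)$. A quaternion algebra means a $4$-dimensional central simple algebra over its centre (a field extension of the ground field); $2\times2$ matrix rings over fields are included. *)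

(* Defs.v *)
From HB Require Import structures.
From mathcomp Require Import all_boot all_order all_fingroup all_algebra.
From mathcomp Require Import all_solvable all_field.
From mathcomp Require integral_char.

Set Implicit Arguments.
Unset Strict Implicit.
Unset Printing Implicit Defensive.

Import GRing.Theory.

Local Open Scope ring_scope.

(* The group algebra K[gT] of a whole finite group type: functions gT -> K   *)
(* under convolution. A fresh name is needed because {ffun gT -> K} already  *)
(* carries the pointwise product.                                            *)
Definition group_algebra (K : fieldType) (gT : finGroupType) : Type :=
  {ffun gT -> K^o}.

Section GroupAlgebra.

Variables (K : fieldType) (gT : finGroupType).
Local Notation A := (group_algebra K gT).

HB.instance Definition _ := Vector.copy A {ffun gT -> K^o}.

Implicit Types a b c : A.

Definition ga_delta (g : gT) : A := [ffun h => ((h == g)%:R : K)].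
Definition ga_one : A := ga_delta 1%g.
Definition ga_mul a b : A :=
  [ffun g => (\sum_(h : gT) (a h : K) * (b (h^-1 * g)%g : K) : K)].

Lemma ga_delta_neq0 g : ga_delta g != 0.
Proof.
apply/eqP=> /ffunP/(_ g); rewrite !ffunE eqxx => /eqP.
by rewrite oner_eq0.
Qed.

Lemma ga_mulA : associative ga_mul.
Proof.
move=> a b c; apply/ffunP=> g; rewrite !ffunE.
under eq_bigr => h _ do rewrite ffunE big_distrr /=.
under [RHS]eq_bigr => h _ do rewrite ffunE big_distrl /=.
rewrite [RHS]exchange_big /=; apply: eq_bigr => k _.
rewrite [RHS](reindex (fun h => k * h)%g) /=; last first.
  by exists (fun h => k^-1 * h)%g => h _; rewrite ?mulKg ?mulKVg.
by apply: eq_bigr => h _; rewrite mulrA mulKg invMg -mulgA.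
Qed.

Lemma ga_mul1l : left_id ga_one ga_mul.
Proof.
move=> a; apply/ffunP=> g; rewrite !ffunE (bigD1 1%g) //= !ffunE eqxx mul1r.
rewrite invg1 mul1g big1 ?addr0 // => h neq_h1.
by rewrite !ffunE (negPf neq_h1) mul0r.
Qed.

Lemma ga_mul1r : right_id ga_one ga_mul.
Proof.
move=> a; apply/ffunP=> g; rewrite !ffunE (bigD1 g) //= !ffunE mulVg eqxx mulr1.
rewrite big1 ?addr0 // => h neq_hg; rewrite !ffunE -eq_mulVg1 (negPf neq_hg).
by rewrite mulr0.
Qed.

Lemma ga_mulDl : left_distributive ga_mul +%R.
Proof.
move=> a b c; apply/ffunP=> g; rewrite !ffunE -big_split /=.
by apply: eq_bigr => h _; rewrite !ffunE -mulrDl.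
Qed.

Lemma ga_mulDr : right_distributive ga_mul +%R.
Proof.
move=> a b c; apply/ffunP=> g; rewrite !ffunE -big_split /=.
by apply: eq_bigr => h _; rewrite !ffunE -mulrDr.
Qed.

HB.instance Definition _ := GRing.Zmodule_isNzRing.Build A
  ga_mulA ga_mul1l ga_mul1r ga_mulDl ga_mulDr (ga_delta_neq0 1%g).

Lemma ga_scaleAl (k : K) a b : k *: (a * b) = (k *: a) * b.
Proof.
apply/ffunP=> g; rewrite !ffunE /= scaler_sumr.
by apply: eq_bigr => h _; rewrite !ffunE scalerAl.
Qed.

HB.instance Definition _ := GRing.Lmodule_isLalgebra.Build K A ga_scaleAl.

Lemma ga_scaleAr (k : K) a b : k *: (a * b) = a * (k *: b).
Proof.
apply/ffunP=> g; rewrite !ffunE /= scaler_sumr.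
by apply: eq_bigr => h _; rewrite !ffunE scalerAr.
Qed.

HB.instance Definition _ := GRing.Lalgebra_isAlgebra.Build K A ga_scaleAr.
HB.instance Definition _ := Algebra_isFalgebra.Build K A.

Lemma ga_deltaM g h : ga_delta g * ga_delta h = ga_delta (g * h)%g.
Proof.
apply/ffunP=> k; rewrite !ffunE (bigD1 g) //= !ffunE eqxx mul1r.
rewrite big1 ?addr0 => [|i /negPf neq_ig]; last by rewrite !ffunE neq_ig mul0r.
by rewrite -(inj_eq (mulgI g)) mulKVg.
Qed.

End GroupAlgebra.

Definition twosided_ideal (K : fieldType) (A : falgType K) (J : {vspace A}) :
    bool :=
  (({:A} * J <= J) && (J * {:A} <= J))%VS.

Definition simple_algebra (K : fieldType) (A : falgType K) : Prop :=
  forall J : {vspace A}, twosided_ideal J -> J = 0%VS \/ J = {:A}%VS.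

Definition field_algebra (K : fieldType) (A : falgType K) : Prop :=
  (forall a b : A, a * b = b * a) /\
  (forall a : A, a != 0 -> a \is a GRing.unit).

(* A is 4-dimensional over its centre Z, i.e. dim_K A = 4 * dim_K Z.         *)
Definition quaternion_algebra (K : fieldType) (A : falgType K) : Prop :=
  [/\ simple_algebra A,
      field_algebra (subvs_of 'Z({:A})%AS)
    & \dim {:A} = (4 * \dim 'Z({:A}))%N].

(* A is isomorphic as a K-algebra to 'M[L]_2 for some field L over K; the    *)
(* K-algebra structure of 'M[L]_2 is obtained by restriction of scalars.     *)
Definition matrix2_algebra (K : fieldType) (A : falgType K) : Prop :=
  exists (L : fieldExtType K) (f : {rmorphism A -> 'M[L]_2}),
    bijective f /\ forall (k : K) (a : A), f (k *: a) = k%:A *: f a.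

(* The B i are {aspace A}: each has its own unit algid (B i), not 1.         *)
Definition ideal_decomposition (K : fieldType) (A : falgType K) (I : finType)
    (B : I -> {aspace A}) : Prop :=
  [/\ forall i, twosided_ideal (B i),
      directv (\sum_i B i)%VS
    & (\sum_i B i)%VS = {:A}%VS].

Definition wedderburn_decomposition (K : fieldType) (A : falgType K)
    (n : nat) (B : 'I_n -> {aspace A}) : Prop :=
  ideal_decomposition B /\ forall i, simple_algebra (subvs_of (B i)).

Definition direct_sum_of (K : fieldType) (A : falgType K)
    (m : nat) (P : falgType K -> Prop) (n : nat) (Q : falgType K -> Prop) :
    Prop :=
  exists (B : 'I_m -> {aspace A}) (C : 'I_n -> {aspace A}),
    [/\ ideal_decomposition
          (fun i : 'I_m + 'I_n => match i with inl j => B j | inr j => C j end),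
        forall j, P (subvs_of (B j))
      & forall j, Q (subvs_of (C j))].

Local Open Scope group_scope.

Definition num_cyclic_subgroups (gT : finGroupType) (G : {group gT}) : nat :=
  #|[set H : {group gT} | (H \subset G) && cyclic H]|.

Section KClasses.

Variables (K : fieldType) (L : splittingFieldType K) (zeta : L).
Variables (gT : finGroupType) (G : {group gT}).

(* zeta is meant to be a primitive e-th root of unity, e the exponent of G,  *)
(* so that the exponents r below only matter modulo e.                       *)
Definition K_class (C : {set gT}) : {set {set gT}} :=
  [set D in classes G |
    [exists sigma in 'Gal(<<1; zeta>>%AS / 1%AS), exists r : 'I_(exponent G),
      (sigma zeta == (zeta ^+ r)%R) && (D == [set g ^+ r | g in C])]].

Definition K_classes : {set {set {set gT}}} :=
  [set K_class C | C in classes G].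

Definition K_classes_involving (s z : gT) : {set {set {set gT}}} :=
  [set O in K_classes |
    O \subset [set [set a * z; s * a * z] | a in 'Z(G)]].

End KClasses.

(* The library's "isog Grp" fixes the group up to isomorphism; the other     *)
(* clauses make t1, ..., y a tuple of generators satisfying the relations,   *)
(* hence (the group being finite) the images of the formal generators.       *)
Definition type_D5 (m1 m2 m3 : nat) (gT : finGroupType)
    (t1 t2 t3 x y : gT) : Prop :=
  [/\ [set: gT] \isog Grp (t1 : t2 : t3 : x : y :
        t1 ^+ (2 ^ m1), t2 ^+ (2 ^ m2), t3 ^+ (2 ^ m3),
        x ^+ 2 = t2, y ^+ 2 = t3,
        [~ t1, t2], [~ t1, t3], [~ t1, x], [~ t1, y],
        [~ t2, t3], [~ t2, x], [~ t2, y], [~ t3, x], [~ t3, y],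
        [~ x, y] = t1 ^+ (2 ^ m1.-1)),
      <<[set t1; t2; t3; x; y]>> = [set: gT],
      [/\ t1 ^+ (2 ^ m1) = 1, t2 ^+ (2 ^ m2) = 1 & t3 ^+ (2 ^ m3) = 1],
      [/\ t1 \in 'Z([set: gT]), t2 \in 'Z([set: gT]) & t3 \in 'Z([set: gT])]
    & [/\ x ^+ 2 = t2, y ^+ 2 = t3 & [~ x, y] = t1 ^+ (2 ^ m1.-1)]].

(* Some splitting field over rat contains the root of unity that K_class     *)
(* refers to.                                                                *)
Lemma exists_primitive_root_rat (gT : finGroupType) (G : {group gT}) :
  exists (L : splittingFieldType rat) (zeta : L),
    (exponent G).-primitive_root zeta.
Proof.
have [L _ [_ _ [w [prim_w _] _]]] := integral_char.group_num_field_exists G.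
exists L, (w ^+ (#|G| %/ exponent G))%R.
exact: (dvdn_prim_root prim_w (exponent_dvdn G)).
Qed.

(* Main.v *)
(* For [B = G] or [B = Z(G)] and [B / C] cyclic, let [hat C] be the average of
   [C] and [e_C := hat C - hat C+], with [C+] the least subgroup of [B] properly
   above [C] ([e_B := hat B]); this is the sum of the primitive idempotents of
   the characters of [B] with kernel [C]. The [e_C] with [B = G], [G' <= C] sum
   to [hat G'] and number N0. The [e_C] with [B = Z(G)], [s] not in [C], sum to
   [1 - hat G'] and number N - N0: outside [Z(G)], w |-> <w G'> has the same
   fibres as the map sending w to its Q-class.
   If [|B / C| = 2^(k+1)], the corner at [e_C] is generated by a root of
   X^(2^k) + 1, together with x and y when [B = Z(G)]; these anticommute there
   because s acts as -1. Over Q this polynomial is irreducible. Over a finite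
   field of odd order q one of -1, 2, -2 is a square, so for k >= 2 it factors
   in two, and the two factors are irreducible if q = 3 mod 8. So each [e_C]
   splits in two, except for the 36 with [|G / C| <= 4]: they come from the
   largest quotient [C_4 ^ 3] of exponent 4 of [G / G'], while [s] not in [C]
   forces [|Z(G) / C| >= 2^m1 >= 8]. A power of t1 squares to -1 in the
   noncommutative corners, so one of x^2, y^2, (x y)^2 = - x^2 y^2 is a square
   in their centre, which makes them matrix rings. *)
Require Import Defs.
From HB Require Import structures.
From mathcomp Require Import all_boot all_order all_fingroup all_algebra.
From mathcomp Require Import all_solvable all_field.
From mathcomp Require Import zify ring.
From Stdlib Require Import Classical FunctionalExtensionality.

Set Implicit Arguments.
Unset Strict Implicit.
Unset Printing Implicit Defensive.

Import GRing.Theory.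

(** * Central idempotents and two-sided ideals *)

(** The lower bound needs no primitivity: orthogonal central idempotents with sum 1 occupy disjoint
    nonempty sets of simple components, so a suitable family bounds the number of components for
    every odd q. Irreducibility enters only for equality. The equality between the number of
    subgroups with cyclic quotient and the number of cyclic subgroups is obtained without
    characters, by comparing two bases of one space over Q. The values -1, 2, -2 come from an
    element [th] with th^4 = -1: th^2 squares to -1, and th - b th^3 squares to 2b when b = 1 or -1.
    The square root c of such a value cuts a corner in two by the idempotents (e + w/c)/2 and (e -
    w/c)/2. For q = 3 mod 8 the order of q modulo 2^j, j >= 3, is 2^(j-2), half the degree of
    X^(2^(j-1)) + 1; so two factors are all there are. The constant 36 is (64 + 8)/2: in a group of
    exponent 4, twice the number of cyclic subgroups is the order plus the number of solutions of
    a^2 = 1. That s differs from 1 is not visible in the presentation; a permutation model supplies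
    it. *)

Section CentralIdempotents.

Local Open Scope ring_scope.

Variables (K : fieldType) (A : falgType K).
Implicit Types (a b e f : A) (I J : finType).

Definition central_idempotent e :=
  [/\ e * e = e, forall a, e * a = a * e & e != 0].

(* [A e]; the junk value [{:A}] occurs only when [e] is not suitable. *)
Definition peirce e : {aspace A} :=
  if insub (limg (amulr e)) is Some B then B else {:A}%AS.

Lemma peirce_limg e : central_idempotent e ->
  peirce e = limg (amulr e) :> {vspace A}.
Proof.
case=> ee ce e0; rewrite /peirce; case: insubP => [B _ -> //|].
case/negP; rewrite /is_aspace; apply/andP; split.
  apply/has_algidP; exists e; split=> //.
    by apply/memv_imgP; exists 1; rewrite ?memvf // lfunE /= mul1r.
  by move=> u /memv_imgP[v _ ->]; rewrite lfunE /= ce -mulrA ee.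
apply/prodvP => _ _ /memv_imgP[u _ ->] /memv_imgP[v _ ->].
apply/memv_imgP; exists (u * e * v); first exact: memvf.
by rewrite !lfunE /= !mulrA.
Qed.

Lemma mem_peirce e a : central_idempotent e -> (a \in peirce e) = (a * e == a).
Proof.
move=> ce; rewrite (peirce_limg ce); case: ce => ee ce e0.
apply/memv_imgP/eqP => [[b _ ->]|ae]; first by rewrite lfunE /= -mulrA ee.
by exists a; rewrite ?memvf // lfunE.
Qed.

Lemma mulr_peirce e a : central_idempotent e -> a * e \in peirce e.
Proof.
by move=> ce; rewrite mem_peirce //; case: ce => ee _ _; rewrite -mulrA ee.
Qed.

Lemma algid_peirce e : central_idempotent e -> algid (peirce e) = e.
Proof.
move=> ce; have eP : e \in peirce e by rewrite mem_peirce //; case: ce => ->.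
have := memv_algid (peirce e); rewrite mem_peirce // => /eqP <-.
exact: algidl eP.
Qed.

Lemma peirce_ideal e : central_idempotent e -> twosided_ideal (peirce e).
Proof.
move=> ce; apply/andP; split; apply/prodvP => a b.
  move=> _; rewrite !mem_peirce // => /eqP be.
  by rewrite -mulrA be.
rewrite !mem_peirce // => /eqP ae _.
by case: ce => _ ce _; rewrite -mulrA -ce mulrA ae.
Qed.

Definition idempotent_decomposition I (e : I -> A) :=
  [/\ forall i, central_idempotent (e i),
      forall i j, i != j -> e i * e j = 0
    & \sum_i e i = 1].

Lemma idempotent_ideal_decomposition I (e : I -> A) :
  idempotent_decomposition e -> ideal_decomposition (fun i => peirce (e i)).
Proof.
case=> ce oe se; split; first by move=> i; apply: peirce_ideal.
  apply/directv_sum_independent => u uP u0 i _.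
  have := congr1 (fun a => a * e i) u0; rewrite mul0r mulr_suml.
  rewrite (bigD1 i) //= big1 ?addr0 => [|j ji].
    by have := uP i isT; rewrite mem_peirce // => /eqP ->.
  have := uP j isT; rewrite mem_peirce // => /eqP <-.
  by rewrite -mulrA oe ?mulr0.
apply/eqP; rewrite eqEsubv subvf; apply/subvP=> a _.
rewrite -[a]mulr1 -se mulr_sumr; apply: memv_sumr => i _.
exact: mulr_peirce.
Qed.

Lemma ideal_mull (U : {vspace A}) a u :
  twosided_ideal U -> u \in U -> a * u \in U.
Proof. by case/andP=> /prodvP h _ uU; apply: h; rewrite ?memvf. Qed.

Lemma ideal_mulr (U : {vspace A}) a u :
  twosided_ideal U -> u \in U -> u * a \in U.
Proof. by case/andP=> _ /prodvP h uU; apply: h; rewrite ?memvf. Qed.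

(** Products across two different summands lie in both, hence vanish by directness. So each unit
    [algid (B i)] is central, and multiplying the decomposition of 1 by the sum of the units shows
    that this sum is 1. *)
Lemma ideal_decomposition_idempotents I (B : I -> {aspace A}) :
  ideal_decomposition B ->
  idempotent_decomposition (fun i => algid (B i)) /\
  forall i, central_idempotent (algid (B i)) /\
            B i = peirce (algid (B i)) :> {vspace A}.
Proof.
move=> [iB dB sB].
have orth i j a b : i != j -> a \in B i -> b \in B j -> a * b = 0.
  move=> ij ai bj; have abi : a * b \in B i by apply: ideal_mulr.
  have abj : a * b \in B j by apply: ideal_mull.
  have /directv_sumP /(_ i isT) /eqP := dB.
  rewrite -subv0 => /subvP /(_ (a * b)).
  rewrite memv_cap abi memv0 /=  => h; apply/eqP/h.
  by rewrite (bigD1 j) 1?eq_sym //= (subvP (addvSl _ _)).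
have dec a : exists2 u : I -> A, forall i, u i \in B i & a = \sum_i u i.
  have : a \in (\sum_i B i)%VS by rewrite sB memvf.
  by case/memv_sumP => u uB ->; exists u => // i; apply: uB.
have c i a : algid (B i) * a = a * algid (B i).
  case: (dec a) => u uB ->; rewrite mulr_suml mulr_sumr; apply: eq_bigr => j _.
  have [->|ij] := eqVneq i j; first by rewrite algidl ?algidr.
  by rewrite (orth i j) ?(orth j i) ?memv_algid // eq_sym.
have ci i : central_idempotent (algid (B i)).
  by split; rewrite ?algid_neq0 // algidl ?memv_algid.
split; last first.
  move=> i; split=> //; apply/eqP; rewrite eqEsubv; apply/andP; split; apply/subvP=> a.
    by move=> aB; rewrite mem_peirce // algidr.
  by rewrite mem_peirce // => /eqP <-; apply: ideal_mull; rewrite ?memv_algid.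
split=> // [i j ij|]; first by rewrite (orth i j) ?memv_algid.
have [u uB u1] := dec 1; rewrite -[LHS]mul1r [X in X * _]u1 [RHS]u1.
rewrite mulr_suml; apply: eq_bigr => i _; rewrite mulr_sumr (bigD1 i) //=.
rewrite big1 ?addr0 ?algidr // => j ji.
by rewrite (orth i j) ?memv_algid // eq_sym.
Qed.

(** The element w = f [algid B] is a central idempotent of [B], so the ideal B w is 0 or everything.
    In the second case 1 = b w, whence w = b w w = b w = 1. *)
Lemma simple_central_idempotent (B : {aspace A}) f :
  simple_algebra (subvs_of B) -> f * f = f -> (forall a, f * a = a * f) ->
  f * algid B \in B -> f * algid B = 0 \/ f * algid B = algid B.
Proof.
move=> sB ff cf fB; pose w : subvs_of B := Subvs fB.
have vw : vsval w = f * algid B by [].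
have cw (b : subvs_of B) : w * b = b * w.
  apply: val_inj => /=; rewrite -mulrA algidl ?subvsP //.
  by rewrite mulrA -cf -mulrA algidr ?subvsP.
have ww : w * w = w.
  apply: val_inj => /=; rewrite mulrA -[f * algid B * f]mulrA -[algid B * f]cf.
  by rewrite mulrA ff -mulrA algidl ?memv_algid.
have [|w0|wf] := sB (limg (amulr w)).
- apply/andP; split; apply/prodvP => a b.
    move=> _ /memv_imgP[u _ ->]; rewrite lfunE /= mulrA.
    by apply/memv_imgP; exists (a * u); rewrite ?memvf // lfunE.
  move=> /memv_imgP[u _ ->] _; rewrite lfunE /= -mulrA cw mulrA.
  by apply/memv_imgP; exists (u * b); rewrite ?memvf // lfunE.
- left; rewrite -vw; have : w \in limg (amulr w).
    by apply/memv_imgP; exists 1; rewrite ?memvf // lfunE /= mul1r.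
  by rewrite w0 memv0 => /eqP ->; rewrite linear0.
right; have : 1 \in limg (amulr w) by rewrite wf memvf.
case/memv_imgP => b _; rewrite lfunE /= => b1.
have : w = 1 by rewrite -[LHS]mul1r [X in X * _]b1 -mulrA ww -b1.
by move/(congr1 (fun z => vsval z)); rewrite vw.
Qed.

(** Each [f j] fixes some [e i], since otherwise f j = f j (sum of the e i) = 0. By orthogonality no
    [e i] is fixed by two of the [f j], so choosing such an [i] injects [J] into [I]. *)
Lemma dichotomy_card_le I J (e : I -> A) (f : J -> A) :
  idempotent_decomposition e -> idempotent_decomposition f ->
  (forall i j, f j * e i = 0 \/ f j * e i = e i) -> (#|J| <= #|I|)%N.
Proof.
move=> [ce oe se] [cf of_ sf] fe.
have ex j : exists i, f j * e i == e i.
  apply: NNPP => ne; case: (cf j) => _ _ /eqP[].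
  rewrite -[LHS]mulr1 -se mulr_sumr big1 // => i _.
  by case: (fe i j) => // /eqP h; case: ne; exists i.
pose phi j := xchoose (ex j).
apply: (leq_card phi) => j k jk; apply/eqP/negPn/negP => njk.
have ej := xchooseP (ex j); have := xchooseP (ex k).
rewrite -/(phi j) -/(phi k) in ej *; rewrite -jk -(eqP ej) mulrA.
rewrite of_ 1?eq_sym // mul0r (eqP ej) eq_sym => /eqP e0.
by case: (ce (phi j)) => _ _; rewrite e0 eqxx.
Qed.

Lemma wedderburn_card_ge n (B : 'I_n -> {aspace A}) J (f : J -> A) :
  wedderburn_decomposition B -> idempotent_decomposition f -> (#|J| <= n)%N.
Proof.
move=> [/ideal_decomposition_idempotents[dB cB] sB] df.
rewrite -[n]card_ord; apply: (dichotomy_card_le dB df) => i j.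
case: df => cf _ _; case: (cf j) => ff cfj _.
apply: simple_central_idempotent => //.
by case: (cB i) => ce ->; rewrite algid_peirce ?mulr_peirce.
Qed.

(** When the corners of the [f j] are simple as well, the dichotomy argument applies with the two
    families exchanged. *)
Lemma wedderburn_card_eq n (B : 'I_n -> {aspace A}) J (f : J -> A) :
  wedderburn_decomposition B -> idempotent_decomposition f ->
  (forall j, simple_algebra (subvs_of (peirce (f j)))) -> n = #|J|.
Proof.
move=> wB df sf; apply/eqP; rewrite eqn_leq (wedderburn_card_ge wB df) andbT.
case: wB => [/ideal_decomposition_idempotents[dB cB] sB].
rewrite -[X in (X <= _)%N]card_ord; apply: (dichotomy_card_le df dB) => j i.
case: (cB i) => [[ee ce e0] _]; case: df => cf _ _.
have /= := @simple_central_idempotent (peirce (f j)) (algid (B i)) (sf j) ee ce.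
by rewrite algid_peirce //; apply; rewrite mulr_peirce.
Qed.

Lemma direct_sum_of_idempotents I J (e : I -> A) (f : J -> A)
    (P Q : falgType K -> Prop) :
  idempotent_decomposition (fun k : I + J => match k with inl i => e i | inr j => f j end) ->
  (forall i, P (subvs_of (peirce (e i)))) ->
  (forall j, Q (subvs_of (peirce (f j)))) ->
  direct_sum_of A #|I| P #|J| Q.
Proof.
move=> [c o s] Pe Qf.
exists (fun i => peirce (e (enum_val i))), (fun j => peirce (f (enum_val j))).
split; [|by move=> i; apply: Pe|by move=> j; apply: Qf].
pose g (k : 'I_#|I| + 'I_#|J|) :=
  match k with inl i => e (enum_val i) | inr j => f (enum_val j) end.
have dg : idempotent_decomposition g.
  split=> [[i|j]|[i|i] [j|j] ij|].
  - exact: (c (inl _)).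
  - exact: (c (inr _)).
  - apply: (o (inl _) (inl _)); apply: contra_neq ij => -[ij].
    by rewrite (enum_val_inj ij).
  - exact: (o (inl _) (inr _)).
  - exact: (o (inr _) (inl _)).
  - apply: (o (inr _) (inr _)); apply: contra_neq ij => -[ij].
    by rewrite (enum_val_inj ij).
  rewrite -s !big_sumType /=; congr (_ + _).
    by rewrite [RHS](big_enum_val (A := I)).
  by rewrite [RHS](big_enum_val (A := J)).
have := idempotent_ideal_decomposition dg; congr (ideal_decomposition _).
(* A [match] inside [peirce] and a [match] of [peirce] agree only pointwise. *)
by apply: functional_extensionality => -[].
Qed.

End CentralIdempotents.

(** * Existence of Wedderburn decompositions *)

Section WedderburnExistence.

Local Open Scope ring_scope.

Variables (K : fieldType) (A : falgType K).

Lemma idempotent_decomposition_card (I : finType) (e : I -> A) :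
  idempotent_decomposition e -> (#|I| <= \dim {:A})%N.
Proof.
move=> de; have [_ /directvP dB <-] := idempotent_ideal_decomposition de.
rewrite dB /= -sum1_card; apply: leq_sum => i _; exact: adim_gt0.
Qed.

(** One refinement step for [wedderburn_exists]; the additional index [None] carries [f]. *)
Lemma idempotent_decomposition_split (I : finType) (e : I -> A) i f :
  idempotent_decomposition e -> central_idempotent f -> f * e i = f ->
  f != e i ->
  idempotent_decomposition
    (oapp (fun j => if j == i then e i - f else e j) f).
Proof.
move=> [ce oe se] [ff cf f0] fe nfe; have ef : e i * f = f by rewrite -cf.
have fo j : j != i -> f * e j = 0.
  by move=> ji; rewrite -fe -mulrA oe ?mulr0 // eq_sym.
have of' j : j != i -> e j * f = 0 by move=> ji; rewrite -cf fo.
split=> [[j|]|[j|] [k|] //= jk|] /=; last 1 first.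
- rewrite (bigD1 None) //= (reindex_omap Some id) => [|[]] //=.
  under eq_bigl do rewrite eqxx; rewrite (bigD1 i) //= eqxx addrA [f + _]addrC subrK -se.
  rewrite [RHS](bigD1 i) //=; congr (_ + _); apply: eq_bigr => j /negPf ji.
  by rewrite ji.
- case: eqP => // _; case: (ce i) => eei cei _; split.
  + by rewrite mulrBl !mulrBr eei ef fe ff subrr subr0.
  + by move=> a; rewrite mulrBl mulrBr cf cei.
  by rewrite subr_eq0 eq_sym.
- by [].
- have {}jk : j != k by apply: contra_neq jk => ->.
  have [ji|ji] := eqVneq j i; have [ki|ki] := eqVneq k i.
  + by rewrite ji ki eqxx in jk.
  + by rewrite mulrBl oe ?fo ?subrr // eq_sym.
  + by rewrite mulrBr oe ?of' ?subrr.
  exact: oe.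
- case: eqP => [_|/eqP ji]; last exact: of'.
  by rewrite mulrBl ef ff subrr.
- case: eqP => [_|/eqP ji]; last exact: fo.
  by rewrite mulrBr fe ff subrr.
Qed.

(** A corner that is not simple has a proper nonzero ideal; seen in [A] this is again an ideal, so
    it is the corner of some [f], which splits the idempotent. The process stops because the number
    of idempotents is bounded by the dimension. *)
Lemma wedderburn_exists :
  (forall U : {vspace A}, twosided_ideal U -> U != 0%VS ->
     exists2 e, central_idempotent e & U = peirce e) ->
  exists (n : nat) (B : 'I_n -> {aspace A}), wedderburn_decomposition B.
Proof.
move=> ssA; suff H m (I : finType) (e : I -> A) : idempotent_decomposition e ->
    (\dim {:A} - #|I| < m)%N ->
    exists (n : nat) (B : 'I_n -> {aspace A}), wedderburn_decomposition B.
  apply: (H _ unit (fun _ => 1)) (ltnSn _).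
  split=> [_|[] [] //|]; last by rewrite big_const card_unit /= addr0.
  by split; rewrite ?oner_eq0 ?mulr1 // => a; rewrite mulr1 mul1r.
elim: m I e => // m IHm I e de lt_m.
have [sB|nB] := classic (forall i, simple_algebra (subvs_of (peirce (e i)))).
  exists #|I|, (fun i => peirce (e (enum_val i))); split=> [|i]; last exact: sB.
  apply: idempotent_ideal_decomposition; case: de => ce oe se; split=> //.
    by move=> i j ij; apply: oe; rewrite (inj_eq enum_val_inj).
  by rewrite -se [RHS](big_enum_val (A := I)).
have [i nBi] := not_all_ex_not _ _ nB.
have [U nBU] := not_all_ex_not _ _ nBi.
have [iU /not_or_and[U0 U1]] := imply_to_and _ _ nBU.
pose V := (linfun vsval @: U)%VS.
have memV u : u \in U -> vsval u \in V.
  by move=> uU; apply/memv_imgP; exists u; rewrite // lfunE.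
have VP a : a \in V -> exists2 u, u \in U & a = vsval u.
  by case/memv_imgP => u uU ->; exists u; rewrite // lfunE.
have ci : central_idempotent (e i) by case: de.
have algi := algid_peirce ci.
have VE a : a \in V -> a * e i = a.
  by move/VP => [u uU ->]; apply/eqP; rewrite -mem_peirce ?subvsP.
have [eei cei e0] := ci.
(* On [V] an element [a] of [A] acts as a * e i, which lies in the corner. *)
have iV : twosided_ideal V.
  apply/andP; split; apply/prodvP => a b.
    move=> _ /[dup] bV /VP[u uU bu]; pose w := Subvs (mulr_peirce a ci).
    suff -> : a * b = vsval (w * u) by apply/memV/ideal_mull.
    by rewrite /= -bu -mulrA cei VE.
  move=> /[dup] aV /VP[u uU au] _; pose w := Subvs (mulr_peirce b ci).
  suff -> : a * b = vsval (u * w) by apply/memV/ideal_mulr.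
  by rewrite /= -au -cei mulrA VE.
have V0 : V != 0%VS.
  apply/eqP => V0; apply: U0; apply/eqP; rewrite -subv0; apply/subvP=> u /memV.
  by rewrite V0 !memv0 => /eqP u0; apply/eqP/val_inj.
have [f cf Vf] := ssA V iV V0.
have fV : f \in V by rewrite Vf mem_peirce //; case: cf => ->.
have nfe : f != e i.
  apply/eqP => fe; apply: U1; apply/eqP; rewrite eqEsubv subvf.
  apply/subvP=> w _; have : vsval w \in V.
    by rewrite Vf mem_peirce // fe -mem_peirce ?subvsP.
  by case/VP => u uU /val_inj ->.
apply: IHm (idempotent_decomposition_split de cf (VE _ fV) nfe) _.
(* The dimension bound for the larger family makes the truncated subtraction decrease strictly. *)
have := idempotent_decomposition_card
  (idempotent_decomposition_split de cf (VE _ fV) nfe).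
rewrite card_option; move: lt_m; rewrite ltnS => /leq_trans h lt.
by rewrite (leq_trans _ (h _ (leqnn _))) // ltn_sub2l.
Qed.

End WedderburnExistence.

(** * Fields and quaternion algebras given by generators *)

Section OneGenerator.

Local Open Scope ring_scope.

Variables (K : fieldType) (B : falgType K) (z : B) (f : {poly K}).
Hypotheses (irr_f : irreducible_poly f) (fz0 : horner_alg z f = 0).

(** If p(z) is nonzero, the irreducible [f] does not divide [p], and a Bezout relation evaluated at
    [z] gives the inverse. Thus K[z] is a field. *)
Lemma horner_alg_inv p : horner_alg z p != 0 ->
  exists q, horner_alg z q * horner_alg z p = 1.
Proof.
move=> pz0; have : coprimep f p.
  rewrite irreducible_poly_coprime //; apply: contraNN pz0 => /dvdpP[q ->].
  by rewrite rmorphM /= fz0 mulr0.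
case/Bezout_eq1_coprimepP => -[u w] /= uw; exists w.
by have := congr1 (horner_alg z) uw; rewrite rmorphD !rmorphM /= fz0 mulr0 add0r rmorph1.
Qed.

Lemma horner_alg_unit p : horner_alg z p != 0 ->
  horner_alg z p \is a GRing.unit.
Proof.
move=> /horner_alg_inv[q qp]; apply/unitrP; exists (horner_alg z q); split=> //.
by rewrite -rmorphM mulrC rmorphM.
Qed.

Lemma field_algebra_generated :
  (forall b, exists p, b = horner_alg z p) -> field_algebra B.
Proof.
move=> genB; split=> [a b|a a0].
  have [p ->] := genB a; have [q ->] := genB b.
  by rewrite -!rmorphM mulrC.
by have [p ap] := genB a; rewrite ap horner_alg_unit // -ap.
Qed.

Variables (u v : B) (i j : nat).
Hypotheses (two_neq0 : (2%:R : K) != 0) (cz : forall b, z * b = b * z)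
  (zU : z \is a GRing.unit) (uu : u * u = z ^+ i) (vv : v * v = z ^+ j)
  (uv : u * v = - (v * u)).
Hypothesis genB : forall b, exists p : 4.-tuple {poly K},
  b = horner_alg z (tnth p 0) + horner_alg z (tnth p 1) * u
      + horner_alg z (tnth p 2) * v + horner_alg z (tnth p 3) * (u * v).

Local Notation "p .@" := (horner_alg z p) (at level 2, format "p .@").

Lemma horner_alg_central p b : p.@ * b = b * p.@.
Proof.
elim/poly_ind: p => [|p c IHp]; first by rewrite rmorph0 mul0r mulr0.
rewrite rmorphD rmorphM /= horner_algX horner_algC mulrDl mulrDr.
rewrite -mulrA cz [p.@ * _]mulrA.
rewrite IHp -!mulrA; congr (_ + _).
by rewrite -scalerAl mul1r -scalerAr mulr1.
Qed.

Let uU : u \is a GRing.unit.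
Proof. by rewrite -(unitrX_pos u (n := 2)) // expr2 uu unitrX. Qed.

Let vU : v \is a GRing.unit.
Proof. by rewrite -(unitrX_pos v (n := 2)) // expr2 vv unitrX. Qed.

Let vu : v * u = - (u * v). Proof. by rewrite uv opprK. Qed.

Lemma memv_half (U : {vspace B}) a : a + a \in U -> a \in U.
Proof.
move=> aU; have -> : a = 2%:R^-1 *: (a + a).
  by rewrite -mulr2n -scaler_nat scalerA mulVf // scale1r.
exact: memvZ.
Qed.

Lemma ideal_unitr (U : {vspace B}) a w : twosided_ideal U ->
  w \is a GRing.unit -> a * w \in U -> a \in U.
Proof. by move=> iU wU; rewrite -{2}[a](mulrK wU); apply: ideal_mulr. Qed.

(* Conjugation by u and by v separates the four coordinates. *)
Lemma ideal_coordinates (U : {vspace B}) a b c d : twosided_ideal U ->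
  a.@ + b.@ * u + c.@ * v + d.@ * (u * v) \in U ->
  [/\ a.@ \in U, b.@ \in U, c.@ \in U & d.@ \in U].
Proof.
move=> iU; set w := _ + d.@ * _ => wU.
(* Since [v] anticommutes with [u] and commutes with K[z], the sum and the difference of r v and v
   r, with r = p + q u, are 2 p v and 2 q u v. *)
have split1 p q : p.@ + q.@ * u \in U -> p.@ \in U /\ q.@ \in U.
  move=> pq; split; apply: memv_half; last first.
    apply: (ideal_unitr iU (w := u * v)); first by rewrite unitrMl.
    have -> : (q.@ + q.@) * (u * v) = (p.@ + q.@ * u) * v - v * (p.@ + q.@ * u).
      rewrite mulrDr !mulrDl mulrA -[v * p.@]horner_alg_central.
      rewrite [v * (_ * u)]mulrA -[v * q.@]horner_alg_central -[q.@ * v * u]mulrA vu.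
      by rewrite mulrN opprD opprK mulrA addrACA subrr add0r.
    by apply: rpredB; [exact: ideal_mulr | exact: ideal_mull].
  apply: (ideal_unitr iU vU).
  have -> : (p.@ + p.@) * v = (p.@ + q.@ * u) * v + v * (p.@ + q.@ * u).
    rewrite mulrDr !mulrDl -[v * p.@]horner_alg_central.
    rewrite [v * (_ * u)]mulrA -[v * q.@]horner_alg_central -[q.@ * v * u]mulrA vu.
    by rewrite mulrN mulrA addrACA subrr addr0.
  by apply: rpredD; [exact: ideal_mulr | exact: ideal_mull].
(* With w = X + Y v and X, Y in K[z][u], the sum w u + u w equals 2 X u, which isolates X. *)
have wE : w = (a.@ + b.@ * u) + (c.@ + d.@ * u) * v.
  by rewrite /w mulrDl addrA mulrA.
have uC p q : u * (p.@ + q.@ * u) = (p.@ + q.@ * u) * u.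
  by rewrite mulrDr mulrDl -horner_alg_central mulrA -horner_alg_central.
set X := a.@ + _ in wE; set Y := c.@ + _ in wE.
have uX : u * X = X * u by apply: uC.
have uY : u * Y = Y * u by apply: uC.
have XU : X \in U.
  apply: memv_half; apply: (ideal_unitr iU uU).
  have -> : (X + X) * u = w * u + u * w.
    rewrite wE mulrDr [(X + X) * u]mulrDl [(X + Y * v) * u]mulrDl uX.
    rewrite [u * (Y * v)]mulrA uY -[Y * v * u]mulrA vu mulrN [Y * (u * v)]mulrA.
    by rewrite addrACA addNr addr0.
  by apply: rpredD; [exact: ideal_mulr | exact: ideal_mull].
have YU : Y \in U.
  by apply: (ideal_unitr iU vU); rewrite -[Y * v](addKr X) -wE rpredD ?rpredN.
by case: (split1 a b XU) => ? ?; case: (split1 c d YU).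
Qed.

(** Applied to the zero ideal, [ideal_coordinates] makes coordinates unique, although [genB] only
    asserts that they exist. Commuting with [u] then kills the coordinates at [v] and [u * v], and
    commuting with [v] the one at [u]. *)
Lemma center_generated w : reflect (exists p, w = p.@) (w \in 'Z({:B})%VS).
Proof.
have i0 : twosided_ideal (0%VS : {vspace B}).
  by rewrite /twosided_ideal prodv0 prod0v subvv.
apply: (iffP idP) => [|[p ->]]; last first.
  rewrite memv_cap memvf; apply/centvP => b _; exact: horner_alg_central.
rewrite memv_cap memvf => /centvP cw; have [t wE] := genB w.
move: wE; set a := tnth t 0; set b := tnth t 1; set c := tnth t 2.
set d := tnth t 3 => wE.
have zero x : x \in (0%VS : {vspace B}) -> x = 0 by rewrite memv0 => /eqP.
have lin q r : q.@ + r.@ * u = 0 -> q.@ = 0 /\ r.@ = 0.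
  move=> qr; have := @ideal_coordinates 0%VS q r 0 0 i0.
  by rewrite !rmorph0 !mul0r !addr0 qr mem0v => /(_ isT)[/zero ? /zero ?].
have uC p q : u * (p.@ + q.@ * u) = (p.@ + q.@ * u) * u.
  by rewrite mulrDr mulrDl -horner_alg_central mulrA -horner_alg_central.
have [c0 d0] : c.@ = 0 /\ d.@ = 0.
  apply: lin; set Y := _ + _; have uY : u * Y = Y * u by apply: uC.
  apply/zero/memv_half; rewrite memv0 -(mulIr_eq0 _ (mulIr vU)).
  rewrite -(mulIr_eq0 _ (mulIr uU)).
  rewrite -(subrr (w * u)) {2}cw ?memvf //.
  have -> : w = (a.@ + b.@ * u) + Y * v.
    by rewrite wE [Y * v]mulrDl addrA mulrA.
  rewrite [u * _]mulrDr [(_ + Y * v) * u]mulrDl uC [u * (Y * v)]mulrA uY.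
  apply/eqP; rewrite opprD [RHS]addrACA subrr add0r -[Y * u * v]mulrA uv.
  by rewrite mulrN opprK mulrA [(Y + Y) * v]mulrDl mulrDl.
have {}wE : w = a.@ + b.@ * u by rewrite wE c0 d0 !mul0r !addr0.
suff b0 : b.@ = 0 by exists a; rewrite wE b0 mul0r addr0.
apply/zero/memv_half; rewrite memv0 -(mulIr_eq0 _ (mulIr uU)).
rewrite -(mulIr_eq0 _ (mulIr vU)) -(subrr (w * v)) {2}cw ?memvf //.
rewrite wE mulrDr !mulrDl -[v * a.@]horner_alg_central.
rewrite [v * (b.@ * u)]mulrA -[v * b.@]horner_alg_central -[b.@ * v * u]mulrA vu.
by rewrite mulrN opprD opprK addrACA subrr add0r mulrA.
Qed.

(** Some coordinate of a nonzero element of the ideal is nonzero; it belongs to the ideal by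
    [ideal_coordinates] and is invertible in K[z]. *)
Lemma quaternion_simple : simple_algebra B.
Proof.
move=> U iU; have [U0|] := eqVneq U 0%VS; [by left | right].
have [w wU w0] : exists2 w, w \in U & w != 0.
  exists (vpick U); [exact: memv_pick | by rewrite vpick0].
suff [p pU p0] : exists2 p, p.@ \in U & p.@ != 0.
  apply/eqP; rewrite eqEsubv subvf; apply/subvP=> b _.
  have [q q1] := horner_alg_inv p0.
  by rewrite -[b]mulr1 -q1; do 2!apply: (ideal_mull _ iU).
have [p wE] := genB w; move: wU; rewrite {1}wE => /(ideal_coordinates iU)[aU bU cU dU].
have inU k : (tnth p k).@ \in U.
  by case: k => -[|[|[|[|//]]]] kl; [move: aU | move: bU | move: cU | move: dU];
    congr ((tnth p _).@ \in U); apply: val_inj.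
case: (boolP [exists k, (tnth p k).@ != 0]) => [/existsP[k k0]|].
  by exists (tnth p k).
rewrite negb_exists => /forallP p0; case/eqP: w0.
have q0 k : (tnth p k).@ = 0 by have := p0 k; rewrite negbK => /eqP.
by rewrite wE !q0 !mul0r !addr0.
Qed.

(** [B] is the direct sum of the translates of its centre K[z] by the units 1, u, v, uv. *)
Lemma quaternion_dim : \dim {:B} = (4 * \dim 'Z({:B}))%N.
Proof.
pose m : 4.-tuple B := [tuple 1; u; v; u * v].
have mU k : tnth m k \is a GRing.unit.
  case: k => -[|[|[|[|//]]]] kl; by rewrite (tnth_nth 0) //= ?unitr1 ?unitrMl.
pose V k := ('Z({:B}) * <[tnth m k]>)%VS.
have i0 : twosided_ideal (0%VS : {vspace B}).
  by rewrite /twosided_ideal prodv0 prod0v subvv.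
have dV : directv (\sum_(k < 4) V k)%VS.
  apply/directv_sum_independent => w wV w0 k _.
  have wE n : exists p, w n = p.@ * tnth m n.
    have := wV n isT; rewrite /V => /memv_cosetP[y yZ ->].
    by have /center_generated[p ->] := yZ; exists p.
  have [a aE] := wE 0; have [b bE] := wE 1.
  have [c cE] := wE 2; have [d dE] := wE 3.
  move: (w0); rewrite !big_ord_recl big_ord0 addr0.
  rewrite (_ : lift ord0 (lift ord0 (lift ord0 ord0)) = 3 :> 'I_4); last exact/val_inj.
  rewrite (_ : lift ord0 (lift ord0 ord0) = 2 :> 'I_4); last exact/val_inj.
  rewrite (_ : lift ord0 ord0 = 1 :> 'I_4); last exact/val_inj.
  rewrite aE bE cE dE !(tnth_nth 0) /= mulr1 !addrA => s0.
  have /(ideal_coordinates i0) : a.@ + b.@ * u + c.@ * v + d.@ * (u * v)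
    \in (0%VS : {vspace B}) by rewrite s0 mem0v.
  rewrite !memv0 => -[/eqP a0 /eqP b0 /eqP c0 /eqP d0].
  move: aE bE cE dE; rewrite a0 b0 c0 d0 !mul0r => aE bE cE dE.
  by case: k => -[|[|[|[|//]]]] kl; [move: aE | move: bE | move: cE | move: dE];
    move=> <-; congr (w _); apply: val_inj.
have sV : (\sum_(k < 4) V k)%VS = {:B}%VS.
  apply/eqP; rewrite eqEsubv subvf; apply/subvP=> b _; have [p ->] := genB b.
  have pZ k : (tnth p k).@ \in 'Z({:B})%VS by apply/center_generated; exists (tnth p k).
  have memV k : (tnth p k).@ * tnth m k \in (\sum_(k < 4) V k)%VS.
    apply: (subvP (sumv_sup k isT (subvv _))).
    by apply: memv_mul; rewrite ?memv_line.
  have := rpredD (rpredD (rpredD (memV 0) (memV 1)) (memV 2)) (memV 3).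
  by rewrite !(tnth_nth 0 m) /= mulr1.
rewrite -[in LHS]sV (directvP dV) /=.
rewrite (eq_bigr (fun=> \dim 'Z({:B}))) ?sum_nat_const ?card_ord // => k _.
exact: dim_cosetv_unit.
Qed.

Lemma center_field : field_algebra (subvs_of 'Z({:B})%AS).
Proof.
split=> [a b|a a0].
  apply: val_inj => /=; have /center_generated[p ->] := subvsP a.
  exact: horner_alg_central.
apply: vsval_unitr; have a0' : vsval a != 0 by [].
have /center_generated[p ap] := subvsP a.
by rewrite ap in a0' *; apply: horner_alg_unit.
Qed.

Lemma quaternion_algebra_generated : quaternion_algebra B.
Proof.
split; [exact: quaternion_simple|exact: center_field|exact: quaternion_dim].
Qed.

End OneGenerator.

(** * Recognition of 2 x 2 matrix algebras by matrix units *)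

Section MatrixUnits.

Local Open Scope ring_scope.

(** [field_algebra] is a mere property, while [matrix2_algebra] asks for a [fieldExtType]; the same
    carrier is repackaged and the isomorphism is the identity. *)
Lemma field_algebra_fieldExt (K : fieldType) (A : falgType K) :
  field_algebra A ->
  exists (L : fieldExtType K) (g : {lrmorphism L -> A}), bijective g.
Proof.
move=> [comA unitA].
have fA : GRing.field_axiom A by move=> a; apply: unitA.
pose Ac := GRing.PzRing_hasCommutativeMul.Build A comA.
pose AC : comUnitRingType := HB.pack A Ac.
pose Af := GRing.ComUnitRing_isField.Build AC fA.
pose L : fieldExtType K := HB.pack A Ac Af.
pose g : L -> A := idfun.
have gB : zmod_morphism g by [].
have gM : monoid_morphism g by [].
have gZ : scalable g by [].
pose gR : {lrmorphism L -> A} :=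
  HB.pack g (GRing.isZmodMorphism.Build _ _ g gB)
    (GRing.isMonoidMorphism.Build _ _ g gM) (GRing.isScalable.Build _ _ _ _ g gZ).
by exists L, gR, idfun.
Qed.

Variables (K : fieldType) (B : falgType K) (E : 'I_2 -> 'I_2 -> B).
Hypotheses (EM : forall i j k l, E i j * E k l = if j == k then E i l else 0)
  (E1 : \sum_i E i i = 1)
  (cE : forall a, (forall i j, E i j * a = a * E i j) -> a \in 'Z({:B})%VS)
  (fZ : field_algebra (subvs_of 'Z({:B})%AS)).

(** The (i, j) entry of [a] with respect to the matrix units [E], as a scalar of [B]. *)
Let coef a i j := \sum_k E k i * a * E j k.

Fact coef_central a i j : coef a i j \in 'Z({:B})%VS.
Proof.
apply: cE => k l; rewrite mulr_suml mulr_sumr (bigD1 l) //= [RHS](bigD1 k) //=.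
rewrite !big1 => [|m mk|m ml].
- by rewrite !addr0 !mulrA EM eqxx -!mulrA EM eqxx.
- by rewrite -!mulrA EM (negPf mk) !mulr0.
- by rewrite !mulrA EM eq_sym (negPf ml) !mul0r.
Qed.

Lemma matrix2_algebra_units : matrix2_algebra B.
Proof.
have [L [g [h gK hK]]] := field_algebra_fieldExt fZ.
pose f (a : B) : 'M[L]_2 := \matrix_(i, j) h (Subvs (coef_central a i j)).
(* Equations between entries in [L] are checked in [B] through this injection. *)
pose iota (x : L) : B := vsval (g x).
have iotaI : injective iota by move=> x y /val_inj/(can_inj gK).
have fE a i j : iota (f a i j) = coef a i j by rewrite mxE /iota hK.
have iotaC x b : iota x * b = b * iota x.
  have := subvsP (g x); rewrite memv_cap => /andP[_ /centvP]; apply; exact: memvf.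
have iotaB : {morph iota : x y / x - y} by move=> x y; rewrite /iota !rmorphB.
have iotaD : {morph iota : x y / x + y} by move=> x y; rewrite /iota !rmorphD.
have iotaM : {morph iota : x y / x * y} by move=> x y; rewrite /iota rmorphM.
have iota0 : iota 0 = 0 by rewrite /iota !rmorph0.
have iota1 : iota 1 = 1.
  by rewrite /iota rmorph1 /= algid_center; apply/eqP; rewrite algid_eq1 memvf.
have iotaZ k : {morph iota : x / k *: x} by move=> x; rewrite /iota !linearZ.
have iotaS (F : 'I_2 -> L) : iota (\sum_i F i) = \sum_i iota (F i).
  exact: (big_morph iota iotaD iota0).
have fB : zmod_morphism f.
  move=> a b; apply/matrixP=> i j; apply: iotaI; rewrite !mxE iotaB.
  rewrite /iota !hK /= /coef -sumrB; apply: eq_bigr => k _.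
  by rewrite mulrBr mulrBl.
have fM : monoid_morphism f.
  split=> [|a b]; apply/matrixP=> i j; apply: iotaI; rewrite fE mxE /coef.
    have [->|ij] := eqVneq i j; last first.
      rewrite iota0 big1 // => k _.
      by rewrite mulr1 EM (negPf ij).
    rewrite /= iota1 -E1; apply: eq_bigr => k _.
    by rewrite E1 mulr1 EM eqxx.
  rewrite iotaS.
  (* Inserting 1 as the sum of the E l l between [a] and [b] produces the matrix product. *)
  transitivity (\sum_l \sum_k (E k i * a * E l l) * (b * E j k)).
    rewrite exchange_big; apply: eq_bigr => k _ /=.
    by rewrite -mulr_suml -mulr_sumr E1 mulr1 !mulrA.
  apply: eq_bigr => l _; rewrite iotaM !fE mulr_suml; apply: eq_bigr => k _.
  rewrite mulr_sumr (bigD1 k) //= big1 ?addr0 => [|m mk].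
    by rewrite !mulrA -[E k i * a * E l k * E k l]mulrA EM eqxx.
  rewrite !mulrA -[E k i * a * E l k * E m l]mulrA EM.
  by rewrite eq_sym (negPf mk) mulr0 !mul0r.
pose fR : {rmorphism B -> 'M[L]_2} := HB.pack f
  (GRing.isZmodMorphism.Build _ _ f fB) (GRing.isMonoidMorphism.Build _ _ f fM).
exists L, fR; split.
  exists (fun M : 'M[L]_2 => \sum_i \sum_j iota (M i j) * E i j).
    move=> a /=; rewrite -[RHS]mul1r -[RHS]mulr1 -{1}E1 -E1 mulr_suml mulr_suml.
    apply: eq_bigr => i _; rewrite mulr_sumr; apply: eq_bigr => j _.
    rewrite fE /coef mulr_suml (bigD1 i) //= big1 ?addr0 => [|k ki].
      by rewrite -!mulrA EM eqxx.
    by rewrite -!mulrA EM (negPf ki) !mulr0.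
  move=> M /=; apply/matrixP=> i j; apply: iotaI; rewrite fE /coef.
  transitivity (\sum_k iota (M i j) * E k k).
    apply: eq_bigr => k _.
    rewrite mulr_sumr mulr_suml (bigD1 i) //= [X in _ + X]big1 ?addr0 => [|l li].
      rewrite mulr_sumr mulr_suml (bigD1 j) //= big1 ?addr0 => [|l lj].
        rewrite [E k i * (_ * _)]mulrA -iotaC -!mulrA.
        by rewrite EM eqxx EM eqxx.
      by rewrite -!mulrA EM (negPf lj) !mulr0.
    rewrite mulr_sumr mulr_suml big1 // => m _.
    by rewrite mulrA -iotaC -!mulrA [E k i * _]mulrA EM eq_sym (negPf li) mul0r mulr0.
  by rewrite -mulr_sumr E1 mulr1.
move=> k a /=; apply/matrixP=> i j; apply: iotaI; rewrite [in RHS]mxE fE.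
rewrite -scalerAl mul1r iotaZ fE /coef scaler_sumr; apply: eq_bigr => l _.
by rewrite scalerAl scalerAr.
Qed.

End MatrixUnits.

Section SplitQuaternions.

Local Open Scope ring_scope.

Variables (K : fieldType) (B : falgType K) (z : B).
Hypotheses (two_neq0 : (2%:R : K) != 0) (cz : forall b, z * b = b * z)
  (zU : z \is a GRing.unit)
  (fZ : field_algebra (subvs_of 'Z({:B})%AS)).

(** The element x = z^(-n) w squares to 1, so p = (1 + x)/2 is idempotent. As [t] anticommutes with
    x, it interchanges p and q = 1 - p, and p, p t^-1, t p, q are matrix units. *)
Lemma matrix2_algebra_square_root (w t : B) (n m : nat) :
  w * w = z ^+ (n + n) -> t * t = z ^+ m -> w * t = - (t * w) ->
  (forall a, w * a = a * w -> t * a = a * t -> a \in 'Z({:B})%VS) ->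
  matrix2_algebra B.
Proof.
move=> ww tt wt cwt.
have tU : t \is a GRing.unit.
  by rewrite -(unitrX_pos t (n := 2)) // expr2 tt unitrX.
have ci b : z ^- n * b = b * z ^- n.
  exact/esym/commrV/commrX/esym/cz.
pose x := z ^- n * w.
have xx : x * x = 1.
  rewrite /x -mulrA [w * _]mulrA -[w * z ^- n]ci -[z ^- n * w * w]mulrA ww.
  by rewrite exprD mulKr ?unitrX // mulVr ?unitrX.
have xt : x * t = - (t * x).
  by rewrite /x -mulrA wt mulrN [z ^- n * (t * w)]mulrA ci mulrA.
pose p := 2%:R^-1 *: (1 + x).
have pp : p * p = p.
  rewrite /p -scalerAl -scalerAr scalerA mulrDl mul1r mulrDr mulr1 xx.
  rewrite [x + 1]addrC -mulr2n -scaler_nat scalerA -mulrA mulVf //.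
  by rewrite mulr1.
pose q := 1 - p.
have pq : p * q = 0 by rewrite mulrBr mulr1 pp subrr.
have qp : q * p = 0 by rewrite mulrBl mul1r pp subrr.
have qq : q * q = q by rewrite {1}/q mulrBl mul1r pq subr0.
have qE : q = 2%:R^-1 *: (1 - x).
  have h : p + 2%:R^-1 *: (1 - x) = 1.
    rewrite /p -scalerDr addrACA subrr addr0 -mulr2n -scaler_nat scalerA.
    by rewrite mulVf // scale1r.
  by rewrite /q -{1}h [p + _]addrC addrK.
have tp : t * p = q * t.
  rewrite qE /p -scalerAl -scalerAr mulrDr mulrBl mulr1 mul1r xt.
  by rewrite opprK.
have ptV : p * t^-1 = t^-1 * q.
  by apply: (mulrI tU); rewrite !mulrA tp divrr // mul1r mulrK.
have pt : p * t = t * q by rewrite mulrBr mulr1 tp mulrBl mul1r subKr.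
pose e (i j : 'I_2) := if i == 0 then (if j == 0 then p else p * t^-1)
                       else (if j == 0 then t * p else q).
have eM i j k l : e i j * e k l = if j == k then e i l else 0.
  have two (a : 'I_2) : {a = 0} + {a = 1}.
    by case: a => -[|[|//]] ka; [left|right]; apply: val_inj.
  rewrite /e; case: (two i) => ->; case: (two j) => ->; case: (two k) => ->;
    case: (two l) => -> /=.
  - by [].
  - by rewrite mulrA pp.
  - by rewrite tp mulrA pq mul0r.
  - by [].
  - by rewrite ptV -mulrA qp mulr0.
  - by rewrite {1}ptV -mulrA [q * _]mulrA qp mul0r mulr0.
  - by rewrite mulrA mulrVK.
  - by rewrite ptV -mulrA qq.
  - by rewrite -mulrA pp.
  - by rewrite mulrA -[t * p * p]mulrA pp tp mulrK.
  - by rewrite {2}tp mulrA -[t * p * q]mulrA pq mulr0 mul0r.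
  - by rewrite -mulrA pq mulr0.
  - by [].
  - by rewrite mulrA qp mul0r.
  - by rewrite tp mulrA qq.
  - by [].
apply: (matrix2_algebra_units eM) fZ.
  by rewrite !big_ord_recl big_ord0 addr0 /e /= addrC subrK.
move=> a ea; have ap : p * a = a * p := ea 0 0.
have at1 : t * p * a = a * (t * p) := ea 1 0.
have at2 : p * t^-1 * a = a * (p * t^-1) := ea 0 1.
have ctt : t * t * a = a * (t * t) by rewrite tt; apply/esym/commrX/esym/cz.
have ax : x * a = a * x.
  have -> : x = p + p - 1.
    rewrite /p -scalerDl -mulr2n -[X in X *: _](mulr_natl _ 2) mulfV //.
    by rewrite scale1r addrC addKr.
  by rewrite mulrBl mulrBr mulrDl mulrDr ap mul1r mulr1.
apply: cwt.
  have -> : w = z ^+ n * x by rewrite /x mulVKr ?unitrX.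
  rewrite -[LHS]mulrA ax [LHS]mulrA [RHS]mulrA; congr (_ * x).
  exact/esym/commrX/esym/cz.
(* Commuting with the matrix units gives commuting with [t], because t^2 is a power of the central
   [z]. *)
have -> : t = t * p + p * t^-1 * (t * t).
  by rewrite mulrA mulrVK // pt -mulrDr addrC subrK mulr1.
rewrite mulrDl mulrDr at1 -[_ * (t * t) * a]mulrA ctt.
by rewrite [_ * (a * _)]mulrA at2 !mulrA.
Qed.

Variables (u v : B) (h i j : nat).
Hypotheses (zh : z ^+ (h + h) = -1) (uu : u * u = z ^+ i) (vv : v * v = z ^+ j)
  (uv : u * v = - (v * u))
  (cuv : forall a, u * a = a * u -> v * a = a * v -> a \in 'Z({:B})%VS).

(* One of u^2, v^2 and (uv)^2 = - u^2 v^2 is an even power of z. *)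
Lemma matrix2_algebra_even : matrix2_algebra B.
Proof.
have evenE n : ~~ odd n -> n = (n./2 + n./2)%N.
  by move=> on; rewrite addnn -[LHS]odd_double_half (negPf on).
have uU : u \is a GRing.unit.
  by rewrite -(unitrX_pos u (n := 2)) // expr2 uu unitrX.
have [oi|/evenE ei] := boolP (odd i); last first.
  by apply: (matrix2_algebra_square_root (n := i./2) _ vv uv) => //; rewrite -ei.
have [oj|/evenE ej] := boolP (odd j); last first.
  apply: (matrix2_algebra_square_root (w := v) (n := j./2) _ uu) => [||a va ua].
  - by rewrite -ej.
  - by rewrite uv opprK.
  exact: cuv.
have /evenE eij : ~~ odd (i + j) by rewrite oddD oi oj.
(* The sign in (uv)^2 = - u^2 v^2 is written as z^(2h), so that (uv)^2 = z^(2h + i + j) with i + j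
   even. *)
apply: (matrix2_algebra_square_root (w := u * v) (n := (h + (i + j)./2)%N) _ uu).
- rewrite addnACA exprD zh -eij exprD mulN1r -uu -vv -[in LHS]mulrA.
  by rewrite [v * (u * v)]mulrA -[v * u]opprK -uv mulNr mulrN !mulrA.
- by rewrite -mulrA -[v * u]opprK -uv mulrN.
move=> a uva ua; apply: cuv => //; apply: (mulrI uU).
by rewrite !mulrA uva ua mulrA.
Qed.

End SplitQuaternions.

(** * Factors of X^(2^k) + 1 *)

Section Arithmetic.

Local Open Scope nat_scope.

(** For odd m also q^m = 3 mod 8, whose square is 1 plus an odd multiple of 8; each further squaring
    raises the 2-adic valuation of the difference from 1 by exactly one. *)
Lemma exp3mod8_even q a m : q = 3 %[mod 8] -> odd m ->
  exists2 r, odd r & q ^ (2 ^ a.+1 * m) = 1 + 2 ^ a.+3 * r.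
Proof.
move=> q3 om; elim: a => [|a [r or IH]].
  have qm : q ^ m = 3 %[mod 8].
    rewrite -modnXm q3 modnXm -[m]odd_double_half om -mul2n expnD expnM.
    by rewrite -modnMmr -modnXm exp1n.
  have E := divn_eq (q ^ m) 8; rewrite qm in E; set t := _ %/ _ in E.
  (* From (8t + 3)^2 = 1 + 8 (8t^2 + 6t + 1). *)
  exists (8 * t ^ 2 + 6 * t + 1); first by lia.
  by rewrite mulnC expnM E; lia.
exists (r + 2 ^ a.+2 * r ^ 2); first by rewrite oddD oddM oddX expnS oddM or.
have -> : 2 ^ a.+2 * m = 2 ^ a.+1 * m * 2 by rewrite expnS; lia.
by rewrite expnM IH !expnS; nia.
Qed.

(** For odd [d], q^d = 3 mod 4 excludes the divisibility. For even [d] the 2-adic valuation of q^d -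
    1 is that of [d] plus 2. The separate conclusion 2 | d carries the case k = 0. *)
Lemma order_mod_pow2 q k d : q = 3 %[mod 8] -> 0 < d ->
  2 ^ k.+2 %| q ^ d - 1 -> 2 %| d /\ 2 ^ k <= d.
Proof.
move=> q3 d0 dv.
have q0 : 0 < q by case: q q3 {dv}.
have evd : ~~ odd d.
  apply/negP => od; have : 4 %| q ^ d - 1.
    by apply: dvdn_trans dv; rewrite (dvdn_exp2l 2 (isT : 2 <= k.+2)).
  have : q ^ d = 3 %[mod 4].
    rewrite -[d]odd_double_half od -mul2n expnD expnM.
    have q4 : q = 3 %[mod 4].
      by rewrite -(modn_dvdm q (isT : 4 %| 8)) q3.
    by rewrite -modnMmr -modnXm -[q ^ 2 %% 4]modnXm q4 exp1n muln1.
  by move: (q ^ d) => X; lia.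
split; first by rewrite dvdn2.
have [m cm dE] := pfactor_coprime (isT : prime 2) d0.
have om : odd m by rewrite -coprime2n.
move: dE evd dv d0; case: (logn 2 d) => [|a] -> evd dv d0.
  by rewrite muln1 om in evd.
have [r or] := exp3mod8_even a q3 om; rewrite [2 ^ _ * m]mulnC => E.
move: dv; rewrite E addKn Gauss_dvdl ?coprimeXl ?coprime2n //.
rewrite dvdn_Pexp2l // !ltnS => ka.
apply: leq_trans (leq_pexp2l _ ka) _ => //.
by rewrite leq_pmull //; case: m om {cm evd d0 E}.
Qed.

End Arithmetic.

Section Polynomials.

Local Open Scope ring_scope.

Lemma size_XnaddC1 (R : nzRingType) n : (0 < n)%N ->
  size ('X^n + 1 : {poly R}) = n.+1.
Proof. by move=> n0; rewrite size_XnaddC. Qed.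

(** A primitive root of unity of order 2^(k+1) is a root, and its minimal polynomial, the cyclotomic
    one, has degree totient(2^(k+1)) = 2^k. *)
Lemma irreducible_rat_XnaddC k : irreducible_poly ('X^(2 ^ k) + 1 : {poly rat}).
Proof.
have [z pz] := C_prim_root_exists (expn_gt0 2 k.+1 : (0 < 2 ^ k.+1)%N).
have zn : z ^+ (2 ^ k) = -1.
  have : (z ^+ (2 ^ k)) ^+ 2 == 1 by rewrite -exprM -expnSr prim_expr_order.
  rewrite sqrf_eq1 => /orP[|/eqP //]; rewrite -(prim_order_dvd pz).
  by rewrite dvdn_Pexp2l // ltnn.
have rz : root (map_poly ratr ('X^(2 ^ k) + 1)) z.
  by rewrite rmorphD rmorph1 rmorphXn /= map_polyX rootE !hornerE zn addNr.
have p0 : 'X^(2 ^ k) + 1 != 0 :> {poly rat}.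
  by rewrite -size_poly_gt0 size_XnaddC1 ?expn_gt0.
apply/(subfx_irreducibleP rz p0) => q rq q0.
have [p [pE _ pdvd]] := minCpolyP z.
have sp : size p = (2 ^ k).+1.
  rewrite -(size_map_poly (ratr : {rmorphism rat -> algC})) /= -pE.
  rewrite (minCpoly_cyclotomic pz) size_cyclotomic.
  by rewrite totient_pfactor // mul1n.
rewrite size_XnaddC1 ?expn_gt0 // -sp; apply: dvdp_leq => //.
by rewrite -pdvd.
Qed.

(** The field K(z) has #|K|^d elements, d being the degree of [z]. This bounds d below by the order
    of #|K| modulo the order of [z]. *)
Lemma adjoin_expf_card (K : finFieldType) (E : fieldExtType K) (z : E) :
  z ^+ (#|K| ^ adjoin_degree 1 z) = z.
Proof.
pose S := subvs_of <<1; z>>%AS; pose F := finvect_type S.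
pose w : S := Subvs (memv_adjoin 1 z).
have cF : #|F| = (#|K| ^ adjoin_degree 1 z)%N.
  rewrite -(card_vspacef (Vector.class (F : vectType K))) card_vspace.
  congr (_ ^ _)%N; transitivity (\dim <<1; z>>%VS); first by rewrite dimvf.
  by rewrite dim_Fadjoin dimv1 muln1.
have := expf_card (w : F); rewrite cF => /(congr1 (vsval : S -> E)).
by rewrite rmorphXn.
Qed.

(** A root of [f] has order exactly 2^(k+1), as its 2^k-th power is -1, which differs from 1. If d
    is its degree over [K], then 2^(k+1) divides #|K|^d - 1, so d reaches the degree [n] of [f]. *)
Lemma irreducible_order_pow2 (K : finFieldType) (f : {poly K}) n k :
  (2%:R : K) != 0 ->
  size f = n.+1 -> (0 < n)%N -> f %| 'X^(2 ^ k) + 1 ->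
  (forall d, (0 < d)%N -> (2 ^ k.+1 %| #|K| ^ d - 1)%N -> (n <= d)%N) ->
  irreducible_poly f.
Proof.
move=> two0 sf n0 df ord.
have f0 : f != 0 by rewrite -size_poly_gt0 sf.
have [E [rs frs _]] := FinSplittingFieldFor f0.
have [z rz] : exists z, root (map_poly (in_alg E) f) z.
  case: rs frs => [|z rs] frs.
    move/eqp_size: frs; rewrite big_nil size_map_poly size_poly1 sf.
    by case: n n0 {sf ord}.
  by exists z; rewrite (eqp_root frs) big_cons rootM root_XsubC eqxx.
have zn : z ^+ (2 ^ k) = -1.
  have /dvdpP[g gE] := df; have := congr1 (fun p => (map_poly (in_alg E) p).[z]) gE.
  rewrite rmorphM /= hornerM (rootP rz) mulr0 rmorphD rmorph1 rmorphXn /= map_polyX.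
  by rewrite !hornerE => /eqP; rewrite addr_eq0 => /eqP.
apply/(subfx_irreducibleP rz f0) => q rq q0.
apply: leq_trans (_ : size (minPoly 1 z) <= _)%N; last first.
  rewrite -(size_map_poly (in_alg E)) dvdp_leq ?map_poly_eq0 //.
  by apply: minPoly_dvdp => //; apply: alg_polyOver.
rewrite sf size_minPoly ltnS; apply: ord => //.
have zz : z ^+ (2 ^ k.+1) = 1 by rewrite expnSr exprM zn expr2 mulrNN mulr1.
have [m pm mdvd] := prim_order_exists (expn_gt0 2 k.+1 : (0 < 2 ^ k.+1)%N) zz.
have -> : (2 ^ k.+1)%N = m.
  have /(dvdn_pfactor _ _ (isT : prime 2))[j jk mE] := mdvd.
  move: jk; rewrite mE leq_eqVlt => /orP[/eqP -> //|]; rewrite ltnS => jk.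
  have : z ^+ (2 ^ k) == 1 by rewrite -(prim_order_dvd pm) mE dvdn_exp2l.
  rewrite zn eq_sym -subr_eq0 opprK -mulr2n.
  by rewrite -(rmorph_nat (in_alg E)) fmorph_eq0 (negPf two0).
have z0 : z != 0.
  apply/eqP => z0; move/eqP: zn; rewrite z0 expr0n expn_eq0 /= eq_sym oppr_eq0.
  by rewrite oner_eq0.
rewrite (prim_order_dvd pm) -subr_eq0 -(mulrI_eq0 _ (mulfI z0)) mulrBr -exprS.
rewrite subn1 prednK ?expn_gt0 ?(ltnW (finNzRing_gt1 K)) //.
by rewrite adjoin_expf_card mulr1 subrr.
Qed.

(** The unit group is cyclic, so a product of two nonsquares is a square. The case of interest is a
    = -1, b = 2. *)
Lemma finField_square_trichotomy (K : finFieldType) (a b : K) :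
  a != 0 -> b != 0 -> exists c, [\/ c * c = a, c * c = b | c * c = a * b].
Proof.
move=> a0 b0; have [g gE] := cyclicP (field_unit_group_cyclic [set: {unit K}]%G).
have pow x : x != 0 -> exists n, x = val g ^+ n.
  move=> x0; have xU : x \is a GRing.unit by rewrite unitfE.
  have /cycleP[n xn] : FinRing.unit K xU \in <[g]>%g by rewrite -gE inE.
  by exists n; have /(congr1 val) := xn; rewrite /= FinRing.val_unitX.
have sq n : ~~ odd n -> exists c : K, c * c = val g ^+ n.
  move=> on; exists (val g ^+ n./2); rewrite -exprD addnn.
  by rewrite -[in RHS](odd_double_half n) (negPf on).
have [n ->] := pow a a0; have [m ->] := pow b b0.
have [on|/sq[c cE]] := boolP (odd n); last by exists c; constructor 1.
have [om|/sq[c cE]] := boolP (odd m); last by exists c; constructor 2.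
have [|c cE] := sq (n + m)%N; first by rewrite oddD on om.
by exists c; constructor 3; rewrite cE exprD.
Qed.

(* A factor of X^(4n) + 1 when c^2 = 2 (b = 1) or c^2 = -2 (b = -1). *)
Definition quartic_factor (K : fieldType) (c b : K) (n : nat) : {poly K} :=
  'X^(n + n) - c *: 'X^n + b%:P.

(** With y = X^n: (y^2 + c y + b)(y^2 - c y + b) = y^4 + (2b - c^2) y^2 + b^2. *)
Lemma quartic_factor_dvd (K : fieldType) (c b : K) n :
  b * b = 1 -> c * c = b + b ->
  quartic_factor c b n %| 'X^(n + n + (n + n)) + 1.
Proof.
move=> bb cc; apply/dvdpP; exists ('X^(n + n) + c *: 'X^n + b%:P).
rewrite /quartic_factor !exprD; set y := 'X^n.
rewrite -!mul_polyC; have -> : 1 = b%:P * b%:P by rewrite -polyCM bb.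
have cc' : c%:P * c%:P = b%:P + b%:P by rewrite -polyCM cc polyCD.
have -> : (y * y + c%:P * y + b%:P) * (y * y - c%:P * y + b%:P) =
  y * y * (y * y) + (b%:P + b%:P - c%:P * c%:P) * (y * y) + b%:P * b%:P by ring.
by rewrite cc' subrr mul0r addr0.
Qed.

Lemma size_quartic_factor (K : fieldType) (c b : K) n :
  (0 < n)%N -> size (quartic_factor c b n) = (n + n).+1.
Proof.
move=> n0; rewrite /quartic_factor -addrA size_polyDl size_polyXn //.
rewrite ltnS; apply: leq_trans (size_polyD _ _) _; rewrite geq_max size_polyN.
rewrite (leq_trans (size_scale_leq _ _)) ?size_polyXn /=; last by lia.
by rewrite (leq_trans (size_polyC_leq1 _)) //; lia.
Qed.

End Polynomials.

(** * Idempotents of subgroups with cyclic quotient *)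

Section SubgroupAverages.

Local Open Scope ring_scope.

Variables (K : fieldType) (gT : finGroupType).
Hypothesis cardG_neq0 : (#|[set: gT]|%:R : K) != 0.

Local Notation A := (group_algebra K gT).
Local Notation delta g := (ga_delta K g : A).
Implicit Types (g h : gT) (a b : A) (C D H P : {group gT}).

Definition hat (H : {set gT}) : A := #|H|%:R^-1 *: \sum_(h in H) delta h.

Lemma ga_sum_delta a : a = \sum_g (a g : K) *: delta g.
Proof.
apply/ffunP=> h; rewrite sum_ffunE (bigD1 h) //= !ffunE eqxx.
rewrite big1 ?addr0; first by rewrite [_ *: _]mulr1.
move=> g gh; rewrite !ffunE eq_sym (negPf gh); exact: mulr0.
Qed.

Lemma ga_central_delta a : (forall g, delta g * a = a * delta g) ->
  forall b, a * b = b * a.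
Proof.
move=> ca b; rewrite (ga_sum_delta b) mulr_sumr mulr_suml.
by apply: eq_bigr => g _; rewrite -scalerAl -scalerAr ca.
Qed.

Lemma natr_cardG_neq0 H : (#|H|%:R : K) != 0.
Proof.
apply: contraNneq cardG_neq0 => H0.
have /dvdnP[n ->] := cardSg (subsetT H).
by rewrite natrM H0 mulr0.
Qed.

Lemma hatE (H : {set gT}) g : hat H g = if g \in H then #|H|%:R^-1 else 0 :> K.
Proof.
rewrite !ffunE sum_ffunE; have [gH|gH] := boolP (g \in H).
  rewrite (bigD1 g) //= !ffunE eqxx big1 ?addr0; first exact: mulr1.
  by move=> h /andP[_ hg]; rewrite !ffunE eq_sym (negPf hg).
rewrite big1; first exact: mulr0.
by move=> h hH; rewrite !ffunE; case: eqP gH => // ->; rewrite hH.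
Qed.

Lemma hat_deltal H h : h \in H -> delta h * hat H = hat H.
Proof.
move=> hH; rewrite /hat -scalerAr mulr_sumr; congr (_ *: _).
rewrite [RHS](reindex_inj (mulgI h)) /=; apply: eq_big => [g|g _].
  by rewrite groupMl.
by rewrite ga_deltaM.
Qed.

Lemma hat_deltar H h : h \in H -> hat H * delta h = hat H.
Proof.
move=> hH; rewrite /hat -scalerAl mulr_suml; congr (_ *: _).
rewrite [RHS](reindex_inj (mulIg h)) /=; apply: eq_big => [g|g _].
  by rewrite groupMr.
by rewrite ga_deltaM.
Qed.

Lemma hat_fixed_mull H a : (forall h, h \in H -> delta h * a = a) ->
  hat H * a = a.
Proof.
move=> ha; rewrite /hat -scalerAl mulr_suml (eq_bigr (fun=> a)) //.
by rewrite sumr_const -scaler_nat scalerA mulVf ?scale1r ?natr_cardG_neq0.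
Qed.

Lemma hat_fixed_mulr H a : (forall h, h \in H -> a * delta h = a) ->
  a * hat H = a.
Proof.
move=> ha; rewrite /hat -scalerAr mulr_sumr (eq_bigr (fun=> a)) //.
by rewrite sumr_const -scaler_nat scalerA mulVf ?scale1r ?natr_cardG_neq0.
Qed.

Lemma hat_subl H P : H \subset P -> hat H * hat P = hat P.
Proof. by move/subsetP=> HP; apply: hat_fixed_mull => h /HP/hat_deltal. Qed.

Lemma hat_subr H P : H \subset P -> hat P * hat H = hat P.
Proof. by move/subsetP=> HP; apply: hat_fixed_mulr => h /HP/hat_deltar. Qed.

Lemma hat1 : hat 1%g = 1.
Proof. by rewrite /hat cards1 invr1 scale1r big_set1. Qed.

Lemma hat_neq0 H : hat H != 0.
Proof.
apply/eqP => /ffunP/(_ 1%g)/eqP; rewrite hatE group1 ffunE /= invr_eq0.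
by rewrite (negPf (natr_cardG_neq0 _)).
Qed.

Lemma hat_delta_comm H g : (H <| [set: gT])%g -> delta g * hat H = hat H * delta g.
Proof.
case/andP=> _ /subsetP/(_ g (in_setT g)) gN.
rewrite /hat -scalerAl -scalerAr mulr_suml mulr_sumr; congr (_ *: _).
rewrite (reindex_inj (conjg_inj g)) /=; apply: eq_big => [h|h _].
  by rewrite memJ_norm.
by rewrite !ga_deltaM conjgE !mulgA mulgV mul1g.
Qed.

Lemma hat_central H a : (H <| [set: gT])%g -> hat H * a = a * hat H.
Proof. by move=> nH; apply: ga_central_delta => g; apply: hat_delta_comm. Qed.

Lemma hat_join C D : (C <| [set: gT])%g -> (D <| [set: gT])%g ->
  hat C * hat D = hat (C <*> D)%g.
Proof.
move=> nC nD; transitivity (hat (C <*> D)%g * (hat C * hat D)).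
  apply/esym/hat_fixed_mull => h; rewrite /= norm_joinEr; last first.
    by case/andP: nC => _; apply: subset_trans (subsetT _).
  case/mulsgP=> c d cC dD ->; rewrite -ga_deltaM -mulrA [delta d * _]mulrA.
  by rewrite hat_delta_comm // -mulrA hat_deltal // mulrA hat_deltal.
by rewrite mulrA hat_subr ?joing_subl // hat_subr ?joing_subr.
Qed.

Lemma index2_rcoset H P z : H \subset P -> #|P : H|%g = 2 -> z \in P ->
  z \notin H -> P = (H :|: H :* z)%g :> {set gT}.
Proof.
move=> HP iHP zP zH; apply/esym/eqP; rewrite eqEcard; apply/andP; split.
  apply/subsetP => g /setUP[/(subsetP HP) //|/rcosetP[h hH ->]].
  by rewrite groupM //; apply: (subsetP HP).
rewrite -(Lagrange HP) iHP cardsU card_rcoset.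
rewrite (_ : _ :&: _ = set0) ?cards0 ?subn0 ?muln2 ?addnn //.
apply/setP=> g; rewrite !inE; apply/negP => /andP[gH /rcosetP[h hH gE]].
by case/negP: zH; rewrite -(groupMl z hH) -gE.
Qed.

Lemma index2_square H P z : H \subset P -> #|P : H|%g = 2 -> z \in P ->
  z \notin H -> (z * z)%g \in H.
Proof.
move=> HP iHP zP zH; have : (z * z)%g \in P by rewrite groupM.
rewrite (index2_rcoset HP iHP zP zH) => /setUP[//|/rcosetP[h hH /mulIg zh]].
by rewrite -zh (negPf zH) in hH.
Qed.

(** Lets an equation hat P * a = 0 be read as: [z] acts as -1 on hat H * a. *)
Lemma hat_double H P z : H \subset P -> #|P : H|%g = 2 -> z \in P ->
  z \notin H -> (H <| [set: gT])%g ->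
  hat P = 2%:R^-1 *: (hat H * (1 + delta z)).
Proof.
move=> HP iHP zP zH nH; have PE := index2_rcoset HP iHP zP zH.
have zz := index2_square HP iHP zP zH.
have two0 : (2%:R : K) != 0.
  apply: contraNneq (natr_cardG_neq0 P) => two0.
  by rewrite -(Lagrange HP) iHP natrM two0 mulr0.
transitivity (hat P * (2%:R^-1 *: (hat H * (1 + delta z)))); last first.
  apply: hat_fixed_mull => g; rewrite PE -scalerAr => gP; congr (_ *: _).
  rewrite mulrA; case/setUP: gP => [gH|/rcosetP[h hH ->]].
    by rewrite hat_deltal.
  rewrite -ga_deltaM -[delta h * _ * _]mulrA hat_delta_comm // mulrA hat_deltal //.
  rewrite -mulrA mulrDr mulr1 ga_deltaM !mulrDr mulr1 addrC.
  by rewrite (hat_deltar zz).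
rewrite -scalerAr mulrA hat_subr // mulrDr mulr1 hat_deltar //.
by rewrite -mulr2n -scaler_nat scalerA mulVf ?scale1r.
Qed.

End SubgroupAverages.

Section CocyclicSubgroups.

Local Open Scope group_scope.

Variables (gT : finGroupType).
Implicit Types (B C D M : {group gT}).

Definition cocyclic B M : {set {group gT}} :=
  [set C : {group gT} | [&& M \subset C, C <| B & cyclic (B / C)]].

(* The least subgroup of [B] properly containing [C], if [C != B] and [B / C] is
   a cyclic 2-group. *)
Definition overgroup B C : {group gT} := (coset C @*^-1 'Ohm_1(B / C))%G.

Lemma overgroup_sub B C : C \subset overgroup B C.
Proof. exact: sub_cosetpre. Qed.

Lemma overgroup_subl B C : C <| B -> overgroup B C \subset B.
Proof.
move=> nCB; apply: (@subset_trans _ _ (coset C @*^-1 (B / C))).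
  by rewrite morphpreS // Ohm_sub.
by rewrite quotientGK.
Qed.

Section CyclicQuotient.

Variables B C : {group gT}.
Hypotheses (pB : 2.-group B) (nCB : C <| B) (cBC : cyclic (B / C)).

Lemma mem_overgroup z : z \in B -> z ^+ 2 \in C -> z \in overgroup B C.
Proof.
move=> zB zC; have zN : z \in 'N(C) by apply: (subsetP (normal_norm nCB)).
rewrite mem_morphpre //= (OhmE 1 (quotient_pgroup C pB)).
apply: mem_gen; rewrite inE mem_quotient //=.
rewrite inE expn1 -(morphX (coset_morphism C)) //.
by rewrite /= coset_id.
Qed.

Hypothesis neCB : C != B.

Lemma overgroup_index : #|overgroup B C : C| = 2.
Proof.
rewrite -card_quotient; last first.
  exact: subset_trans (overgroup_subl nCB) (normal_norm nCB).
rewrite cosetpreK; apply: (Ohm1_cyclic_pgroup_prime cBC (quotient_pgroup C pB)).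
apply: contraNneq neCB => BC; apply/eqP/val_inj => /=; apply/eqP.
by rewrite eqEsubset normal_sub //= -quotient_sub1 ?normal_norm // BC.
Qed.

(** D / C is a nontrivial subgroup of a cyclic 2-group, so its elements of order at most 2 already
    form the subgroup of order 2 of B / C. *)
Lemma overgroup_min D : C \subset D -> D \subset B -> C != D ->
  overgroup B C \subset D.
Proof.
move=> CD DB neCD; have nCD : C <| D := normalS CD DB nCB.
have sDB : D / C \subset B / C by apply: quotientS.
have D1 : D / C != 1.
  apply: contraNneq neCD => DC; apply/eqP/val_inj => /=; apply/eqP.
  by rewrite eqEsubset CD /= -quotient_sub1 ?normal_norm // DC.
have pD : 2.-group (D / C) := pgroupS sDB (quotient_pgroup C pB).
have B1 : B / C != 1 by apply: contraNneq D1 => BC; rewrite -subG1 -BC.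
have OE : 'Ohm_1(D / C) = 'Ohm_1(B / C).
  apply/eqP; rewrite eqEcard OhmS //=.
  rewrite (Ohm1_cyclic_pgroup_prime cBC (quotient_pgroup C pB)) //.
  by rewrite (Ohm1_cyclic_pgroup_prime (cyclicS sDB cBC) pD).
rewrite -(quotientGK nCD) /= morphpreS // -OE; exact: Ohm_sub.
Qed.

End CyclicQuotient.

(** Lifts of generators of a Klein four-group in B / C. Three involutions with product 1 cannot all
    act as -1, which is how [hat_sum_cocyclic] treats noncyclic quotients. *)
Lemma noncyclic_two_involutions B C : 2.-group B -> C <| B ->
  abelian (B / C) -> ~~ cyclic (B / C) ->
  exists x y, [/\ x \in B :\: C, y \in B :\: C, x * y \notin C,
                  x ^+ 2 \in C & y ^+ 2 \in C /\ (x * y) ^+ 2 \in C].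
Proof.
move=> pB nCB aBC ncBC; have pBC : 2.-group (B / C) := quotient_pgroup C pB.
have r2 : 2 <= 'r_2(B / C).
  by move: ncBC; rewrite (abelian_rank1_cyclic aBC) -ltnNge (rank_pgroup pBC).
have [E] := p_rank_geP r2.
rewrite pnElemE // inE => /andP[/pElemP[sEB aE] /eqP cE].
have ntE : E != 1%G.
  by apply: contraTneq isT => E1; move: cE; rewrite E1 cards1.
have [X XE X1] := trivgPn _ ntE.
have : ~~ (E \subset <[X]>).
  apply/negP => /subset_leq_card; rewrite cE -orderE.
  by rewrite (abelem_order_p aE XE X1).
case/subsetPn => Y YE YX.
have Y1 : Y != 1 by apply: contraNneq YX => ->; rewrite group1.
have XY1 : X * Y != 1.
  by apply: contraNneq YX => /eqP; rewrite -eq_invg_mul => /eqP <-; rewrite groupV cycle_id.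
have lift Z : Z \in E -> exists2 z, z \in B & z \in 'N(C) /\ Z = coset C z.
  by move/(subsetP sEB)/morphimP => [z zN zB ->]; exists z.
have [x xB [xN xE]] := lift X XE; have [y yB [yN yE]] := lift Y YE.
have sq z : z \in 'N(C) -> coset C z \in E -> z ^+ 2 \in C.
  move=> zN zE; apply: coset_idr; rewrite ?groupX // morphX //.
  have [_ ->] := abelemP (isT : prime 2) aE => //.
exists x, y; split.
- rewrite inE xB andbT; apply: contraNN X1 => /coset_id h.
  by rewrite xE h.
- rewrite inE yB andbT; apply: contraNN Y1 => /coset_id h.
  by rewrite yE h.
- by apply: contraNN XY1 => /coset_id h; rewrite xE yE -morphM //= h.
- by apply: sq; rewrite -?xE.
split; first by apply: sq; rewrite -?yE.
by apply: sq; rewrite ?groupM // morphM //= -xE -yE groupM.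
Qed.

End CocyclicSubgroups.

Section CocyclicIdempotents.

Local Open Scope ring_scope.

Variables (K : fieldType) (gT : finGroupType).
Hypotheses (two_neq0 : (2%:R : K) != 0) (pG : (2.-group [set: gT])%g).

Local Notation A := (group_algebra K gT).
Local Notation delta g := (ga_delta K g : A).
Local Notation hat := (hat K).
Implicit Types (g h z : gT) (a b : A) (C D H P : {group gT}).

Lemma cardG_neq0 : (#|[set: gT]|%:R : K) != 0.
Proof.
have [n ->] := p_natP pG.
by rewrite natrX expf_neq0.
Qed.

Variables (B M : {group gT}).
(** Satisfied by B = G with M = G', and by B = Z(G) with M = 1; normality in the whole group is what
    makes the averages central. *)
Hypotheses (sMB : M \subset B) (dB : (B^`(1) \subset M)%g)
  (nMB : forall C, M \subset C -> C \subset B -> (C <| [set: gT])%g).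

Definition cocyclic_idem C : A :=
  if C == B then hat B else hat C - hat (overgroup B C).
Local Notation e := cocyclic_idem.
Local Notation cocyclic := (cocyclic B M).

Let pB : (2.-group B)%g. Proof. exact: pgroupS (subsetT B) pG. Qed.

Lemma cocyclicP C : C \in cocyclic ->
  [/\ M \subset C, C \subset B, (C <| B)%g & cyclic (B / C)%g].
Proof. by rewrite inE => /and3P[MC nCB cBC]; split=> //; apply: normal_sub. Qed.

Lemma overgroup_normal C : C \in cocyclic -> (overgroup B C <| [set: gT])%g.
Proof.
case/cocyclicP => MC _ nCB _; apply: nMB (overgroup_subl nCB).
exact: subset_trans MC (overgroup_sub B C).
Qed.

Lemma cocyclic_normal C : C \in cocyclic -> (C <| [set: gT])%g.
Proof. by case/cocyclicP => MC CB _ _; apply: nMB. Qed.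

(** If D is not inside C, the join of D and C properly contains C, hence contains its overgroup; the
    two terms of [e C] then have equal products with [hat D] and cancel. *)
Lemma hat_cocyclic_idem C D : C \in cocyclic -> M \subset D -> D \subset B ->
  hat D * e C = if D \subset C then e C else 0.
Proof.
move=> cC MD DB; have [MC CB nCB cBC] := cocyclicP cC.
have nD := nMB MD DB; have nC := cocyclic_normal cC.
rewrite /e; case: eqP => [->|/eqP neCB]; first by rewrite DB (hat_subl cardG_neq0 DB).
have nO := overgroup_normal cC.
have CO := overgroup_sub B C.
case: ifP => [DC|/negbT nDC]; rewrite mulrBr.
  by rewrite !(hat_subl cardG_neq0) // (subset_trans DC).
rewrite !(hat_join cardG_neq0) //; apply/eqP; rewrite subr_eq0.
suff -> : (D <*> C = D <*> overgroup B C)%g by [].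
apply/eqP; rewrite eqEsubset genS ?setUS //= join_subG joing_subl /=.
apply: overgroup_min; rewrite ?joing_subr ?join_subG ?DB //.
by apply: contraNneq nDC => CE; rewrite CE joing_subl.
Qed.

Lemma cocyclic_idem_delta C c : C \in cocyclic -> c \in C ->
  delta c * e C = e C.
Proof.
move=> cC cc; have [_ CB nCB cBC] := cocyclicP cC.
rewrite /e; case: eqP => [CE|_]; first by rewrite (hat_deltal _) // -CE.
rewrite mulrBr !hat_deltal //; exact: (subsetP (overgroup_sub B C)).
Qed.

(** With O the overgroup, 2 hat O = hat C + z hat C, so z (hat C - hat O) = hat O - hat C. *)
Lemma cocyclic_idem_delta_overgroup C z : C \in cocyclic -> C != B ->
  z \in overgroup B C -> z \notin C -> delta z * e C = - e C.
Proof.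
move=> cC neCB zO zC; have [MC CB nCB cBC] := cocyclicP cC.
have nC := cocyclic_normal cC; have iO := overgroup_index pB nCB cBC neCB.
have CO := overgroup_sub B C.
have OE : hat (overgroup B C) + hat (overgroup B C) = hat C + delta z * hat C.
  rewrite {1 2}(hat_double cardG_neq0 CO iO zO zC nC) -mulr2n -scaler_nat scalerA.
  by rewrite mulfV // scale1r mulrDr mulr1 hat_delta_comm.
rewrite /e (negPf neCB) mulrBr opprB (hat_deltal _ zO).
by apply/eqP; rewrite subr_eq addrAC OE addrC addKr.
Qed.

Lemma cocyclic_idem_central C : C \in cocyclic -> central_idempotent (e C).
Proof.
move=> cC; have [MC CB nCB cBC] := cocyclicP cC.
have nC := cocyclic_normal cC; have nO := overgroup_normal cC.
split=> [|a|].
- rewrite {1}/e; case: eqP => [CE|/eqP neCB].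
    by rewrite (hat_cocyclic_idem cC) // -CE subxx.
  rewrite mulrBl !(hat_cocyclic_idem cC) ?subxx //.
  + case: ifP => [OC|]; last by rewrite subr0.
    have := overgroup_index pB nCB cBC neCB.
    by move: OC; rewrite -indexg_eq1 => /eqP ->.
  + exact: subset_trans MC (overgroup_sub B C).
  exact: overgroup_subl.
- rewrite /e; case: eqP => [CE|_]; first by rewrite hat_central // -CE.
  by rewrite mulrBl mulrBr !hat_central.
rewrite /e; have [_|neCB] := eqVneq C B; first by apply: hat_neq0; apply: cardG_neq0.
apply/eqP => e0; have := overgroup_index pB nCB cBC neCB.
have : (overgroup B C \subset C).
  apply/subsetP => z zO; apply/negPn/negP => zC.
  have /ffunP/(_ z)/eqP := e0; rewrite ffunE [X in _ + X]ffunE !hatE zO (negPf zC) add0r.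
  by rewrite ffunE oppr_eq0 invr_eq0 (negPf (natr_cardG_neq0 cardG_neq0 _)).
by rewrite -indexg_eq1 => /eqP ->.
Qed.

Lemma cocyclic_idem_orth C D : C \in cocyclic -> D \in cocyclic -> C != D ->
  e C * e D = 0.
Proof.
(* Of two different subgroups one is not contained in the other, and centrality makes the order of
   the factors irrelevant. *)
suff H C1 D1 : C1 \in cocyclic -> D1 \in cocyclic -> ~~ (D1 \subset C1) ->
    e D1 * e C1 = 0.
  move=> cC cD neCD; have [DC|nDC] := boolP (D \subset C).
    apply: H => //; apply: contraNN neCD => CD.
    by apply/eqP/val_inj/eqP; rewrite eqEsubset CD.
  by have [_ -> _] := cocyclic_idem_central cC; apply: H.
move=> cC cD nDC; have [MC CB nCB cBC] := cocyclicP cC.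
have [MD DB nDB cBD] := cocyclicP cD.
rewrite {1}/e; case: eqP => [DE|_].
  by rewrite (hat_cocyclic_idem cC) // -DE (negPf nDC).
have MO : M \subset overgroup B D1 := subset_trans MD (overgroup_sub B D1).
rewrite mulrBl !(hat_cocyclic_idem cC) ?overgroup_subl //.
rewrite (negPf nDC) ifN ?subr0 //.
by apply: contraNN nDC; apply: subset_trans (overgroup_sub B D1).
Qed.

(** Induction from larger to smaller [H]. If B / H is cyclic, hat H is e H plus the average of the
    overgroup. Otherwise F = hat H (1 - E) is negated by each of two involutions of B / H and by
    their product, so F = -F. *)
Lemma hat_sum_cocyclic H : M \subset H -> H \subset B ->
  hat H * (\sum_(C in cocyclic) e C) = hat H.
Proof.
set E := \sum_(C in _) _; move: {2}(#|B| - #|H|).+1%N (ltnSn (#|B| - #|H|)%N) => n.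
elim: n H => // n IHn H le_n MH HB.
have nH := nMB MH HB; have nHB : (H <| B)%g by apply: normalS nH; rewrite ?subsetT.
have IH P : H \subset P -> P \subset B -> ~~ (P \subset H) -> hat P * E = hat P.
  move=> HP PB nPH; apply: IHn => //; last exact: subset_trans HP.
  have lt_HP : (#|H| < #|P|)%N by apply: proper_card; rewrite properE HP.
  by apply: leq_trans (le_n : (_ <= n)%N); rewrite ltn_sub2l // (leq_trans lt_HP) ?subset_leq_card.
have [cBH|ncBH] := boolP (cyclic (B / H)%g).
  have cH : H \in cocyclic by rewrite inE MH nHB cBH.
  have eE : e H * E = e H.
    rewrite /E mulr_sumr (bigD1 H) //= big1 ?addr0.
      by have [] := cocyclic_idem_central cH.
    by move=> C /andP[cC CH]; rewrite cocyclic_idem_orth // eq_sym.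
  move: eE; rewrite /e; case: eqP => [-> //|/eqP neHB]; rewrite mulrBl.
  rewrite (IH (overgroup B H)) ?overgroup_sub ?overgroup_subl //.
    by move/(congr1 (fun a => a + hat (overgroup B H))); rewrite !subrK.
  by rewrite -indexg_eq1 (overgroup_index pB nHB cBH neHB).
have aBH : abelian (B / H)%g by apply: sub_der1_abelian (subset_trans dB MH).
have [x [y [xB yB xyB xx]]] := noncyclic_two_involutions pB nHB aBH ncBH.
move=> [yy xyxy]; set F := hat H * (1 - E).
suff F0 : F = 0 by apply/eqP; rewrite eq_sym -subr_eq0 -[X in X - _]mulr1 -mulrBr -/F F0.
have neg z : z \in B :\: H -> (z ^+ 2)%g \in H -> delta z * F = - F.
  case/setDP => zB zH zz; pose P := (H <*> <[z]>)%G.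
  have HP : H \subset P by apply: joing_subl.
  have zP : z \in P by rewrite mem_gen // inE cycle_id orbT.
  have PB : P \subset B by rewrite join_subG HB cycle_subG.
  have zN : z \in ('N(H))%g by apply: (subsetP (normal_norm nHB)).
  have iP : #|P : H|%g = 2.
    rewrite -card_quotient ?join_subG ?normG ?cycle_subG //=.
    rewrite quotientYidl ?cycle_subG // quotient_cycle // -orderE.
    apply: nt_prime_order => //; first by rewrite -(morphX (coset_morphism H)) //= coset_id.
    by apply: contraNneq zH => h; apply: coset_idr zN h.
  have : hat P * (1 - E) = 0.
    rewrite mulrBr mulr1 (IH P) ?subrr //.
    by apply/subsetPn; exists z.
  rewrite (hat_double cardG_neq0 HP iP zP zH nH) -scalerAl => /eqP.
  rewrite scaler_eq0 invr_eq0 (negPf two_neq0) /=.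
  rewrite [hat H * (1 + _)]mulrDr mulr1 mulrDl.
  by rewrite -hat_delta_comm // -mulrA -/F addrC addr_eq0 => /eqP.
have xyBH : (x * y)%g \in B :\: H.
  by rewrite inE xyB; case/setDP: xB => xB _; case/setDP: yB => yB _; rewrite groupM.
have := neg _ xyBH xyxy; rewrite -ga_deltaM -mulrA (neg y) // mulrN (neg x) //.
rewrite opprK => FF; apply/eqP; move/eqP: FF; rewrite -addr_eq0 -mulr2n -scaler_nat.
by rewrite scaler_eq0 (negPf two_neq0).
Qed.

Lemma sum_cocyclic_idem : \sum_(C in cocyclic) e C = hat M.
Proof.
rewrite -(hat_sum_cocyclic (subxx M) sMB) mulr_sumr; apply: eq_bigr => C cC.
have [MC _ _ _] := cocyclicP cC.
by rewrite hat_cocyclic_idem // MC.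
Qed.

End CocyclicIdempotents.

(** * Subgroups with cyclic quotient against cyclic subgroups *)

Section CardCocyclic.

Local Open Scope ring_scope.

Lemma dim_sum_lines (K : fieldType) (V : vectType K) (I : finType)
    (P : pred I) (v : I -> V) :
  (forall c : I -> K, \sum_(i | P i) c i *: v i = 0 -> forall i, P i -> c i = 0) ->
  \dim (\sum_(i | P i) <[v i]>)%VS = #|P|.
Proof.
move=> vfree; have v0 i : P i -> v i != 0.
  move=> Pi; apply/eqP => vi0; have := vfree (fun j => (j == i)%:R).
  rewrite (bigD1 i) //= vi0 scaler0 big1 ?addr0 => [/(_ erefl i Pi)/eqP|j /andP[_ /negPf ->]].
    by rewrite eqxx oner_eq0.
  by rewrite scale0r.
have /directvP -> : directv (\sum_(i | P i) <[v i]>)%VS.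
  apply/directv_sum_independent => w wv w0 i Pi.
  have wE j : exists k, P j -> w j = k *: v j.
    by case Pj: (P j); [have /vlineP[k ->] := wv j Pj; exists k | exists 0].
  have [c cE] := fin_all_exists wE; rewrite cE // (vfree c) ?scale0r //.
  by rewrite -[RHS]w0; apply: eq_bigr => j Pj; rewrite cE.
rewrite /= -sum1_card; apply: eq_bigr => i Pi; by rewrite dim_vline v0.
Qed.

Variables (gT : finGroupType) (B M : {group gT}).
Hypotheses (pG : (2.-group [set: gT])%g)
  (sMB : M \subset B) (dB : (B^`(1) \subset M)%g)
  (nMB : forall C : {group gT}, M \subset C -> C \subset B -> (C <| [set: gT])%g).

Local Notation A := (group_algebra rat gT).
Local Notation delta g := (ga_delta rat g : A).
Local Notation hat := (hat rat).
Local Notation e := (cocyclic_idem rat B).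
Local Notation cocyclic := (cocyclic B M).
Implicit Types (H C : {group gT}) (D : {group coset_of M}).

Let two0 : (2%:R : rat) != 0. Proof. by []. Qed.

Definition cyclic_generators D : A :=
  [ffun g => ((g \in B) && (<[coset M g]>%G == D))%:R : rat].
Local Notation ind := cyclic_generators.
Local Notation cyc D := ((D \subset B / M)%g && (cyclic D)).

Let nM : (M <| [set: gT])%g. Proof. exact: nMB. Qed.
Let memN g : g \in ('N(M))%g.
Proof. by apply: (subsetP (normal_norm nM)); rewrite inE. Qed.

(** The elements of [H] are sorted by the cyclic subgroup of B / M that their coset generates. *)
Lemma sum_delta_cyclic_generators H : M \subset H -> H \subset B ->
  \sum_(h in H) delta h = \sum_(D : {group coset_of M} | cyc D && (D \subset H / M)%g) ind D.
Proof.
move=> MH HB; apply/ffunP=> g; rewrite !sum_ffunE.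
have -> : \sum_(h in H) delta h g = (g \in H)%:R.
  have [gH|gH] := boolP (g \in H).
    rewrite (bigD1 g) //= !ffunE eqxx big1 ?addr0 // => h /andP[_ hg].
    by rewrite !ffunE eq_sym (negPf hg).
  by rewrite big1 // => h hH; rewrite !ffunE; case: eqP gH => // ->; rewrite hH.
pose D0 := <[coset M g]>%G.
have nMH : (M <| H)%g by apply: normalS nM; rewrite ?subsetT.
have gHE : (g \in H) = (D0 \subset H / M)%g.
  apply/idP/idP => [gH|]; first by rewrite cycle_subG mem_quotient.
  rewrite cycle_subG => gH; rewrite -(quotientGK nMH) mem_morphpre //.
have [gB|gB] := boolP (g \in B); last first.
  rewrite (negPf (contra (subsetP HB g) gB)) big1 // => D _.
  by rewrite ffunE (negPf gB).
have cD0 : cyc D0 by rewrite cycle_cyclic cycle_subG mem_quotient.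
have [gH|gH] := boolP (g \in H).
  rewrite (bigD1 D0) ?cD0 -?gHE //= ffunE gB eqxx big1 ?addr0 // => D /andP[_ nD].
  by rewrite ffunE eq_sym (negPf nD) andbF.
rewrite big1 // => D /andP[_ DH]; rewrite ffunE; case: eqP => [DE|]; last by rewrite andbF.
by move: gH; rewrite gHE -DE in DH *; rewrite DH.
Qed.

Lemma dim_cocyclic_idem :
  \dim (\sum_(C in cocyclic) <[e C]>)%VS = #|cocyclic|.
Proof.
apply: dim_sum_lines => c c0 C cC; have [ee _ e0] := cocyclic_idem_central two0 pG sMB nMB cC.
have := congr1 (fun a => e C * a) c0; rewrite mulr0 mulr_sumr (bigD1 C) //= big1.
  rewrite addr0 -scalerAr ee => /eqP.
  by rewrite scaler_eq0 (negPf e0) orbF => /eqP.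
move=> D /andP[cD DC]; rewrite -scalerAr (cocyclic_idem_orth two0 pG sMB nMB) ?scaler0 //.
by rewrite eq_sym.
Qed.

Lemma dim_cyclic_generators :
  \dim (\sum_(D : {group coset_of M} | cyc D) <[ind D]>)%VS =
  num_cyclic_subgroups (B / M)%G.
Proof.
rewrite dim_sum_lines => [|c c0 D /andP[DB cD]]; first by rewrite /num_cyclic_subgroups cardsE.
have [X DX] := cyclicP cD.
have : X \in (B / M)%g by apply: (subsetP DB); rewrite DX cycle_id.
case/morphimP => g gN gB XE.
have /ffunP/(_ g) := c0; rewrite sum_ffunE (bigD1 D) ?DB //= big1.
  rewrite !ffunE gB addr0 (_ : _ == D).
    by rewrite [_ *: _]mulr1.
  by apply/eqP/val_inj; rewrite /= DX XE.
move=> D' /andP[_ nD]; rewrite !ffunE gB /= (_ : (_ == _) = false) ?scaler0 //.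
apply: contraNF nD => /eqP <-; apply/eqP/val_inj; by rewrite /= DX XE.
Qed.

Let scale_hat H : #|H|%:R *: hat H = \sum_(h in H) delta h.
Proof.
by rewrite [LHS]scalerA mulfV ?scale1r ?(natr_cardG_neq0 (cardG_neq0 two0 pG)).
Qed.

Lemma hat_memv_cocyclic H : M \subset H -> H \subset B ->
  hat H \in (\sum_(C in cocyclic) <[e C]>)%VS.
Proof.
move=> MH HB; rewrite -(hat_sum_cocyclic two0 pG sMB dB nMB MH HB) mulr_sumr.
apply: memv_sumr => C cC; rewrite (hat_cocyclic_idem two0 pG nMB) //.
by case: ifP => _; rewrite ?mem0v ?memv_line.
Qed.

Lemma hat_memv_cyclic_generators H : M \subset H -> H \subset B ->
  hat H \in (\sum_(D : {group coset_of M} | cyc D) <[ind D]>)%VS.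
Proof.
move=> MH HB; apply: memvZ; rewrite sum_delta_cyclic_generators //.
apply: rpred_sum => D /andP[cD _].
by rewrite memvE; apply: (sumv_sup D).
Qed.

(* The [cocyclic_idem], and the sums over the generators of each cyclic subgroup
   of [B / M], are two bases of the span of the averages of subgroups. *)
Lemma card_cocyclic : #|cocyclic| = num_cyclic_subgroups (B / M)%G.
Proof.
rewrite -dim_cocyclic_idem -dim_cyclic_generators.
congr (\dim _); apply/eqP; rewrite eqEsubv; apply/andP; split; apply/subv_sumP.
  move=> C cC; have [MC CB nCB _] := cocyclicP cC.
  rewrite -memvE /cocyclic_idem; case: eqP => _; first exact: hat_memv_cyclic_generators.
  apply: rpredB; apply: hat_memv_cyclic_generators => //.
    exact: subset_trans MC (overgroup_sub B C).
  exact: overgroup_subl.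
(* The system is triangular: the sum over the preimage H of D is [ind D] plus terms for smaller
   cyclic subgroups. *)
move=> D; have [n] := ubnP #|D|; elim: n D => // n IHn D lt_n cD.
have [DB _] := andP cD; rewrite -memvE.
pose H := (coset M @*^-1 D)%G.
have MH : M \subset H by apply: sub_cosetpre.
have nMB' : (M <| B)%g by apply: normalS nM; rewrite ?subsetT.
have HB : H \subset B.
  apply: (@subset_trans _ _ (coset M @*^-1 (B / M))%g); last by rewrite quotientGK.
  exact: morphpreS.
have HD : (H / M)%g = D by rewrite /= cosetpreK.
have E := sum_delta_cyclic_generators MH HB.
rewrite (bigD1 D) /= ?cD ?HD //= in E.
have -> : ind D = #|H|%:R *: hat H -
  \sum_(D' : {group coset_of M} | cyc D' && (D' \subset D) && (D' != D)) ind D'.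
  by rewrite scale_hat E addrK.
apply: rpredB; first exact/memvZ/hat_memv_cocyclic.
apply: rpred_sum => D' /andP[/andP[cD' D'D] neD]; rewrite memvE; apply: IHn => //.
rewrite -ltnS; apply: leq_trans lt_n; rewrite ltnS; apply: proper_card.
rewrite properEneq D'D andbT.
by apply: contraNneq neD => /val_inj ->.
Qed.

End CardCocyclic.

(** * Groups of type D5 *)

Section ModelD5.

Local Open Scope group_scope.

Variable m : nat.
Hypothesis m_gt0 : (0 < m)%N.

Local Notation n := (2 ^ m)%N.
Local Notation T := ('Z_n * bool)%type.

Let n_gt1 : (1 < n)%N. Proof. by rewrite -(expn0 2) ltn_exp2l. Qed.

Fact rotate_inj : injective (fun p : T => (p.1 + 1, p.2)%R).
Proof.
move=> [a b] [c d] E; have h : (a + 1 = c + 1)%R := congr1 fst E.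
have bd : b = d := congr1 snd E.
by rewrite (GRing.addIr _ h) bd.
Qed.
Fact twist_inj : injective
  (fun p : T => (if p.2 then p.1 + (2 ^ m.-1)%:R else p.1, p.2)%R).
Proof.
move=> [a b] [c d] E; have bd : b = d := congr1 snd E.
move: E; rewrite bd; case: d {bd} => E; last exact: E.
have h : (a + (2 ^ m.-1)%:R = c + (2 ^ m.-1)%:R)%R := congr1 fst E.
by rewrite (GRing.addIr _ h).
Qed.
Fact flip_inj : injective (fun p : T => (p.1, ~~ p.2)).
Proof. by move=> [a b] [c d] [-> /negb_inj ->]. Qed.

Let r := perm rotate_inj.
Let u := perm twist_inj.
Let v := perm flip_inj.

Let rX k p : (r ^+ k) p = (p.1 + k%:R, p.2)%R.
Proof.
elim: k p => [|k IHk] p; first by rewrite perm1 GRing.addr0; case: p.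
by rewrite expgSr permM IHk permE /= -GRing.addrA -GRing.natr1.
Qed.

Let half2 : ((2 ^ m.-1)%:R + (2 ^ m.-1)%:R = 0 :> 'Z_n)%R.
Proof.
by rewrite -GRing.natrD addnn -mul2n -expnS prednK // pchar_Zp.
Qed.

Let half_neq0 : ((2 ^ m.-1)%:R != 0 :> 'Z_n)%R.
Proof.
apply/eqP => /(congr1 val) /=; rewrite val_Zp_nat // modn_small.
  by apply/eqP; rewrite expn_eq0.
by rewrite ltn_exp2l // prednK.
Qed.

(** On two copies of Z_n, [r] rotates both, [v] exchanges them and [u] is the half turn on one copy
    only. Conjugation by [v] moves that half turn to the other copy, so [u, v] is the half turn on
    both. *)
Lemma type_D5_model : exists (rT : finGroupType) (r u v : rT),
  [/\ r ^+ n = 1, commute r u, commute r v, u ^+ 2 = 1 /\ v ^+ 2 = 1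
    & [~ u, v] = r ^+ (2 ^ m.-1) /\ r ^+ (2 ^ m.-1) != 1].
Proof.
exists {perm T}, r, u, v.
have vv : v ^+ 2 = 1.
  by apply/permP=> -[i b]; rewrite permX perm1 /= !permE /= negbK.
have uu : u ^+ 2 = 1.
  apply/permP=> -[i b]; rewrite permX perm1 /= !permE /=.
  by case: b => //; rewrite -GRing.addrA half2 GRing.addr0.
split=> //.
- by apply/permP=> -[i b]; rewrite rX perm1 /= pchar_Zp // GRing.addr0.
- apply/permP=> -[i b]; rewrite !permM !permE /=.
  by case: b => //; rewrite GRing.addrAC.
- by apply/permP=> -[i b]; rewrite !permM !permE.
split; last first.
  apply/eqP => /permP/(_ (0%R, true)); rewrite rX perm1 /= GRing.add0r => -[h].
  by move: half_neq0; rewrite h eqxx.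
have inv2 (w : {perm T}) : w ^+ 2 = 1 -> w^-1 = w.
  by move=> ww; apply/eqP; rewrite eq_invg_mul; apply/eqP.
have iv := inv2 v vv; have iu := inv2 u uu.
rewrite commgEl conjgE iu iv; apply/permP=> -[i b]; rewrite !permM rX !permE /=.
by case: b => //=; rewrite -GRing.addrA half2.
Qed.

End ModelD5.

Section PresentationSatisfaction.

Local Open Scope group_scope.

Import Presentation.

Variable gT : finGroupType.

Fixpoint relations_hold (e : seq gT) (f : formula) : Prop :=
  match f with
  | Eq2 s t => eval e s = eval e t
  | And f1 f2 => relations_hold e f1 /\ relations_hold e f2
  end.

Lemma and_rel_refl (T : finType) (a b : T) (r : rel_type) :
  a = b -> bool_of_rel r -> bool_of_rel (and_rel a b r).
Proof. by move=> ->; case: r => [|wT c d] /= => [|/eqP ->]; rewrite eqxx. Qed.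

(* Deciding the whole presentation by conversion is intractable with this many
   relations; this splits it into separate equations. *)
Lemma relations_hold_rel (e : seq gT) (f : formula) (r : rel_type) :
  relations_hold e f -> bool_of_rel r -> bool_of_rel (rel e f r).
Proof.
elim: f r => [s t|f1 IH1 f2 IH2] r /=; first exact: and_rel_refl.
by case=> h1 h2 hr; apply: IH1 => //; apply: IH2.
Qed.

End PresentationSatisfaction.

Section GroupD5.

Local Open Scope group_scope.

Variables (m1 m2 m3 : nat) (gT : finGroupType) (t1 t2 t3 x y : gT).
Hypotheses (hm1 : (3 <= m1)%N) (hG : type_D5 m1 m2 m3 t1 t2 t3 x y).

Local Notation G := [set: gT]%G.
Local Notation s := (t1 ^+ (2 ^ m1.-1)).

Lemma D5_gen_subset (H : {group gT}) : t1 \in H -> t2 \in H -> t3 \in H ->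
  x \in H -> y \in H -> G \subset H.
Proof.
case: hG => _ genG _ _ _ t1H t2H t3H xH yH.
have : <<[set t1; t2; t3; x; y]>> \subset H.
  rewrite gen_subG; apply/subsetP => g.
  by rewrite !inE -!orbA => /or4P[|||/orP[]] /eqP ->.
by rewrite genG.
Qed.

Lemma D5_gen_central (z : gT) : commute z x -> commute z y -> z \in 'Z(G).
Proof.
case: hG => _ _ _ [t1Z t2Z t3Z] _ zx zy; rewrite inE in_setT /=.
have tz t : t \in 'Z(G) -> t \in 'C[z].
  by move/centerP => [_ ct]; apply/cent1P; apply: ct; rewrite in_setT.
have sub : G \subset 'C[z].
  by apply: D5_gen_subset; [exact: tz|exact: tz|exact: tz| |];
    apply/cent1P/commute_sym.
by rewrite -sub_cent1.
Qed.

(** The universal property of the presentation, sending t1, t2, t3, x, y to r, u^2, v^2, u, v. The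
    exponents m2 + 1 and m3 + 1 reflect x^2 = t2 and y^2 = t3. *)
Lemma D5_homg_model (rT : finGroupType) (r u v : rT) :
  r ^+ (2 ^ m1) = 1 -> commute r u -> commute r v ->
  u ^+ (2 ^ m2.+1) = 1 -> v ^+ (2 ^ m3.+1) = 1 ->
  commute (u ^+ 2) v -> commute (v ^+ 2) u ->
  [~ u, v] = r ^+ (2 ^ m1.-1) ->
  (<[r]> <*> <[u ^+ 2]> <*> <[v ^+ 2]> <*> <[u]> <*> <[v]>)%G \homg G.
Proof.
move=> rn ru rv un vn u2v v2u uv; have [iG _ _ _ _] := hG.
rewrite iG; apply/existsP; exists (r, u ^+ 2, v ^+ 2, u, v).
apply: and_rel_refl => //; apply: relations_hold_rel => //=.
have c (a b : rT) : commute a b -> [~ a, b] = 1 by move/commgP/eqP.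
have cX (a : rT) k : commute (a ^+ k) a by apply/commute_sym/commuteX.
by rewrite -!expgM -!expnS; do !split => //; rewrite c //; do ?[exact: cX | exact: commuteX].
Qed.

(** If s were 1, then x and y would commute and G would be abelian, and so would its image generated
    by the model's [r], [u], [v], where [u, v] is not 1. *)
Lemma D5_s_neq1 : s != 1.
Proof.
apply/eqP => s1; have [_ _ _ [t1Z t2Z t3Z] [_ _ xys]] := hG.
have m1_gt0 : (0 < m1)%N by apply: ltn_trans hm1.
have [rT [r [u [v [rn ru rv [uu vv] [uv r1]]]]]] := type_D5_model m1_gt0.
have hH : (<[r]> <*> <[u ^+ 2]> <*> <[v ^+ 2]> <*> <[u]> <*> <[v]>)%G \homg G.
  apply: D5_homg_model => //; rewrite ?expnS ?expgM ?uu ?vv ?expg1n //.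
    exact/commute_sym/commute1.
  exact/commute_sym/commute1.
have cxy : commute x y by apply/commgP; rewrite xys s1.
have aG : abelian G.
  have xZ : x \in 'Z(G) by apply: D5_gen_central.
  have yZ : y \in 'Z(G) by apply: D5_gen_central.
  exact: subset_trans (D5_gen_subset t1Z t2Z t3Z xZ yZ) (subsetIr _ _).
set H := (_ <*> _)%G in hH.
have [f fG] := homgP hH; have aH : abelian H by rewrite -fG morphim_abelian.
have uH : u \in H by rewrite mem_gen // inE (@mem_gen _ u) ?inE ?cycle_id ?orbT.
have vH : v \in H by rewrite mem_gen // inE cycle_id orbT.
move/negP: r1; apply; rewrite -uv; apply/commgP.
exact: (centsP aH).
Qed.

Let t1Z : t1 \in 'Z(G). Proof. by case: hG => _ _ _ []. Qed.
Let x2Z : x ^+ 2 \in 'Z(G). Proof. by case: hG => _ _ _ [_ t2Z _] [-> _ _]. Qed.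
Let y2Z : y ^+ 2 \in 'Z(G). Proof. by case: hG => _ _ _ [_ _ t3Z] [_ -> _]. Qed.

Lemma center_commute (z g : gT) : z \in 'Z(G) -> commute z g.
Proof. by case/centerP => _; apply; rewrite in_setT. Qed.

Lemma D5_s_center : s \in 'Z(G). Proof. by rewrite groupX. Qed.

Lemma D5_s2 : s ^+ 2 = 1.
Proof.
rewrite -expgM -expnSr prednK; last exact: ltn_trans hm1.
by case: hG => _ _ [].
Qed.

Lemma D5_xy : x * y = y * x * s.
Proof. by have [_ _ _ _ [_ _ <-]] := hG; rewrite -commgC. Qed.

Lemma D5_x_notin_center : x \notin 'Z(G).
Proof.
apply/negP => xZ; case/eqP: D5_s_neq1; have [_ _ _ _ [_ _ <-]] := hG.
by apply/eqP/commgP; apply: center_commute.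
Qed.

Lemma D5_y_notin_center : y \notin 'Z(G).
Proof.
apply/negP => yZ; case/eqP: D5_s_neq1; have [_ _ _ _ [_ _ <-]] := hG.
by apply/eqP/commgP/commute_sym/center_commute.
Qed.

Lemma D5_xy_notin_center : x * y \notin 'Z(G).
Proof.
apply/negP => xyZ; case/eqP: D5_s_neq1.
have := center_commute x xyZ; rewrite /commute -mulgA => /mulgI; rewrite D5_xy => h.
by apply: (mulgI (y * x)); rewrite mulg1 -h.
Qed.

Lemma D5_quotient_abelian (S : {group gT}) : s \in S -> S <| G -> abelian (G / S).
Proof.
move=> sS nS; have nN g : g \in 'N(S).
  by apply: (subsetP (normal_norm nS)); rewrite in_setT.
have cen w : w \in [:: t1; t2; t3; x; y] -> commute (coset S w) (coset S x) ->
    commute (coset S w) (coset S y) -> G \subset coset S @*^-1 'C[coset S w].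
  move=> _ wx wy; have [_ _ _ [_ t2Z t3Z] _] := hG.
  have tz t : t \in 'Z(G) -> t \in coset S @*^-1 'C[coset S w].
    move=> tZ; rewrite mem_morphpre //=; apply/cent1P.
    by rewrite /commute -!morphM // (center_commute w tZ).
  apply: (D5_gen_subset (H := (coset S @*^-1 'C[coset S w])%G)) => /=;
    [exact: tz|exact: tz|exact: tz| |];
    by rewrite mem_morphpre //=; apply/cent1P/commute_sym.
have xy : commute (coset S x) (coset S y).
  by rewrite /commute -!morphM // D5_xy [in LHS]morphM //= (coset_id sS) mulg1.
have xC := cen x _ (commute_refl _) xy; have yC := cen y _ (commute_sym xy) (commute_refl _).
have {}cen w : G \subset coset S @*^-1 'C[coset S w] -> coset S w \in 'C(G / S).
  move=> /subsetP Gw; apply/centP => _ /morphimP[g _ _ ->].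
  have [_ gC] := morphpreP (Gw g (in_setT g)).
  exact/commute_sym/cent1P.
have GC : G \subset coset S @*^-1 'C(G / S).
  have [_ _ _ [_ t2Z t3Z] _] := hG.
  have tz t : t \in 'Z(G) -> t \in coset S @*^-1 'C(G / S).
    move=> tZ; rewrite mem_morphpre //=; apply/centP => _ /morphimP[g _ _ ->] /=.
    by rewrite /commute -!morphM // (center_commute g tZ).
  apply: (D5_gen_subset (H := (coset S @*^-1 'C(G / S))%G)) => /=;
    [exact: tz|exact: tz|exact: tz| |]; rewrite mem_morphpre //=; apply: cen.
    by apply: xC; rewrite !inE eqxx !orbT.
  by apply: yC; rewrite !inE eqxx !orbT.
apply/subsetP => _ /morphimP[g _ _ ->].
by have [] := morphpreP (subsetP GC g (in_setT g)).
Qed.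

Lemma central_normal (S : {group gT}) : S \subset 'Z(G) -> S <| G.
Proof. by move=> SZ; apply: sub_center_normal. Qed.

Lemma D5_der1 : G^`(1) = <[s]>.
Proof.
have sZ : <[s]> \subset 'Z(G) by rewrite cycle_subG D5_s_center.
have nS := central_normal (S := <[s]>%G) sZ.
apply/eqP; rewrite eqEsubset; apply/andP; split.
  apply: der1_min (normal_norm nS) _.
  by apply: (D5_quotient_abelian (S := <[s]>%G)); rewrite ?cycle_id.
rewrite cycle_subG; have [_ _ _ _ [_ _ <-]] := hG.
by apply: mem_commg; rewrite in_setT.
Qed.

(** G / Z(G) is abelian and generated by the cosets of x and y, whose squares are trivial. *)
Lemma D5_cover g : exists2 z, z \in 'Z(G) & exists i j : bool, g = z * (x ^+ i * y ^+ j).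
Proof.
have nZ : 'Z(G) <| G by apply: center_normal.
have nN h : h \in 'N('Z(G)) by apply: (subsetP (normal_norm nZ)); rewrite in_setT.
have aQ : abelian (G / 'Z(G)) by apply: (D5_quotient_abelian (S := 'Z(G)%G)) => //; apply: D5_s_center.
pose X := coset 'Z(G) x; pose Y := coset 'Z(G) y.
have XQ : X \in G / 'Z(G) by apply: mem_quotient; rewrite in_setT.
have YQ : Y \in G / 'Z(G) by apply: mem_quotient; rewrite in_setT.
have [_ _ _ [_ t2Z t3Z] _] := hG.
have tz t : t \in 'Z(G) -> t \in coset 'Z(G) @*^-1 (<[X]> <*> <[Y]>).
  by move=> tZ; rewrite mem_morphpre //= coset_id ?group1.
have sub : G \subset (coset 'Z(G) @*^-1 (<[X]> <*> <[Y]>))%G.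
  apply: D5_gen_subset => /=; [exact: tz|exact: tz|exact: tz| |];
    by rewrite mem_morphpre //= mem_gen // inE cycle_id ?orbT.
have XYE : <[X]> <*> <[Y]> = <[X]> * <[Y]>.
  apply: cent_joinEl; rewrite cycle_subG; apply/centP => _ /cycleP[k ->].
  by apply: commuteX; apply: (centsP aQ).
have [_] := morphpreP (subsetP sub g (in_setT g)); rewrite /= XYE.
case/mulsgP => _ _ /cycleP[i ->] /cycleP[j ->] gE.
have X2 : X ^+ 2 = 1 by rewrite /X -(morphX (coset_morphism _)) //= coset_id.
have Y2 : Y ^+ 2 = 1 by rewrite /Y -(morphX (coset_morphism _)) //= coset_id.
rewrite -(expg_mod i X2) -(expg_mod j Y2) !modn2 in gE.
exists (g * (x ^+ odd i * y ^+ odd j)^-1); last by exists (odd i), (odd j); rewrite mulgKV.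
apply: coset_idr => //; rewrite morphM //= gE morphV //= morphM //= !(morphX (coset_morphism _)) //.
by rewrite mulgV.
Qed.

(** G / Z(G) is abelian, so G is nilpotent; its 2-core then contains every 2-element, in particular
    all generators. *)
Lemma D5_pgroup : 2.-group G.
Proof.
have nilG : nilpotent G.
  rewrite -quotient_center_nil; apply: abelian_nil.
  by apply: (D5_quotient_abelian (S := 'Z(G)%G)); rewrite ?center_normal ?D5_s_center.
have [_ _ [t1n t2n t3n] _ [x2 y2 _]] := hG.
have mem g k : g ^+ (2 ^ k) = 1 -> g \in 'O_2(G).
  move=> gk; rewrite (mem_normal_Hall (nilpotent_pcore_Hall _ nilG) (pcore_normal _ _)) ?in_setT //.
  apply: (@pnat_dvd _ (2 ^ k)); first by rewrite order_dvdn gk.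
  by rewrite pnatX pnat_id.
have sub : G \subset 'O_2(G).
  apply: D5_gen_subset; [exact: mem t1n|exact: mem t2n|exact: mem t3n| |].
    by apply: (mem _ m2.+1); rewrite expnS expgM x2.
  by apply: (mem _ m3.+1); rewrite expnS expgM y2.
exact: pgroupS sub (pcore_pgroup _ _).
Qed.

End GroupD5.

(** * Counting cyclic subgroups and the constant 36 *)

Section CountCyclic.

Local Open Scope group_scope.

Lemma num_cyclic_subgroups_injm (aT rT : finGroupType) (X : {group aT})
    (f : {morphism X >-> rT}) :
  'injm f -> num_cyclic_subgroups (f @* X)%G = num_cyclic_subgroups X.
Proof.
move=> injf; rewrite /num_cyclic_subgroups.
rewrite -(card_in_imset (f := fun H : {group aT} => (f @* H)%G)); last first.
  move=> H1 H2; rewrite !inE => /andP[H1X _] /andP[H2X _] /(congr1 (fun H : {group _} => H : {set rT})).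
  by move=> /= /(injm_morphim_inj injf H1X H2X)/val_inj.
apply: eq_card => H; rewrite inE; apply/andP/imsetP => [[HX cH]|[H' + ->]].
  exists (f @*^-1 H)%G; last by apply/val_inj; rewrite /= morphpreK.
  by rewrite inE subsetIl /= -(injm_cyclic injf) ?subsetIl // morphpreK.
by rewrite inE => /andP[HX cH]; rewrite morphimS //= morphim_cyclic.
Qed.

(** Every element generates exactly one cyclic subgroup, and a cyclic subgroup of order n has
    totient(n) generators. *)
Lemma sum_totient_cyclic (gT : finGroupType) (X : {group gT}) (P : pred nat) :
  (\sum_(D : {group gT} | (D \subset X) && cyclic D && P #|D|) totient #|D| =
   #|[set x in X | P #[x]]|)%N.
Proof.
rewrite -sum1_card (partition_big (fun x => <[x]>%G)
  (fun D : {group gT} => (D \subset X) && cyclic D && P #|D|)) /=; last first.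
  by move=> x; rewrite inE => /andP[xX Px]; rewrite cycle_subG xX cycle_cyclic.
apply: eq_bigr => D /andP[/andP[DX /cyclicP[a Da]] PD].
rewrite Da -orderE totient_gen -sum1_card; apply: eq_bigl => x.
rewrite !inE /generator; apply/idP/andP => [/eqP xa|[_ /eqP/(congr1 val) /= xE]].
  have xD : <[x]> = D by rewrite Da xa.
  split; last by apply/eqP/val_inj; rewrite /= xD.
  by rewrite -cycle_subG xD DX orderE xD.
by rewrite xE Da.
Qed.

(** A cyclic subgroup of order 1 or 2 has one generator and is counted in both terms; one of order 4
    has two generators and is counted only in the first. Each contributes 2. *)
Lemma num_cyclic_exponent4 (gT : finGroupType) (X : {group gT}) :
  (forall x, x \in X -> x ^+ 4 = 1) ->
  (2 * num_cyclic_subgroups X = #|X| + #|[set x in X | x ^+ 2 == 1%g]|)%N.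
Proof.
move=> X4; have := sum_totient_cyclic X predT.
have := sum_totient_cyclic X (fun n => n <= 2)%N.
have ord x : x \in X -> #[x] \in divisors 4.
  by move=> xX; rewrite -dvdn_divisors // order_dvdn X4.
have -> : [set x in X | predT #[x]] = X by apply/setP=> x; rewrite inE andbT.
have -> : [set x in X | (#[x] <= 2)%N] = [set x in X | x ^+ 2 == 1].
  apply/setP=> x; rewrite !inE -order_dvdn; case xX: (x \in X) => //=.
  by have := ord x xX; rewrite !inE => /or3P[] /eqP ->.
move=> E2 E; rewrite -E -E2 /num_cyclic_subgroups -sum1_card big_distrr /=.
rewrite [X in (_ = X + _)%N](eq_bigl (fun D : {group gT} => (D \subset X) && cyclic D)); last first.
  by move=> D; rewrite andbT.
rewrite [X in (_ = _ + X)%N]big_mkcondr -big_split /=; apply: eq_big => [D|D]; first by rewrite inE.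
rewrite inE => /andP[DX /cyclicP[a Da]]; rewrite Da -orderE.
have /ord : a \in X by rewrite -cycle_subG -Da.
by rewrite !inE => /or3P[] /eqP ->.
Qed.

Local Notation T := ('Z_4 * 'Z_4 * 'Z_4)%type.

Lemma Z4_4 (a : 'Z_4) : a ^+ 4 = 1.
Proof. by apply: val_inj; case: a => -[|[|[|[|]]]]. Qed.

Lemma expg_pair (A B : finGroupType) (a : A) (b : B) n :
  (a, b) ^+ n = (a ^+ n, b ^+ n).
Proof. by elim: n => // n IH; rewrite !expgS IH. Qed.

Lemma T4 (a : T) : a ^+ 4 = 1.
Proof. by case: a => -[a b] c; rewrite !expg_pair !Z4_4. Qed.

(** Here 2 * 36 = 64 + 8, with 8 = 2^3 solutions of a^2 = 1. *)
Lemma num_cyclic_Z4 : num_cyclic_subgroups [set: T]%G = 36.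
Proof.
have := @num_cyclic_exponent4 _ [set: T]%G (fun a _ => T4 a).
rewrite cardsT !card_prod !card_ord.
have -> : #|[set x in [set: T]%G | x ^+ 2 == 1]| = 8.
  pose D := [set a : 'Z_4 | a ^+ 2 == 1].
  have cD : #|D| = 2.
    rewrite (_ : D = [set 0%R; 2%:R%R]); first by rewrite cards2.
    by apply/setP=> -[[|[|[|[|]]]] ha]; rewrite // !inE.
  rewrite (_ : [set _ in _ | _] = setX (setX D D) D); first by rewrite !cardsX cD.
  by apply/setP=> -[[a b] c]; rewrite !inE /= !expg_pair !xpair_eqE.
by move=> E; apply/eqP; rewrite -(eqn_pmul2l (isT : 0 < 2)%N) E.
Qed.


Section SmallCocyclic.

Variables (m1 m2 m3 : nat) (gT : finGroupType) (t1 t2 t3 x y : gT).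
Hypotheses (hm1 : (3 <= m1)%N) (hm2 : (3 <= m2)%N) (hm3 : (3 <= m3)%N)
  (hG : type_D5 m1 m2 m3 t1 t2 t3 x y).

Local Notation G := [set: gT]%G.
Local Notation s := (t1 ^+ (2 ^ m1.-1)).

Lemma D5_homg_exponent4 (rT : finGroupType) (r u v : rT) :
  (forall a b : rT, commute a b) -> (forall a : rT, a ^+ 4 = 1) ->
  (forall a, exists i j k, a = r ^+ i * u ^+ j * v ^+ k) ->
  [set: rT] \homg G.
Proof.
move=> cT T4' gen.
have X4 (a : rT) k : (2 <= k)%N -> a ^+ (2 ^ k) = 1.
  by move=> k2; rewrite -(subnK k2) expnD mulnC expgM T4' expg1n.
have hH : (<[r]> <*> <[u ^+ 2]> <*> <[v ^+ 2]> <*> <[u]> <*> <[v]>)%G \homg G.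
  apply: (D5_homg_model hG) => //.
  - by apply: X4; apply: ltnW.
  - by apply: X4; rewrite ltnS (leq_trans _ hm2).
  - by apply: X4; rewrite ltnS (leq_trans _ hm3).
  (* Because m1 >= 3, the element s goes to a power with exponent divisible by 4, hence to 1, as a
     commutative image requires. *)
  rewrite X4; last by rewrite -ltnS prednK // (ltn_trans _ hm1).
  by apply/eqP/commgP.
suff <- : (<[r]> <*> <[u ^+ 2]> <*> <[v ^+ 2]> <*> <[u]> <*> <[v]>)%G = [set: rT] :> {set rT}
  by exact: hH.
apply/eqP; rewrite eqEsubset subsetT; apply/subsetP => a _.
have [i [j [k ->]]] := gen a; set H := (_ <*> _)%G.
have uH : u \in H by rewrite mem_gen // inE (@mem_gen _ u) ?inE ?cycle_id ?orbT.
have vH : v \in H by rewrite mem_gen // inE cycle_id orbT.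
have rH : r \in H by do 4![rewrite mem_gen // inE; apply/orP; left]; rewrite cycle_id.
by rewrite !groupM ?groupX.
Qed.

Lemma T_comm (a b : T) : commute a b.
Proof. by case: a b => [[a b] c] [[a' b'] c']; congr (_, _, _); apply: GRing.addrC. Qed.

Lemma T_gen (a : T) : exists i j k,
  a = ((Zp1, 1, 1) : T) ^+ i * ((1, Zp1, 1) : T) ^+ j * ((1, 1, Zp1) : T) ^+ k.
Proof.
case: a => -[a b] c; exists a, b, c.
have mulg_pair (A B : finGroupType) (a1 a2 : A) (b1 b2 : B) :
  (a1, b1) * (a2, b2) = (a1 * a2, b1 * b2) by [].
by rewrite !expg_pair !expg1n !mulg_pair !mulg1 !mul1g !Zp1_expgz.
Qed.

Lemma D5_homg_Z4 : [set: T] \homg G.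
Proof. exact: D5_homg_exponent4 T_comm T4 T_gen. Qed.

(** As t2 = x^2 and t3 = y^2, the quotient is a product of three cyclic groups of order at most 4,
    generated by t1, x, y. *)
Lemma D5_card_quotient_le (J : {group gT}) : J <| G -> abelian (G / J) ->
  (forall g, g ^+ 4 \in J) -> (#|G / J| <= 64)%N.
Proof.
move=> nJ aQ g4; have nN g : g \in 'N(J).
  by apply: (subsetP (normal_norm nJ)); rewrite in_setT.
pose X g := <[coset J g]>.
have cX g : (#|X g| <= 4)%N.
  rewrite -orderE dvdn_leq // order_dvdn -(morphX (coset_morphism J)) //=.
  by rewrite coset_id.
have XQ g : X g \subset G / J by rewrite cycle_subG mem_quotient // in_setT.
have [_ _ _ _ [x2 y2 _]] := hG.
have E1 : X t1 <*> X x = X t1 * X x.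
  by apply: cent_joinEl; apply: sub_abelian_cent2 aQ (XQ _) (XQ _).
have E2 : X t1 <*> X x <*> X y = X t1 <*> X x * X y.
  by apply: cent_joinEl; apply: sub_abelian_cent2 aQ _ (XQ _); rewrite join_subG !XQ.
have sub : G \subset (coset J @*^-1 (X t1 <*> X x <*> X y))%G.
  have xH : coset J x \in X t1 <*> X x <*> X y.
    by rewrite mem_gen // inE (@mem_gen _ (coset J x)) // inE cycle_id orbT.
  have yH : coset J y \in X t1 <*> X x <*> X y by rewrite mem_gen // inE cycle_id orbT.
  have tH : coset J t1 \in X t1 <*> X x <*> X y.
    by rewrite mem_gen // inE (@mem_gen _ (coset J t1)) // inE cycle_id.
  apply: (D5_gen_subset hG); rewrite /= mem_morphpre //= -?x2 -?y2.
    by rewrite (morphX (coset_morphism J)) //= groupX.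
  by rewrite (morphX (coset_morphism J)) //= groupX.
have QE : G / J \subset X t1 <*> X x <*> X y.
  by apply/subsetP => _ /morphimP[g _ _ ->]; have [] := morphpreP (subsetP sub g (in_setT g)).
apply: leq_trans (subset_leq_card QE) _; rewrite E2 E1.
have le_mul (A B : {set coset_of J}) : (#|(A * B)%g| <= #|A| * #|B|)%N.
  rewrite -cardsX; apply: leq_trans (leq_imset_card (fun p => p.1 * p.2) _).
  apply/subset_leq_card/subsetP => _ /mulsgP[a b aA bB ->].
  by apply/imsetP; exists (a, b); rewrite ?inE ?aA.
apply: leq_trans (le_mul _ _) _.
apply: leq_trans (leq_mul (leq_trans (le_mul _ _) (leq_mul (cX _) (cX _))) (cX _)) _.
by [].
Qed.

(** The kernel of G onto C_4^3 is J, generated by G' and all fourth powers, since it contains J and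
    both quotients are compared with 64. The subgroups counted are those above J with cyclic
    quotient, and [card_cocyclic] turns them into the cyclic subgroups of C_4^3. *)
Lemma D5_small_cocyclic :
  #|[set C in cocyclic G G^`(1)%G | (#|G / C| <= 4)%N]| = 36.
Proof.
have [f fG] := homgP D5_homg_Z4; have pG := D5_pgroup hG.
have aT : abelian [set: T].
  by apply/centsP => a _ b _; apply: T_comm.
have [g injg gE] := first_isom f.
have nK : 'ker f <| G by apply: ker_normal.
have fK z : f z = 1 -> z \in 'ker f by move=> fz; apply/kerP; rewrite ?in_setT.
have K4 z : z ^+ 4 \in 'ker f.
  by apply: fK; rewrite morphX ?in_setT // T4.
have dK : G^`(1) \subset 'ker f.
  apply: der1_min (normal_norm nK) _; rewrite -(injm_abelian injg) ?gE ?fG //.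
pose J := (G^`(1) <*> 'Mho^2(G))%G.
have nJ : J <| G by apply: normalY; rewrite ?der_normal ?Mho_normal.
have JK : J \subset 'ker f.
  rewrite join_subG dK (MhoE _ pG) gen_subG.
  by apply/subsetP => _ /imsetP[z _ ->]; apply: K4.
have J4 z : z ^+ 4 \in J.
  rewrite mem_gen // inE (Mho_p_elt (p := 2) 2) ?in_setT ?orbT //.
  exact: mem_p_elt pG (in_setT z).
have aJ : abelian (G / J) by apply: sub_der1_abelian; rewrite joing_subl.
have KJ : 'ker f = J.
  apply/esym/eqP; rewrite eqEcard JK /=.
  have := D5_card_quotient_le nJ aJ J4.
  have : #|G / 'ker f| = 64.
    rewrite -(card_injm injg) // gE fG cardsT !card_prod !card_ord //.
  rewrite !card_quotient ?normal_norm // => K64 J64.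
  have := Lagrange (subsetT J); have := Lagrange (subsetT ('ker f)).
  rewrite K64 => <-; move: J64; set n := #|_ : J| => J64.
  move=> E; have : (#|'ker f| * 64 <= #|J| * 64)%N by rewrite -E leq_mul2l J64 orbT.
  by rewrite leq_pmul2r.
(* For a cyclic 2-group, order at most 4 and exponent dividing 4 are the same condition. *)
have CE : [set C in cocyclic G G^`(1)%G | (#|G / C| <= 4)%N] = cocyclic G ('ker f)%G.
  apply/setP=> C; rewrite !inE; apply/andP/and3P => [[/and3P[dC nC cC] C4]|[KC nC cC]].
    split=> //; rewrite /= KJ join_subG dC (MhoE _ pG) gen_subG.
    apply/subsetP => _ /imsetP[z _ ->]; have zN : z \in 'N(C).
      by apply: (subsetP (normal_norm nC)); rewrite in_setT.
    apply: coset_idr; rewrite ?groupX // morphX //=.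
    have pC := quotient_pgroup C pG; have [k Ck] := p_natP pC.
    have zQ : coset C z \in (G / C)%G by apply: mem_quotient; rewrite in_setT.
    apply/eqP; rewrite -order_dvdn; apply: dvdn_trans (order_dvdG zQ) _.
    rewrite Ck (dvdn_exp2l 2 (_ : k <= 2)%N) // -(leq_exp2l (m := 2)) //.
    by rewrite -Ck.
  rewrite nC cC !andbT; split; first exact: subset_trans dK KC.
  have [Y YE] := cyclicP cC; rewrite YE -orderE dvdn_leq // order_dvdn.
  have : Y \in G / C by rewrite YE cycle_id.
  case/morphimP => z zN _ ->; rewrite -morphX //= coset_id //.
  by apply: (subsetP KC).
have nC (C : {group gT}) : ('ker f)%G \subset C -> C \subset G -> C <| G.
  by move=> KC _; apply: sub_der1_normal (subsetT C); apply: subset_trans dK KC.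
rewrite CE (card_cocyclic pG (subsetT _) dK nC) -num_cyclic_Z4.
rewrite -(num_cyclic_subgroups_injm injg); congr num_cyclic_subgroups.
by apply: val_inj; rewrite /= gE fG.
Qed.

End SmallCocyclic.

End CountCyclic.

(** * Galois action over Q on roots of unity of 2-power order *)

Section CyclotomicAutomorphisms.

Local Open Scope ring_scope.

Lemma cyclotomic_normalField (L : splittingFieldType rat) n (z : L) :
  n.-primitive_root z -> normalField 1 <<1; z>>.
Proof.
move=> pz; apply/splitting_normalField; first exact: sub1v.
exists ('X^n - 1); first by rewrite rpredB ?rpredX ?polyOverX ?rpred1.
exists [seq z ^+ val i | i <- index_enum 'I_n].
  by rewrite -(factor_Xn_sub_1 pz) big_mkord big_map eqpxx.
apply/eqP; rewrite eqEsubv; apply/andP; split.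
  apply/Fadjoin_seqP; split; first exact: subv_adjoin.
  move=> _ /mapP[i _ ->]; exact/rpredX/memv_adjoin.
apply/FadjoinP; split; first exact: subv_adjoin_seq.
have n0 := prim_order_gt0 pz.
rewrite -[z in z \in _]expr1 -(prim_expr_mod pz).
apply: seqv_sub_adjoin; apply/mapP.
by exists (Ordinal (ltn_pmod 1 n0)); rewrite ?mem_index_enum.
Qed.

(** The minimal polynomial of [z] divides the irreducible X^(2^n) + 1, so it is associate to it, and
    z^r is again a root for odd [r]. *)
Lemma cyclotomic_galois_odd (L : splittingFieldType rat) n (z : L) r :
  (2 ^ n.+1).-primitive_root z -> odd r ->
  exists2 sigma, sigma \in 'Gal(<<1; z>>%AS / 1%AS)%g & sigma z = z ^+ r.
Proof.
move=> pz or; apply: (normalField_root_minPoly (sub1v _)).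
- exact: cyclotomic_normalField pz.
- exact: memv_adjoin.
have zn : z ^+ (2 ^ n) = -1.
  have : (z ^+ (2 ^ n)) ^+ 2 == 1 by rewrite -exprM -expnSr prim_expr_order.
  rewrite sqrf_eq1 => /orP[|/eqP //]; rewrite -(prim_order_dvd pz).
  by rewrite dvdn_Pexp2l // ltnn.
have [p pE] : exists p, minPoly 1 z = map_poly (in_alg L) p.
  by have /polyOver1P[p ->] := minPolyOver 1 z; exists p.
have mapf : map_poly (in_alg L) ('X^(2 ^ n) + 1) = 'X^(2 ^ n) + 1.
  by rewrite rmorphD rmorph1 rmorphXn /= map_polyX.
have pf : p %| 'X^(2 ^ n) + 1.
  rewrite -(dvdp_map (in_alg L)) -pE mapf; apply: minPoly_dvdp.
    by rewrite rpredD ?rpredX ?polyOverX ?rpred1.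
  by rewrite rootE !hornerE zn addNr.
have sp : size p != 1%N.
  by rewrite -(size_map_poly (in_alg L)) -pE size_minPoly.
have pq : map_poly (in_alg L) p %= map_poly (in_alg L) ('X^(2 ^ n) + 1).
  by rewrite eqp_map; apply: (apply_irredp (irreducible_rat_XnaddC n)).
rewrite pE (eqp_root pq) mapf rootE !hornerE -exprM mulnC exprM zn.
by rewrite -signr_odd or expr1 addNr.
Qed.

Lemma galois_prim_root_coprime (L : splittingFieldType rat) n (z : L) E sigma r :
  n.-primitive_root z -> sigma \in 'Gal(E / 1%AS)%g -> sigma z = z ^+ r -> coprime r n.
Proof.
move=> pz _ zr; rewrite -(prim_root_exp_coprime r pz) -zr.
by rewrite (fmorph_primitive_root sigma).
Qed.

End CyclotomicAutomorphisms.

(** * Rational classes *)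

Section KClassesD5.

Local Open Scope group_scope.

Variables (m1 m2 m3 : nat) (gT : finGroupType) (t1 t2 t3 x y : gT).
Variables (L : splittingFieldType rat) (zeta : L).
Hypotheses (hm1 : (3 <= m1)%N) (hG : type_D5 m1 m2 m3 t1 t2 t3 x y)
  (hzeta : ((exponent [set: gT]).-primitive_root zeta)%R).

Local Notation G := [set: gT]%G.
Local Notation s := (t1 ^+ (2 ^ m1.-1)).

Lemma D5_exponent : exists n, exponent G = (2 ^ n.+1)%N.
Proof.
have [n nE] : exists n, exponent G = (2 ^ n)%N.
  have := D5_pgroup hG; rewrite -pnat_exponent.
  by case/p_natP => n nE; exists n.
case: n nE => [|n] nE; last by exists n.
case/negP: (D5_s_neq1 hm1 hG); rewrite -[s]expg1 -[1%N]/(2 ^ 0)%N -nE.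
by rewrite expg_exponent ?in_setT.
Qed.

Lemma D5_cycle_s : <[s]> = [set 1; s].
Proof.
apply: cycle2g; apply: nt_prime_order => //; [exact: (D5_s2 hm1 hG)|exact: (D5_s_neq1 hm1 hG)].
Qed.

Lemma D5_class w : w \notin 'Z(G) -> w ^: G = [set w; s * w].
Proof.
move=> wZ; apply/eqP; rewrite eqEcard; apply/andP; split.
  apply/subsetP => _ /imsetP[g _ ->].
  have : [~ w, g] \in <[s]> by rewrite -(D5_der1 hG) mem_commg ?in_setT.
  rewrite D5_cycle_s conjg_mulR !inE => /orP[] /eqP ->; first by rewrite mulg1 eqxx.
  by rewrite (center_commute w (D5_s_center hG)) eqxx orbT.
have -> : #|[set w; s * w]| = 2.
  rewrite cards2 eq_sym -{2}[w]mul1g (inj_eq (mulIg w)).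
  by rewrite (D5_s_neq1 hm1 hG).
rewrite ltnNge; apply: contra wZ; rewrite -index_cent1 => h.
have : #|G : 'C_G[w]| == 1%N by rewrite eqn_leq h indexg_gt0.
rewrite indexg_eq1 => Gw; apply/centerP; split; first exact: in_setT.
move=> g gG; have := subsetP Gw g gG; rewrite inE => /andP[_ /cent1P].
exact: commute_sym.
Qed.

Local Notation cl w := (coset G^`(1) w).

Let nD w : w \in 'N(G^`(1)).
Proof. by apply: (subsetP (der_norm 1 G)); rewrite in_setT. Qed.

Lemma D5_coset_eq w w' : cl w = cl w' -> w' = w \/ w' = s * w.
Proof.
move=> ww'; have : w' * w^-1 \in G^`(1).
  apply: coset_idr; rewrite // morphM // morphV //= ww' mulgV //.
rewrite (D5_der1 hG) D5_cycle_s !inE => /orP[] /eqP E; [left|right].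
  by apply: (mulIg w^-1); rewrite E mulgV.
by rewrite -E mulgKV.
Qed.

Lemma D5_coset_class w w' : w \notin 'Z(G) -> cl w = cl w' -> w ^: G = w' ^: G.
Proof.
move=> wZ /D5_coset_eq h; apply/esym/class_eqP; rewrite (D5_class wZ) !inE.
by case: h => ->; rewrite eqxx ?orbT.
Qed.

Lemma D5_class_coset w w' : w ^: G = w' ^: G -> cl w = cl w'.
Proof.
move=> E; have : w \in w' ^: G by rewrite -E class_refl.
case/imsetP => g _ ->; rewrite conjg_mulR morphM //=.
by rewrite (coset_id (mem_commg _ _)) ?mulg1 ?in_setT.
Qed.

(** An automorphism preserves the order of [zeta], which forces an odd exponent; conversely each odd
    exponent is realised, after reduction modulo the exponent of G as [K_class] demands. *)
Lemma K_class_D5 w D : D \in K_class zeta G (w ^: G) <->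
  exists2 r, odd r & D = (w ^+ r) ^: G.
Proof.
have [n nE] := D5_exponent; have pz := hzeta; rewrite nE in pz.
have im r : [set g ^+ r | g in w ^: G] = (w ^+ r) ^: G.
  apply/setP=> h; apply/imsetP/imsetP => [[_ /imsetP[g gG ->] ->]|[g gG ->]].
    by exists g; rewrite // conjXg.
  by exists (w ^ g); [apply: imset_f | rewrite conjXg].
rewrite inE; split.
  case/andP=> _ /existsP[sigma] /andP[sG /existsP[r /andP[/eqP zr /eqP ->]]].
  exists r; last exact: im.
  have := galois_prim_root_coprime pz sG zr.
  by rewrite coprime_sym coprime_pexpl // coprime2n.
case=> r or ->; rewrite mem_classes ?in_setT //=.
have [sigma sG zr] := cyclotomic_galois_odd pz or.
have e0 : (0 < exponent G)%N by apply: exponent_gt0.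
apply/existsP; exists sigma; rewrite sG /=; apply/existsP.
exists (Ordinal (ltn_pmod r e0)) => /=.
rewrite (prim_expr_mod hzeta) zr eqxx im /=.
have -> // : w ^+ (r %% exponent G) = w ^+ r.
by apply: expg_mod; apply: expg_exponent; rewrite in_setT.
Qed.

Let f w := K_class zeta G (w ^: G).
Let g w := <[cl w]>%G.

Lemma D5_sqr_center w : w ^+ 2 \in 'Z(G).
Proof.
have [z zZ [i [j ->]]] := D5_cover hG w.
have [_ _ _ [_ t2Z t3Z] [x2 y2 _]] := hG.
rewrite expgMn; last exact: center_commute.
apply: groupM; first exact: groupX.
have cs h : s * h = h * s := center_commute h (D5_s_center hG).
have yx : y * x = s * (x * y).
  by rewrite cs (D5_xy hG) -mulgA -[s * s]/(s ^+ 2) (D5_s2 hm1 hG) mulg1.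
have xyxy : (x * y) ^+ 2 = s * (x ^+ 2 * y ^+ 2).
  by rewrite !expgS !expg0 !mulg1 -mulgA [y * (x * y)]mulgA yx !mulgA -cs.
case: i j => [] [] /=; rewrite ?mul1g ?mulg1 ?expg1 ?expg1n ?group1 //.
- by rewrite xyxy x2 y2 !groupM ?(D5_s_center hG).
- by rewrite x2.
by rewrite y2.
Qed.

Lemma D5_odd_power w r : odd r -> exists2 a, a \in 'Z(G) & w ^+ r = a * w.
Proof.
move=> or; exists ((w ^+ 2) ^+ r./2); first by rewrite groupX ?D5_sqr_center.
by rewrite -expgM mul2n -expgSr -[in LHS](odd_double_half r) or.
Qed.

Lemma D5_odd_power_center w r : odd r -> (w ^+ r \in 'Z(G)) = (w \in 'Z(G)).
Proof. by case/(D5_odd_power w) => a aZ ->; rewrite groupMl. Qed.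

Lemma D5_even_power_center w r : ~~ odd r -> w ^+ r \in 'Z(G).
Proof.
move=> or; rewrite -[r]odd_double_half (negPf or) add0n -mul2n expgM.
by rewrite groupX ?D5_sqr_center.
Qed.

Lemma D5_coset_center w w' : cl w = cl w' -> (w' \in 'Z(G)) = (w \in 'Z(G)).
Proof. by case/D5_coset_eq => -> //; rewrite groupMl ?(D5_s_center hG). Qed.

Let clX w r : cl (w ^+ r) = cl w ^+ r.
Proof. by rewrite -(morphX (coset_morphism _)). Qed.

Lemma D5_cycle_mem w w' : g w = g w' -> exists r, cl w' = cl (w ^+ r).
Proof.
move=> gw; have : cl w' \in g w by rewrite gw cycle_id.
by case/cycleP => r rE; exists r; rewrite clX.
Qed.

Lemma D5_K_class_sub w w' : w \notin 'Z(G) -> w' \notin 'Z(G) -> g w = g w' ->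
  f w' \subset f w.
Proof.
move=> wZ wZ' /D5_cycle_mem[r rE]; apply/subsetP => D /K_class_D5[k ok ->].
have or : odd r.
  by apply: contraNT wZ' => or; rewrite (D5_coset_center (esym rE)) D5_even_power_center.
apply/K_class_D5; exists (r * k)%N; first by rewrite oddM or.
apply: D5_coset_class; first by rewrite D5_odd_power_center.
by rewrite expgM clX rE -clX.
Qed.

(** For noncentral elements the conjugacy class is the coset of G'. If the cosets generate the same
    cyclic group, each is a power of the other, with odd exponent because even powers are
    central. *)
Lemma D5_K_class_eq w w' : w \notin 'Z(G) -> w' \notin 'Z(G) ->
  (f w == f w') = (g w == g w').
Proof.
move=> wZ wZ'; apply/eqP/eqP => [fw|gw]; last first.
  by apply/eqP; rewrite eqEsubset !D5_K_class_sub.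
have sub v v' : f v = f v' -> g v \subset g v'.
  move=> fv; have : v ^: G \in f v by apply/K_class_D5; exists 1%N.
  rewrite fv => /K_class_D5[r _ /D5_class_coset vE].
  by rewrite cycle_subG vE clX mem_cycle.
by apply/val_inj/eqP; rewrite eqEsubset !sub.
Qed.

(** The coset of Z(G) can thus be read off from the cyclic subgroup of G / G', which makes the
    images of the four cosets under [g] disjoint. *)
Lemma D5_same_cycle w w' : g w = g w' -> w' * w^-1 \in 'Z(G).
Proof.
move=> gw; have [r rE] := D5_cycle_mem gw.
have [wZ|wZ] := boolP (w \in 'Z(G)).
  by rewrite groupMr ?groupV // (D5_coset_center (esym rE)) groupX.
have [or|/(D5_even_power_center w) or] := boolP (odd r); last first.
  have wZ' : w' \in 'Z(G) by rewrite (D5_coset_center (esym rE)).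
  have [k kE] := D5_cycle_mem (esym gw).
  by case/negP: wZ; rewrite (D5_coset_center (esym kE)) groupX.
have [a aZ wr] := D5_odd_power w or.
have [->|->] := D5_coset_eq (esym rE); rewrite wr ?mulgA mulgK //.
by rewrite groupMl ?(D5_s_center hG).
Qed.

Lemma card_imset_fibers (I : finType) (U V : finType) (W : {set I})
    (h : I -> U) (k : I -> V) :
  {in W &, forall a b, (h a == h b) = (k a == k b)} -> #|h @: W| = #|k @: W|.
Proof.
have le (U1 V1 : finType) (h1 : I -> U1) (k1 : I -> V1) :
    {in W &, forall a b, (h1 a == h1 b) = (k1 a == k1 b)} ->
    (#|h1 @: W| <= #|k1 @: W|)%N.
  have injS : injective (@Some U1) by move=> a b [].
  move=> hk; rewrite -(card_imset _ injS).
  (* [option] provides a value where no preimage exists, since [U1] has no default element. *)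
  pose q c := omap h1 [pick w in W | k1 w == c].
  apply: leq_trans (leq_imset_card q _); apply/subset_leq_card/subsetP.
  move=> _ /imsetP[_ /imsetP[w wW ->] ->]; apply/imsetP; exists (k1 w); first exact: imset_f.
  rewrite /q; case: pickP => [w' /andP[wW' kw]|/(_ w)]; last by rewrite /= wW eqxx.
  by congr Some; apply/eqP; rewrite hk // eq_sym.
move=> hk; apply/eqP; rewrite eqn_leq !le // => a b aW bW.
by rewrite hk.
Qed.

(** Odd powers stay in their coset of Z(G), so the rational classes involving [z] are exactly those
    of elements of that coset; [D5_K_class_eq] then compares fibres. *)
Lemma D5_card_involving z : z \notin 'Z(G) ->
  #|K_classes_involving zeta G s z| = #|g @: ('Z(G) :* z)|.
Proof.
move=> zZ; have azZ w : w \in 'Z(G) :* z -> w \notin 'Z(G).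
  by case/rcosetP => a aZ ->; rewrite groupMl.
rewrite -(card_imset_fibers (h := f)); last first.
  by move=> w w' /azZ wZ /azZ wZ'; apply: D5_K_class_eq.
apply: eq_card => O; rewrite inE; apply/andP/imsetP.
  case=> /imsetP[_ /imsetP[w _ ->] ->] /subsetP sub.
  exists w => //; have : w ^: G \in f w by apply/K_class_D5; exists 1%N.
  case/sub/imsetP => a aZ wE; have : w \in w ^: G by apply: class_refl.
  rewrite wE !inE => /orP[] /eqP ->; apply/rcosetP; first by exists a.
  by exists (s * a); rewrite ?groupM ?(D5_s_center hG).
case=> w wz ->; split; first by apply: imset_f; rewrite mem_classes ?in_setT.
apply/subsetP => D /K_class_D5[r or ->]; have [b bZ wr] := D5_odd_power w or.
have wrz := wr; case/rcosetP: wz (azZ _ wz) wr => a aZ -> wZ wr.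
apply/imsetP; exists (b * a); first exact: groupM.
by rewrite D5_class ?D5_odd_power_center // wr !mulgA.
Qed.

Lemma D5_num_cyclic_quotient (B : {group gT}) : G^`(1) \subset B ->
  num_cyclic_subgroups (B / G^`(1))%G = #|g @: B|.
Proof.
move=> sB; apply: eq_card => D; rewrite inE; apply/andP/imsetP.
  case=> DB /cyclicP[Y DE]; have : Y \in B / G^`(1) by rewrite (subsetP DB) // DE cycle_id.
  by case/morphimP => w _ wB YE; exists w => //; apply: val_inj; rewrite /= DE YE.
by case=> w wB ->; rewrite cycle_cyclic cycle_subG mem_quotient.
Qed.

(** A cyclic subgroup of G / G' has all its generators over one of the four cosets of Z(G),
    represented by 1, x, y, xy. *)
Lemma D5_num_cyclic_involving :
  num_cyclic_subgroups (G / G^`(1))%G =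
  (num_cyclic_subgroups ('Z(G) / G^`(1))%G +
   #|K_classes_involving zeta G s x| + #|K_classes_involving zeta G s y| +
   #|K_classes_involving zeta G s (x * y)|)%N.
Proof.
have xZ := D5_x_notin_center hm1 hG; have yZ := D5_y_notin_center hm1 hG.
have xyZ := D5_xy_notin_center hm1 hG.
have dZ : G^`(1) \subset 'Z(G) by rewrite (D5_der1 hG) cycle_subG (D5_s_center hG).
rewrite !D5_card_involving // !D5_num_cyclic_quotient ?subsetT //.
have GE : G = 'Z(G) :|: 'Z(G) :* x :|: 'Z(G) :* y :|: 'Z(G) :* (x * y) :> {set gT}.
  apply/setP=> w; rewrite in_setT; apply/esym; rewrite 3!in_setU !mem_rcoset.
  have [z zZ [i [j ->]]] := D5_cover hG w.
  by case: i j => [] [] /=; rewrite ?mul1g ?mulg1 ?expg1 ?mulgK ?zZ ?orbT.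
have dis z z' : z' * z^-1 \notin 'Z(G) ->
    [disjoint g @: ('Z(G) :* z) & g @: ('Z(G) :* z')].
  move=> zz; rewrite -setI_eq0; apply/eqP/setP=> D; rewrite !inE; apply/negP.
  case/andP => /imsetP[_ /rcosetP[a aZ ->] ->] /imsetP[_ /rcosetP[b bZ ->]].
  move/D5_same_cycle; rewrite invMg -!mulgA groupMl // mulgA groupMr ?groupV //.
  exact/negP.
have Z1 : 'Z(G) = 'Z(G) :* 1 by rewrite mulg1.
have cU (A B : {set {group coset_of G^`(1)}}) : [disjoint A & B] -> #|A :|: B| = (#|A| + #|B|)%N.
  by move=> dAB; rewrite cardsU (disjoint_setI0 dAB) cards0 subn0.
have yx' : y * x^-1 \notin 'Z(G).
  apply: contra xyZ => h; have -> : x * y = s * ((y * x^-1) * x ^+ 2).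
    rewrite (center_commute _ (D5_s_center hG)) (D5_xy hG) -[x ^+ 2]/(x * x).
    by rewrite mulgA mulgKV.
  by apply: groupM (D5_s_center hG) (groupM h (D5_sqr_center x)).
have xyx : x * y * x^-1 \notin 'Z(G).
  by apply: contra yZ => h; rewrite -(mulKg x y) -[x * y](mulgKV x) (center_commute _ h) mulKg.
have := dis 1 x; have := dis 1 y; have := dis 1 (x * y); have := dis x y.
have := dis x (x * y); have := dis y (x * y).
rewrite !invg1 !mulg1 mulgK => /(_ xZ) d1 /(_ xyx) d2 /(_ yx') d3 /(_ xyZ) d4 /(_ yZ) d5 /(_ xZ) d6.
have dU (A B C : {set {group coset_of G^`(1)}}) : [disjoint A & C] -> [disjoint B & C] ->
    [disjoint A :|: B & C].
  by rewrite -!setI_eq0 setIUl => /eqP -> /eqP ->; rewrite setU0.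
have -> : g @: G = g @: 'Z(G) :|: g @: ('Z(G) :* x) :|: g @: ('Z(G) :* y) :|: g @: ('Z(G) :* (x * y)).
  rewrite -!imsetU; apply/setP=> D; apply/imsetP/imsetP => -[w wB ->]; exists w => //.
    by rewrite -GE in_setT.
by rewrite !cU // !dU.
Qed.

End KClassesD5.

(** * Components of the group algebra *)

Section CentralSplit.

Local Open Scope ring_scope.

Variables (K : fieldType) (A : falgType K).
Hypothesis two_neq0 : (2%:R : K) != 0.

(* The two eigenspaces of a central square root [w] of [c ^ 2]. *)
Lemma central_split (e w : A) (c : K) :
  central_idempotent e -> (forall a, w * a = a * w) -> w * e = w ->
  w * w = (c * c) *: e -> c != 0 -> w != c *: e -> w != - (c *: e) ->
  exists h : bool -> A,
    [/\ forall b, central_idempotent (h b), h true * h false = 0,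
        h true + h false = e,
        forall b, h b * e = h b
      & forall b, w * h b = (if b then c else - c) *: h b].
Proof.
move=> [ee ce e0] cw we ww c0 wc wc'; have ew : e * w = w by rewrite ce.
pose k (b : bool) := if b then c else - c.
have kk b : k b * k b = c * c by case: b; rewrite /k ?mulrNN.
have k0 b : k b != 0 by case: b; rewrite /k ?oppr_eq0.
pose h b := 2%:R^-1 *: (e + (k b)^-1 *: w).
have wh b : w * h b = k b *: h b.
  rewrite /h -scalerAr mulrDr we -scalerAr ww -(kk b) scalerA mulKf //.
  rewrite [RHS]scalerA [k b * _]mulrC -scalerA; congr (_ *: _).
  by rewrite scalerDr scalerA mulfV // scale1r addrC.
have eh b : e * h b = h b by rewrite /h -scalerAr mulrDr ee -scalerAr ew.
have he b : h b * e = h b by rewrite /h -scalerAl mulrDl ee -scalerAl we.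
have hh b : h b * h b = h b.
  rewrite {1}/h -scalerAl mulrDl eh -scalerAl wh scalerA mulVf // scale1r.
  by rewrite -mulr2n -scaler_nat scalerA mulVf // scale1r.
exists h; split=> // [b||].
- split=> //.
    move=> a; rewrite /h -scalerAl -scalerAr; congr (_ *: _).
    by rewrite mulrDl mulrDr ce -scalerAl -scalerAr cw.
  (* A vanishing eigenspace would make w equal to c e or - c e, the two excluded values. *)
  rewrite scaler_eq0 invr_eq0 (negPf two_neq0) /= addr_eq0.
  apply/eqP => /(congr1 (fun a => k b *: a)); rewrite scalerN scalerA mulfV // scale1r => h0.
  case: b h0; rewrite /k ?scaleNr => h0.
    by case/eqP: wc'; rewrite h0 opprK.
  by case/eqP: wc; rewrite -[w]opprK -h0 opprK.
- rewrite {1}/h -scalerAl mulrDl eh -scalerAl wh scalerA /= mulrN mulVf //.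
  by rewrite scaleN1r subrr scaler0.
rewrite /h -scalerDr /k invrN scaleNr addrACA subrr addr0.
by rewrite -mulr2n -scaler_nat scalerA mulVf // scale1r.
Qed.

End CentralSplit.

Section Components.

Local Open Scope ring_scope.

Variables (K : fieldType) (gT : finGroupType).
Hypothesis two_neq0 : (2%:R : K) != 0.

Local Notation A := (group_algebra K gT).
Local Notation delta g := (ga_delta K g : A).
Implicit Types (g h : gT) (e a : A).

(* The corner of [K[B]] at [e] is a simple extension of [K], generated by a root
   of an irreducible polynomial. *)
Definition root_spanned (B : {group gT}) (e : A) :=
  exists2 g, g \in B & (exists2 f, irreducible_poly f & horner_alg (delta g) f * e = 0)
    /\ forall h, h \in B -> exists i, delta h * e = delta g ^+ i * e.

Section Peirce.

Variable e : A.
Hypothesis ce : central_idempotent e.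
Local Notation P := (subvs_of (peirce e)).
Let rho a : P := Subvs (mulr_peirce a ce).

Let ee : e * e = e. Proof. by case: ce. Qed.
Let eC a : e * a = a * e. Proof. by case: ce. Qed.
Let rhoK (b : P) : rho (vsval b) = b.
Proof. by apply: val_inj; apply/eqP; rewrite /= -mem_peirce ?subvsP. Qed.
Let rhoM a b : rho (a * b) = rho a * rho b.
Proof. by apply: val_inj; rewrite /= -!mulrA [e * _]mulrA eC -!mulrA ee. Qed.
Let rhoD a b : rho (a + b) = rho a + rho b.
Proof. by apply: val_inj; rewrite /= mulrDl. Qed.
Let rhoZ k a : rho (k *: a) = k *: rho a.
Proof. by apply: val_inj; rewrite /= -scalerAl. Qed.
Let rho1 : rho 1 = 1.
Proof. by apply: val_inj; rewrite /= mul1r algid_peirce. Qed.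
Let rhoX a n : rho (a ^+ n) = rho a ^+ n.
Proof. by elim: n => [|n IH]; rewrite ?expr0 ?rho1 // !exprS rhoM IH. Qed.
Let rhoN a : rho (- a) = - rho a.
Proof. by apply: val_inj; rewrite /= mulNr. Qed.
Let rho_eq a b : a * e = b * e -> rho a = rho b.
Proof. by move=> ab; apply: val_inj. Qed.

Let rho_horner a p : rho (horner_alg a p) = horner_alg (rho a) p.
Proof.
elim/poly_ind: p => [|p c IHp]; first by apply: val_inj; rewrite /= !rmorph0 mul0r linear0.
rewrite !rmorphD !rmorphM /= !horner_algX !horner_algC rhoD rhoM IHp rhoZ.
by rewrite rho1.
Qed.

Let rho_ind (Q : P -> Prop) : Q 0 -> (forall a b : P, Q a -> Q b -> Q (a + b)) ->
  (forall k h, Q (k *: rho (delta h))) -> forall b, Q b.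
Proof.
move=> Q0 QD Qd b; rewrite -(rhoK b) (ga_sum_delta (vsval b)).
have rho0 : rho 0 = 0 by apply: val_inj; rewrite /= mul0r ?linear0.
rewrite (big_morph rho rhoD rho0); apply: (big_ind Q) => // h _.
by rewrite rhoZ.
Qed.

Lemma field_component : root_spanned [set: gT]%G e -> field_algebra P.
Proof.
case=> g _ [[f irr_f fg] gen]; apply: (field_algebra_generated (z := rho (delta g)) irr_f).
  by rewrite -rho_horner; apply: val_inj; rewrite /= fg ?linear0.
apply: rho_ind => [|a b [p ->] [q ->]|k h].
- by exists 0; rewrite rmorph0.
- by exists (p + q); rewrite rmorphD.
have [i hi] := gen h (in_setT h); exists (k *: 'X^i).
by rewrite linearZ rmorphXn /= horner_algX -rhoX mulr_algl (rho_eq hi).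
Qed.

Variables (Z : {group gT}) (x y t : gT).
Hypotheses (cZ : forall z a, z \in Z -> delta z * a = a * delta z)
  (xx : (x ^+ 2)%g \in Z) (yy : (y ^+ 2)%g \in Z)
  (cover : forall g, exists2 z, z \in Z & exists i j : bool, g = (z * (x ^+ i * y ^+ j))%g)
  (xy : delta (x * y)%g * e = - (delta (y * x)%g * e))
  (tZ : t \in Z) (tt : delta (t ^+ 2)%g * e = - e)
  (root_e : root_spanned Z e).

(** By [cover], the corner is spanned over K[z] by 1, u, v, uv, where z, u, v are the images of g,
    x, y; the image of [t] is a power of z with square -1, as [matrix2_algebra_even] requires. *)
Lemma quaternion_component : quaternion_algebra P /\ matrix2_algebra P.
Proof.
have [g gZ [[f irr_f fg] gen]] := root_e.
pose z := rho (delta g); pose u := rho (delta x); pose v := rho (delta y).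
have fz : horner_alg z f = 0 by rewrite -rho_horner; apply: val_inj; rewrite /= fg ?linear0.
have cz b : z * b = b * z by rewrite -(rhoK b) -!rhoM cZ.
have zU : z \is a GRing.unit.
  apply/unitrP; exists (rho (delta g^-1%g)); rewrite -!rhoM !ga_deltaM mulVg mulgV.
  by rewrite rho1.
have dsq h : rho (delta h) * rho (delta h) = rho (delta (h ^+ 2)%g).
  by rewrite -rhoM ga_deltaM.
have [i iE] := gen _ xx; have [j jE] := gen _ yy; have [k kE] := gen _ tZ.
have uu : u * u = z ^+ i by rewrite dsq -rhoX (rho_eq iE).
have vv : v * v = z ^+ j by rewrite dsq -rhoX (rho_eq jE).
have uv : u * v = - (v * u).
  rewrite -!rhoM -rhoN !ga_deltaM; apply: rho_eq; by rewrite mulNr.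
have zk : z ^+ (k + k) = -1.
  rewrite exprD -rhoX -(rho_eq kE) dsq -rho1 -rhoN; apply: rho_eq.
  by rewrite tt mulNr mul1r.
have genP b : exists p : 4.-tuple {poly K},
    b = horner_alg z (tnth p 0) + horner_alg z (tnth p 1) * u
        + horner_alg z (tnth p 2) * v + horner_alg z (tnth p 3) * (u * v).
  elim/rho_ind: b => [|a b [p ->] [q ->]|c h].
  - by exists [tuple 0; 0; 0; 0]; rewrite !(tnth_nth 0) /= !rmorph0 !mul0r !addr0.
  - exists [tuple tnth p 0 + tnth q 0; tnth p 1 + tnth q 1; tnth p 2 + tnth q 2;
                  tnth p 3 + tnth q 3].
    rewrite !(tnth_nth 0 [tuple _; _; _; _]) /= !rmorphD /= !mulrDl.
    rewrite addrACA [_ + horner_alg z (tnth p 2) * v + _]addrACA.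
    by rewrite [_ + horner_alg z (tnth p 1) * u + _]addrACA.
  have [w wZ [a [b hE]]] := cover h; have [n nE] := gen _ wZ.
  have wE : rho (delta h) = z ^+ n * (rho (delta (x ^+ a)%g) * rho (delta (y ^+ b)%g)).
    by rewrite hE -!ga_deltaM !rhoM (rho_eq nE) rhoX.
  have hX : horner_alg z (c *: 'X^n) = c *: z ^+ n.
    by rewrite linearZ rmorphXn /= horner_algX mulr_algl.
  have d1 : rho (delta (1 : gT)%g) = 1 by rewrite rho1.
  exists [tuple (if ~~ a && ~~ b then c *: 'X^n else 0); (if a && ~~ b then c *: 'X^n else 0);
                (if ~~ a && b then c *: 'X^n else 0); (if a && b then c *: 'X^n else 0)].
  rewrite wE !(tnth_nth 0) /=; case: a b {hE wE} => [] [] /=;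
    by rewrite ?expg1 ?expg0 ?d1 hX ?rmorph0 ?mul0r ?addr0 ?add0r ?mulr1 ?mul1r -?scalerAl.
have cuv (a : P) : u * a = a * u -> v * a = a * v -> a \in 'Z({:P})%VS.
  move=> ua va; rewrite memv_cap memvf; apply/centvP => b _.
  have [p ->] := genP b.
  have cp p' : GRing.comm a (horner_alg z p') by apply/esym/horner_alg_central.
  have cu : GRing.comm a u by []. have cv : GRing.comm a v by [].
  exact: commrD (commrD (commrD (cp _) (commrM (cp _) cu)) (commrM (cp _) cv))
    (commrM (cp _) (commrM cu cv)).
split; first exact: (quaternion_algebra_generated irr_f fz two_neq0 cz zU uu vv uv genP).
apply: (matrix2_algebra_even two_neq0 cz zU _ zk uu vv uv cuv).
exact: (center_field irr_f fz two_neq0 cz zU uu vv uv genP).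
Qed.

End Peirce.

End Components.

Section FiniteFieldFacts.

Local Open Scope ring_scope.

Variable K : finFieldType.

Lemma finField_card_natr : #|K|%:R = 0 :> K.
Proof.
have := @expg_cardG K [set: K]%G (1%R : K) (in_setT _); rewrite FinRing.zmodXgE cardsT => h.
exact: h.
Qed.

Lemma odd_card_two_neq0 : odd #|K| -> (2%:R : K) != 0.
Proof.
move=> oK; apply: contraNneq (oner_neq0 K) => two0.
by rewrite -finField_card_natr -[#|K|]odd_double_half oK -mul2n natrD natrM two0 mul0r addr0.
Qed.

(** With #|K| = 8j + 3, c^2 = -1 would give c^#|K| = (-1)^(4j+1) c = -c, against c^#|K| = c. *)
Lemma finField_sqrt_opp1 (c : K) : #|K| = 3 %[mod 8] -> c * c != -1.
Proof.
move=> K3; have oK : odd #|K| by lia.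
apply/eqP => cc; have c0 : c != 0.
  by apply/eqP => c0; move/eqP: cc; rewrite c0 mul0r eq_sym oppr_eq0 oner_eq0.
have := expf_card c; have -> : #|K| = (2 * (#|K| %/ 4 * 2 + 1)).+1 by lia.
rewrite exprSr exprM expr2 cc -signr_odd oddD oddM andbF /= expr1 mulN1r => /eqP.
rewrite eq_sym -subr_eq0 opprK -mulr2n -mulr_natl mulf_eq0 (negPf c0) orbF.
by rewrite (negPf (odd_card_two_neq0 oK)).
Qed.

End FiniteFieldFacts.

Section QuarticFactor.

Local Open Scope ring_scope.

Lemma horner_quartic_factor (K : fieldType) (A : falgType K) (a : A) (c b : K) n :
  horner_alg a (quartic_factor c b n) = a ^+ (n + n) - c *: a ^+ n + b%:A.
Proof.
rewrite /quartic_factor rmorphD rmorphB !rmorphXn /= horner_algX horner_algC.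
by rewrite linearZ /= mulr_algl rmorphXn /= horner_algX.
Qed.

(** The roots have order 2^(k+3), and [order_mod_pow2] at k + 1 bounds the order of #|K| modulo
    2^(k+3) below by 2^(k+1), the degree of the factor. *)
Lemma quartic_factor_irreducible (K : finFieldType) (c b : K) k :
  #|K| = 3 %[mod 8] -> b * b = 1 -> c * c = b + b ->
  irreducible_poly (quartic_factor c b (2 ^ k)).
Proof.
move=> K3 bb cc; have oK : odd #|K| by lia.
have n0 : (0 < 2 ^ k)%N by rewrite expn_gt0.
apply: (irreducible_order_pow2 (n := (2 ^ k + 2 ^ k)%N) (k := k.+2)).
- exact: odd_card_two_neq0.
- exact: size_quartic_factor.
- by rewrite addn_gt0 n0.
- have -> : (2 ^ k.+2 = 2 ^ k + 2 ^ k + (2 ^ k + 2 ^ k))%N by rewrite !expnS; lia.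
  exact: quartic_factor_dvd.
move=> d d_gt0 dv; have [_] := order_mod_pow2 (k := k.+1) K3 d_gt0 dv.
by rewrite expnS mul2n -addnn.
Qed.

End QuarticFactor.

Section CocyclicComponents.

Local Open Scope ring_scope.

Variables (K : fieldType) (gT : finGroupType).
Hypotheses (two_neq0 : (2%:R : K) != 0) (pG : (2.-group [set: gT])%g).

Local Notation A := (group_algebra K gT).
Local Notation delta g := (ga_delta K g : A).
Implicit Types (g h z : gT) (a : A) (C D H P : {group gT}).

Variables (B M : {group gT}).
Hypotheses (sMB : M \subset B)
  (nMB : forall C, M \subset C -> C \subset B -> (C <| [set: gT])%g).

Local Notation e := (cocyclic_idem K B).
Local Notation cocyclic := (cocyclic B M).

Let pB : (2.-group B)%g. Proof. exact: pgroupS (subsetT B) pG. Qed.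

Lemma ga_deltaX g n : delta g ^+ n = delta (g ^+ n)%g.
Proof. by elim: n => // n IH; rewrite exprS IH ga_deltaM expgS. Qed.

Lemma cocyclic_generator C : C \in cocyclic -> exists2 g, g \in B &
  (forall h, h \in B -> exists i, delta h * e C = delta g ^+ i * e C) /\
  (forall i, (g ^+ i \in C)%g = (#|B / C|%g %| i)%N).
Proof.
move=> cC; have [MC CB nCB cBC] := cocyclicP cC.
have [Y YE] := cyclicP cBC; have : Y \in (B / C)%g by rewrite YE cycle_id.
case/morphimP => g gN gB gE; exists g => //; split=> [h hB|i].
  have hN : h \in ('N(C))%g by apply: (subsetP (normal_norm nCB)).
  have : coset C h \in <[Y]>%g by rewrite -YE mem_quotient.
  case/cycleP => i; rewrite gE -(morphX (coset_morphism C)) //= => hE.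
  exists i; have hC : (h * (g ^+ i)^-1)%g \in C.
    apply: coset_idr; rewrite ?groupM ?groupV ?groupX //.
    by rewrite morphM ?morphV ?groupV ?groupX //= hE mulgV.
  have [_ ec _] := cocyclic_idem_central two_neq0 pG sMB nMB cC.
  rewrite -[h](mulgKV (g ^+ i)%g) -ga_deltaM -mulrA -ec mulrA (cocyclic_idem_delta K cC) //.
  by rewrite ec ga_deltaX.
rewrite YE -orderE order_dvdn gE -(morphX (coset_morphism C)) //=.
apply/idP/eqP => [/coset_id //|]; apply: coset_idr; exact: groupX.
Qed.

Lemma mem_overgroup_sqr C z : C \in cocyclic -> C != B -> z \in overgroup B C ->
  (z ^+ 2)%g \in C.
Proof.
move=> cC neCB zO; have [MC CB nCB cBC] := cocyclicP cC.
have [zC|zC] := boolP (z \in C); first exact: groupX.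
exact: index2_square (overgroup_sub B C) (overgroup_index pB nCB cBC neCB) zO zC.
Qed.

Lemma cocyclic_idem_delta_opp C z : C \in cocyclic -> z \in B -> z \notin C ->
  (z ^+ 2)%g \in C -> delta z * e C = - e C.
Proof.
move=> cC zB zC zz; have [MC CB nCB cBC] := cocyclicP cC.
have neCB : C != B by apply: contraNneq zC => ->.
apply: (cocyclic_idem_delta_overgroup two_neq0 pG nMB cC neCB) => //.
exact: mem_overgroup.
Qed.

Lemma ga_mul_delta1 h a : (delta h * a) 1%g = a h^-1%g.
Proof.
rewrite ffunE (bigD1 h) //= ffunE eqxx mul1r mulg1 big1 ?addr0 // => k kh.
by rewrite ffunE (negPf kh) mul0r.
Qed.

(** The support of [e C] lies in the overgroup, whose elements have squares in C. Together with
    [cocyclic_idem_at1] this shows that certain elements of a corner are not scalar multiples of its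
    unit. *)
Lemma cocyclic_idem_outside C h : C \in cocyclic -> C != B -> h \in B ->
  (h ^+ 2)%g \notin C -> (delta h * e C) 1%g = 0.
Proof.
move=> cC neCB hB hh; have hO : h^-1%g \notin overgroup B C.
  by rewrite groupV; apply: contra hh; apply: mem_overgroup_sqr.
rewrite ga_mul_delta1 /cocyclic_idem (negPf neCB) !ffunE !sum_ffunE.
have nC := contra (subsetP (overgroup_sub B C) _) hO.
rewrite !big1 ?scaler0 ?subr0 // => k kO.
  by rewrite ffunE; case: eqP hO => // ->; rewrite kO.
by rewrite ffunE; case: eqP nC => // ->; rewrite kO.
Qed.

Lemma cocyclic_idem_at1 C : C \in cocyclic -> C != B -> e C 1%g != 0.
Proof.
move=> cC neCB; have [MC CB nCB cBC] := cocyclicP cC.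
have iO := overgroup_index pB nCB cBC neCB.
have cO : #|overgroup B C| = (#|C| * 2)%N by rewrite -(Lagrange (overgroup_sub B C)) iO.
have C0 : (#|C|%:R : K) != 0 := natr_cardG_neq0 (cardG_neq0 two_neq0 pG) C.
rewrite /cocyclic_idem (negPf neCB) ffunE [X in _ + X]ffunE !hatE !group1 cO natrM.
rewrite subr_eq0; apply: contraNneq C0 => E.
have {E} : (#|C|%:R : K) = #|C|%:R * 2%:R := invr_inj (E : _ = _ :> K).
by rewrite mulr_natr mulr2n -[LHS]addr0 => /addrI <-.
Qed.

Lemma root_spanned_whole : B \in cocyclic -> root_spanned B (e B).
Proof.
move=> cB; have [g gB [gen _]] := cocyclic_generator cB.
exists g => //; split=> //; exists ('X - 1%:P); first exact: irredp_XsubC.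
rewrite rmorphB /= horner_algX horner_algC mulrBl (cocyclic_idem_delta K cB) //.
by rewrite mulr_algl scale1r subrr.
Qed.

Lemma root_spanned_irreducible C k : C \in cocyclic ->
  #|B / C|%g = (2 ^ k.+1)%N -> irreducible_poly ('X^(2 ^ k) + 1 : {poly K}) ->
  root_spanned B (e C).
Proof.
move=> cC BCk irr; have [g gB [gen gC]] := cocyclic_generator cC.
exists g => //; split=> //; exists ('X^(2 ^ k) + 1) => //.
rewrite rmorphD rmorph1 rmorphXn /= horner_algX mulrDl mul1r ga_deltaX.
rewrite (cocyclic_idem_delta_opp cC) ?addNr //; first exact: groupX.
  by rewrite gC BCk dvdn_Pexp2l // ltnn.
by rewrite -expgM -expnSr gC BCk.
Qed.

End CocyclicComponents.

(** * Splitting the idempotents over a finite field *)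

Section FiniteSplit.

Local Open Scope ring_scope.

Variables (K : finFieldType) (gT : finGroupType).
Hypotheses (oK : odd #|K|) (pG : (2.-group [set: gT])%g).

Local Notation A := (group_algebra K gT).
Local Notation delta g := (ga_delta K g : A).
Implicit Types (g h z : gT) (a : A) (C D H P : {group gT}).

Variables (B M : {group gT}).
Hypotheses (sMB : M \subset B)
  (nMB : forall C, M \subset C -> C \subset B -> (C <| [set: gT])%g).

Local Notation e := (cocyclic_idem K B).
Local Notation cocyclic := (cocyclic B M).

Let two_neq0 : (2%:R : K) != 0. Proof. exact: odd_card_two_neq0. Qed.

Lemma root_spanned_small C : #|K| = 3 %[mod 8] -> C \in cocyclic ->
  (#|B / C|%g <= 4)%N -> root_spanned B (e C).
Proof.
move=> K3 cC BC4; have [MC CB nCB cBC] := cocyclicP cC.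
have [k BCk] := p_natP (quotient_pgroup C (pgroupS (subsetT B) pG)).
have irr j : (j <= 1)%N -> irreducible_poly ('X^(2 ^ j) + 1 : {poly K}).
  move=> j1; apply: (irreducible_order_pow2 (n := (2 ^ j)%N) (k := j) two_neq0) => //.
  - by rewrite size_XnaddC1 ?expn_gt0.
  - by rewrite expn_gt0.
  (* Only X^2 + 1 needs an argument: 4 | #|K|^d - 1 forces [d] to be even. *)
  move=> d d0; case: j j1 => [|[|//]] _ // dv.
  by have [/dvdn_leq -> //] := order_mod_pow2 (k := 0) K3 d0 dv.
case: k BCk => [|k] BCk.
  have CE : C = B.
    by apply/eqP; rewrite -val_eqE eqEsubset CB -quotient_sub1 ?normal_norm // subG1 trivg_card1 BCk.
  by rewrite CE in cC *; apply: root_spanned_whole cC.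
apply: (root_spanned_irreducible two_neq0 pG sMB nMB cC BCk); apply: irr.
by move: BC4; rewrite BCk -[4%N]/(2 ^ 2)%N leq_exp2l.
Qed.

(** The element th = g^(2^k) e C satisfies th^4 = - e C. Either w = th^2 or w = th - b th^3 has a
    scalar square c^2, and [central_split] applies. The first case needs a square root of -1, which
    does not exist when #|K| = 3 mod 8. *)
Lemma cocyclic_split C k : C \in cocyclic -> #|B / C|%g = (2 ^ k.+3)%N ->
  (forall g h, g \in B -> delta h * (delta g * e C) = delta g * e C * delta h) ->
  exists h : bool -> A,
    [/\ forall b : bool, central_idempotent (h b), h true * h false = 0,
        h true + h false = e C,
        forall b : bool, h b * e C = h b
      & #|K| = 3 %[mod 8] -> forall b : bool, root_spanned B (h b)].
Proof.
move=> cC BCk gcomm; have [g gB [gen gC]] := cocyclic_generator two_neq0 pG sMB nMB cC.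
have [MC CB nCB cBC] := cocyclicP cC.
have neCB : C != B by apply/eqP => CE; move: (gC 1%N); rewrite expg1 BCk CE gB dvdn1 expnS muln_eq1.
pose E := e C; pose n := (2 ^ k)%N; pose th := delta g ^+ n * E.
have cE := cocyclic_idem_central two_neq0 pG sMB nMB cC; have [EE EC E0] := cE.
have cth a : th * a = a * th.
  by apply: ga_central_delta => h; rewrite /th ga_deltaX gcomm ?groupX.
have thE : th * E = th by rewrite /th -mulrA EE.
have thX m : th ^+ m.+1 = delta g ^+ (n * m.+1) * E.
  elim: m => [|m IH]; first by rewrite expr1 muln1.
  rewrite exprS IH {1}/th -mulrA [E * (_ * E)]mulrA EC.
  by rewrite -!mulrA EE mulrA -exprD -mulnS.
have th4 : th ^+ 4 = - E.
  rewrite thX ga_deltaX (cocyclic_idem_delta_opp two_neq0 pG nMB cC) //.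
  - exact: groupX.
  - by rewrite gC BCk /n -[4%N]/(2 ^ 2)%N -expnD addn2 dvdn_Pexp2l // ltnn.
  by rewrite -expgM gC BCk /n -mulnA -[(4 * 2)%N]/(2 ^ 3)%N -expnD addn3.
(* The coefficient at 1 detects that [w] is not a multiple of the unit of the corner. *)
have out m : (0 < m < 4)%N -> (th ^+ m) 1%g = 0.
  case: m => // m m3; rewrite thX ga_deltaX.
  apply: (cocyclic_idem_outside _ pG cC neCB); first exact: groupX.
  rewrite -expgM gC BCk /n -mulnA -addn3 expnD dvdn_pmul2l ?expn_gt0 //.
  by case: m m3 => [|[|[|]]].
have E1 : E 1%g != 0 := cocyclic_idem_at1 two_neq0 pG cC neCB.
have ne (w : A) c : w 1%g = 0 -> c != 0 -> w != c *: E.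
  move=> w1 c0; apply/eqP => wE; move/eqP: w1; rewrite wE ffunE.
  by rewrite mulf_eq0 (negPf c0) (negPf E1).
have split (w : A) c : c != 0 -> (forall a, w * a = a * w) -> w * E = w ->
    w * w = (c * c) *: E -> w 1%g = 0 -> exists h : bool -> A,
    [/\ forall b, central_idempotent (h b), h true * h false = 0,
        h true + h false = E, forall b, h b * E = h b
      & forall b, w * h b = (if b then c else - c) *: h b].
  move=> c0 cw wE ww w1; apply: (central_split two_neq0 cE cw wE ww c0); first exact: ne.
  by rewrite -scaleNr ne ?oppr_eq0.
have comX m a : th ^+ m * a = a * th ^+ m by apply/esym/commrX/esym/cth.
have thXE m : th ^+ m.+1 * E = th ^+ m.+1 by rewrite exprSr -mulrA thE.
have n1 : (-1 : K) != 0 by rewrite oppr_eq0 oner_eq0.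
have n2 : (2%:R : K) != 0 by [].
have [c cc] := finField_square_trichotomy n1 n2.
have c0 : c != 0.
  apply/eqP => c0; rewrite c0 mul0r in cc; case: cc => /esym/eqP.
  - by rewrite (negPf n1).
  - by rewrite (negPf n2).
  by rewrite mulf_eq0 (negPf n1) (negPf n2).
have [cm|[b bb cb]] : c * c = -1 \/ exists2 b : K, b * b = 1 & c * c = b + b.
  case: cc => cc; [by left | right; exists 1 | right; exists (-1)].
  - by rewrite mulr1.
  - by rewrite cc mulr2n.
  - by rewrite mulrNN mulr1.
  by rewrite cc mulr2n mulN1r opprD.
- have [h [h1 h2 h3 h4 _]] : exists h : bool -> A,
    [/\ forall b, central_idempotent (h b), h true * h false = 0,
        h true + h false = E, forall b, h b * E = h b
      & forall b, th ^+ 2 * h b = (if b then c else - c) *: h b].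
    apply: split => //; [by rewrite -exprD th4 cm scaleN1r | exact: out].
  exists h; split=> // K3; have := finField_sqrt_opp1 c K3.
  by rewrite cm eqxx.
pose w := th - b *: th ^+ 3.
have [h [h1 h2 h3 h4 wh]] : exists h : bool -> A,
    [/\ forall b, central_idempotent (h b), h true * h false = 0,
        h true + h false = E, forall b, h b * E = h b
      & forall b, w * h b = (if b then c else - c) *: h b].
  apply: split => //.
  - move=> a; rewrite /w mulrBl mulrBr -scalerAl -scalerAr comX.
    by rewrite -[th in LHS]expr1 comX expr1.
  - by rewrite /w mulrBl thE -scalerAl thXE.
  - have t13 : th * th ^+ 3 = - E by rewrite -exprS.
    have t31 : th ^+ 3 * th = - E by rewrite -exprSr.
    have t33 : th ^+ 3 * th ^+ 3 = - (th * th).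
      by rewrite -exprD (exprD th 4 2) th4 mulNr EC -expr2 thXE.
    rewrite /w mulrBl !mulrBr -!scalerAl -!scalerAr t13 t31 t33 scalerA bb scale1r.
    rewrite !scalerN !opprK opprD opprK cb scalerDl addrACA.
    by rewrite addrC addrA subrK.
  - have := out 1%N isT; rewrite expr1 => o1.
    by rewrite /w ffunE [X in _ + X]ffunE o1 add0r ffunE out // scaler0 oppr0.
have Eh i : E * h i = h i by rewrite EC h4.
have thh i m : delta g ^+ (n * m.+1) * h i = th ^+ m.+1 * h i.
  by rewrite thX -mulrA Eh.
exists h; split=> // K3 i; exists g => //; split; last first.
  by move=> k0 /gen[j jE]; exists j; rewrite -(Eh i) !mulrA jE.
pose d := if i then c else - c.
have dd : d * d = b + b by rewrite -cb /d; case: (i); rewrite ?mulrNN.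
exists (quartic_factor d b n); first exact: quartic_factor_irreducible.
have X1 : delta g ^+ n * h i = th * h i by rewrite -(expr1 th) -thh muln1.
have X2 : delta g ^+ (n + n) * h i = th * (th * h i).
  by rewrite addnn -muln2 thh expr2 mulrA.
(* Multiplying (th - b th^3) h = d h by th and using th^4 = -1 gives th^2 - d th + b = 0, the
   quartic factor evaluated at g. *)
have dh : d *: (th * h i) = th * (th * h i) + b *: h i.
  rewrite scalerAr -wh /w [(th - _) * h i]mulrBl mulrBr; congr (_ + _).
  rewrite -scalerAl -scalerAr mulrA -exprS th4 mulNr Eh.
  by rewrite scalerN opprK.
rewrite horner_quartic_factor mulrDl mulrBl X2 -scalerAl X1 dh mulr_algl.
by rewrite opprD addrA subrr add0r addNr.
Qed.

End FiniteSplit.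

Section OrthogonalFamilies.

Local Open Scope ring_scope.

Variables (K : fieldType) (A : falgType K).

Lemma field_algebra_simple (B : falgType K) : field_algebra B -> simple_algebra B.
Proof.
move=> [_ unitB] J iJ; have [J0|] := eqVneq J 0%VS; [by left | right].
have J0 : vpick J != 0 by rewrite vpick0.
apply/eqP; rewrite eqEsubv subvf; apply/subvP=> b _.
by rewrite -[b](mulrVK (unitB _ J0)) (ideal_mull _ iJ) ?memv_pick.
Qed.

(** A version of [idempotent_decomposition] with total [p], so that the parts below hat G' and 1 -
    hat G' can be refined separately. *)
Definition orthogonal_family (T : finType) (X : {set T}) (F : T -> A) (p : A) :=
  [/\ {in X, forall i, central_idempotent (F i)},
      {in X &, forall i j, i != j -> F i * F j = 0}
    & \sum_(i in X) F i = p].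

Lemma orthogonal_family_sum (T : finType) (X : {set T}) (F : T -> A) p i :
  orthogonal_family X F p -> i \in X -> F i * p = F i /\ p * F i = F i.
Proof.
move=> [cF oF <-] iX; have [ee ce _] := cF i iX.
have E : F i * \sum_(j in X) F j = F i.
  rewrite mulr_sumr (bigD1 i) //= ee big1 ?addr0 // => j /andP[jX ji].
  by rewrite oF // eq_sym.
by split=> //; rewrite -ce.
Qed.

Lemma orthogonal_family_decomposition (T1 T2 : finType) (X : {set T1})
    (Y : {set T2}) (F1 : T1 -> A) (F2 : T2 -> A) p :
  orthogonal_family X F1 p -> orthogonal_family Y F2 (1 - p) ->
  idempotent_decomposition (fun k : 'I_#|X| + 'I_#|Y| =>
    match k with inl i => F1 (enum_val i) | inr j => F2 (enum_val j) end).
Proof.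
move=> o1 o2; have [c1 d1 s1] := o1; have [c2 d2 s2] := o2.
have pp : p * p = p.
  rewrite -{2}s1 mulr_sumr -[RHS]s1; apply: eq_bigr => i iX.
  by have [_ ->] := orthogonal_family_sum o1 iX.
have cross i j : i \in X -> j \in Y -> F1 i * F2 j = 0 /\ F2 j * F1 i = 0.
  move=> iX jY; have [ip _] := orthogonal_family_sum o1 iX.
  have [_ pj] := orthogonal_family_sum o2 jY.
  have E : F1 i * F2 j = 0.
    by rewrite -ip -pj mulrA -[F1 i * p * _]mulrA mulrBr mulr1 pp subrr mulr0 mul0r.
  by split=> //; have [_ <- _] := c1 i iX.
split=> [[i|j]|[i|i] [j|j] ij|].
- exact: c1 (enum_valP i).
- exact: c2 (enum_valP j).
- apply: d1; rewrite ?enum_valP //; apply: contra_neq ij => /enum_val_inj -> //.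
- by case: (cross _ _ (enum_valP i) (enum_valP j)).
- by case: (cross _ _ (enum_valP j) (enum_valP i)).
- apply: d2; rewrite ?enum_valP //; apply: contra_neq ij => /enum_val_inj -> //.
by rewrite big_sumType /= -!big_enum_val s1 s2 addrC subrK.
Qed.

Lemma orthogonal_family_direct_sum (T1 T2 : finType) (X : {set T1})
    (Y : {set T2}) (F1 : T1 -> A) (F2 : T2 -> A) p (P Q : falgType K -> Prop) :
  orthogonal_family X F1 p -> orthogonal_family Y F2 (1 - p) ->
  {in X, forall i, P (subvs_of (peirce (F1 i)))} ->
  {in Y, forall j, Q (subvs_of (peirce (F2 j)))} ->
  direct_sum_of A #|X| P #|Y| Q.
Proof.
move=> o1 o2 hP hQ; have d := orthogonal_family_decomposition o1 o2.
have := direct_sum_of_idempotents d (fun i => hP _ (enum_valP i)) (fun j => hQ _ (enum_valP j)).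
by rewrite !card_ord.
Qed.

Section Refinement.

Variables (T : finType) (X S : {set T}) (F : T -> A) (p : A) (h : T -> bool -> A).
Hypotheses (oF : orthogonal_family X F p)
  (hc : forall i b, i \in X -> i \notin S -> central_idempotent (h i b))
  (ho : forall i, i \in X -> i \notin S -> h i true * h i false = 0)
  (hs : forall i, i \in X -> i \notin S -> h i true + h i false = F i)
  (hF : forall i b, i \in X -> i \notin S -> h i b * F i = h i b).

(** Indices in [S] stay unsplit and keep only their copy marked [true]. *)
Definition refined_index := [set q : T * bool | (q.1 \in X) && ((q.1 \in S) ==> q.2)].
Definition refined_family (q : T * bool) := if q.1 \in S then F q.1 else h q.1 q.2.

Lemma card_refined_index : (#|refined_index| + #|X :&: S| = 2 * #|X|)%N.
Proof.
have -> : refined_index = setX X [set: bool] :\: setX (X :&: S) [set false].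
  apply/setP=> -[i b]; rewrite !inE /=.
  by case: (i \in X); case: (i \in S); case: b.
rewrite cardsD (setIidPr _) ?setXS ?subsetIl ?subsetT // !cardsX cardsT card_bool cards1 muln1.
by rewrite subnK ?muln2 ?mul2n // -addnn -[leqLHS]addn0 leq_add // subset_leq_card ?subsetIl.
Qed.

Lemma orthogonal_family_refine : orthogonal_family refined_index refined_family p.
Proof.
have [cF dF sF] := oF; split=> [[i b]|[i b] [j c]|].
- rewrite inE /refined_family /= => /andP[iX _]; case: ifP => [_|/negbT iS].
    exact: cF.
  exact: hc.
- rewrite !inE /= => /andP[iX iSb] /andP[jX jSc] ne.
  have FE k d : k \in X -> refined_family (k, d) * F k = refined_family (k, d)
      /\ F k * refined_family (k, d) = refined_family (k, d).
    move=> kX; rewrite /refined_family /=; have [Fk Fc _] := cF k kX.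
    by case: ifP => [_|/negbT kS]; [rewrite Fk | rewrite Fc hF].
  have [ij|ij] := eqVneq i j.
    rewrite -ij in ne jSc *; have [iS|iS] := boolP (i \in S).
      by rewrite iS /= in iSb jSc; rewrite iSb jSc eqxx in ne.
    have [_ hcomm _] := hc true iX iS.
    rewrite /refined_family /= (negPf iS).
    case: b c ne {iSb jSc} => [] []; rewrite ?eqxx // => _; first exact: ho.
    by rewrite -hcomm ho.
  have [<- _] := FE i b iX; have [_ <-] := FE j c jX.
  by rewrite -mulrA [F i * _]mulrA dF // mul0r mulr0.
rewrite -sF (eq_bigl (fun q : T * bool => (q.1 \in X) && ((q.1 \in S) ==> q.2))); last first.
  by move=> q; rewrite inE.
rewrite -(pair_big_dep (fun i => i \in X) (fun i b => (i \in S) ==> b)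
  (fun i b => refined_family (i, b))) /=.
apply: eq_bigr => i iX; rewrite big_mkcond big_bool /refined_family /=.
by have [iS|iS] := boolP (i \in S); rewrite /= ?addr0 ?hs.
Qed.

End Refinement.

End OrthogonalFamilies.

(** * Ideals of the group algebra are generated by central idempotents *)

Section Maschke.

Local Open Scope ring_scope.

Variables (K : fieldType) (gT : finGroupType).
Hypothesis cardG_neq0 : (#|[set: gT]|%:R : K) != 0.

Local Notation A := (group_algebra K gT).
Local Notation delta g := (ga_delta K g : A).

(* The average over [G x G] of a linear projection onto an ideal is a bimodule
   projection; the image of [1] is the identity of the ideal. *)
Lemma ga_ideal_idempotent (U : {vspace A}) : twosided_ideal U -> U != 0%VS ->
  exists2 e, central_idempotent e & U = peirce e.
Proof.
move=> iU U0; pose n := #|[set: gT]|%:R : K.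
pose pi a : A := (n * n)^-1 *: \sum_g \sum_h
  delta g * projv U (delta g^-1 * a * delta h^-1) * delta h.
have piU a : pi a \in U.
  apply/memvZ/rpred_sum => g _; apply: rpred_sum => h _.
  by apply/ideal_mulr/ideal_mull; rewrite ?memv_proj.
have pi_id a : a \in U -> pi a = a.
  move=> aU; rewrite /pi (eq_bigr (fun=> a *+ #|gT|)) => [|g _].
    rewrite sumr_const -mulrnA -scaler_nat scalerA natrM /n cardsT mulVf ?scale1r //.
    by move: cardG_neq0; rewrite cardsT => c0; rewrite mulf_neq0.
  rewrite (eq_bigr (fun=> a)) ?sumr_const // => h _.
  rewrite projv_id; last by apply/ideal_mulr/ideal_mull.
  by rewrite !mulrA ga_deltaM mulgV mul1r -mulrA ga_deltaM mulVg mulr1.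
have dVl g : delta g^-1 * delta g = 1 by rewrite ga_deltaM mulVg.
have dVr g : delta g * delta g^-1 = 1 by rewrite ga_deltaM mulgV.
have piMl k a : pi (delta k * a) = delta k * pi a.
  rewrite /pi -scalerAr mulr_sumr; congr (_ *: _).
  rewrite (reindex_inj (mulgI k)) /=; apply: eq_bigr => g _.
  rewrite mulr_sumr; apply: eq_bigr => h _.
  by rewrite invMg -!ga_deltaM !mulrA -[delta g^-1 * delta k^-1 * _]mulrA dVl mulr1.
have piMr k a : pi (a * delta k) = pi a * delta k.
  rewrite /pi -scalerAl mulr_suml; congr (_ *: _); apply: eq_bigr => g _.
  rewrite mulr_suml (reindex_inj (mulIg k)) /=; apply: eq_bigr => h _.
  by rewrite invMg -!ga_deltaM !mulrA -[_ * delta k * delta k^-1]mulrA dVr mulr1.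
have piZ k a : pi (k *: a) = k *: pi a.
  rewrite /pi scalerA [k * _]mulrC -scalerA; congr (_ *: _).
  rewrite scaler_sumr; apply: eq_bigr => g _; rewrite scaler_sumr; apply: eq_bigr => h _.
  by rewrite -scalerAr -scalerAl linearZ /= -scalerAr -scalerAl.
have piD a b : pi (a + b) = pi a + pi b.
  rewrite /pi -scalerDr -big_split; congr (_ *: _); apply: eq_bigr => g _ /=.
  rewrite -big_split; apply: eq_bigr => h _ /=.
  by rewrite mulrDr mulrDl linearD /= mulrDr mulrDl.
have pi0 : pi 0 = 0 by rewrite -(scale0r (0 : A)) piZ !scale0r.
pose e := pi 1.
have piE a : pi a = a * e /\ pi a = e * a.
  have piS : pi a = \sum_g (a g : K) *: pi (delta g).
    rewrite {1}(ga_sum_delta a) (big_morph pi piD pi0).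
    by apply: eq_bigr => g _; rewrite piZ.
  rewrite piS; split; rewrite {2}(ga_sum_delta a) ?mulr_suml ?mulr_sumr; apply: eq_bigr => g _.
    by rewrite -scalerAl -piMl mulr1.
  by rewrite -scalerAr -piMr mul1r.
have eU : e \in U by apply: piU.
have ee : e * e = e by have [<- _] := piE e; apply: pi_id.
have ce : central_idempotent e.
  split=> // [a|]; first by have [<- <-] := piE a.
  apply/eqP => e0; move: U0; rewrite -subv0 => /negP; apply; apply/subvP => a aU.
  by rewrite memv0 -(pi_id a aU); have [-> _] := piE a; rewrite e0 mulr0.
exists e => //; apply/eqP; rewrite eqEsubv; apply/andP; split; apply/subvP=> a.
  by move=> aU; rewrite mem_peirce //; have [<- _] := piE a; rewrite pi_id.
by rewrite mem_peirce // => /eqP <-; apply: ideal_mull.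
Qed.

Lemma ga_wedderburn_exists :
  exists (n : nat) (B : 'I_n -> {aspace A}), wedderburn_decomposition B.
Proof. exact: wedderburn_exists ga_ideal_idempotent. Qed.

End Maschke.

Lemma cocyclic_above (gT : finGroupType) (B M D : {group gT}) : M \subset D ->
  [set C in cocyclic B M | D \subset C] = cocyclic B D.
Proof.
move=> MD; apply/setP => C; rewrite !inE.
by case: (boolP (D \subset C)) => [/(subset_trans MD) ->|_]; rewrite ?andbT ?andbF.
Qed.

Section CocyclicFamilies.

Local Open Scope ring_scope.

Variables (K : fieldType) (gT : finGroupType).
Hypotheses (two_neq0 : (2%:R : K) != 0) (pG : (2.-group [set: gT])%g).

Local Notation A := (group_algebra K gT).
Local Notation delta g := (ga_delta K g : A).
Local Notation hat := (hat K).
Implicit Types (C D : {group gT}).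

Variables (B M : {group gT}).
Hypotheses (sMB : M \subset B) (dB : (B^`(1) \subset M)%g)
  (nMB : forall C, M \subset C -> C \subset B -> (C <| [set: gT])%g).

Local Notation e := (cocyclic_idem K B).
Local Notation cocyclic := (cocyclic B M).

Lemma cocyclic_family : orthogonal_family cocyclic e (hat M).
Proof.
split=> [C cC|C D cC cD|].
- exact: (cocyclic_idem_central two_neq0 pG sMB nMB).
- exact: (cocyclic_idem_orth two_neq0 pG sMB nMB).
exact: (sum_cocyclic_idem two_neq0 pG sMB dB nMB).
Qed.

Lemma cocyclic_family_outside D : M \subset D -> D \subset B ->
  orthogonal_family [set C in cocyclic | ~~ (D \subset C)] e (hat M - hat D).
Proof.
move=> MD DB; have [cF oF sF] := cocyclic_family; split=> [C|C1 C2|].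
- by case/setIdP => cC _; apply: cF.
- by case/setIdP => c1 _ /setIdP[c2 _]; apply: oF.
have <- : \sum_(C in cocyclic | D \subset C) e C = hat D.
  rewrite -(hat_sum_cocyclic two_neq0 pG sMB dB nMB MD DB) mulr_sumr big_mkcondr.
  by apply: eq_bigr => C cC; rewrite (hat_cocyclic_idem two_neq0 pG nMB).
rewrite -sF [in RHS](bigID (fun C => D \subset C)) /=.
rewrite [_ + \sum_(i in _ | _) _]addrC addrK; apply: eq_bigl => C.
by rewrite !inE.
Qed.

End CocyclicFamilies.

Section FiniteRefinement.

Local Open Scope ring_scope.

Variables (K : finFieldType) (gT : finGroupType).
Hypotheses (oK : odd #|K|) (pG : (2.-group [set: gT])%g).

Local Notation A := (group_algebra K gT).
Local Notation delta g := (ga_delta K g : A).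

Variables (B M : {group gT}).
Hypotheses (sMB : M \subset B) (dB : (B^`(1) \subset M)%g)
  (nMB : forall C : {group gT}, M \subset C -> C \subset B -> (C <| [set: gT])%g).

Local Notation e := (cocyclic_idem K B).
Local Notation cocyclic := (cocyclic B M).

Hypothesis gcomm : forall C g h, C \in cocyclic -> g \in B ->
  delta h * (delta g * e C) = delta g * e C * delta h.

(** The last clause keeps each new idempotent below an old one, so that the action of s as -1 is
    inherited. *)
Lemma cocyclic_family_refine (X : {set {group gT}}) p : X \subset cocyclic ->
  orthogonal_family X e p ->
  exists (T : finType) (Y : {set T}) (F : T -> A),
    [/\ orthogonal_family Y F p,
        (#|Y| + #|[set C in X | (#|B / C|%g <= 4)%N]| = 2 * #|X|)%N,
        #|K| = 3 %[mod 8] -> {in Y, forall i, root_spanned B (F i)}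
      & {in Y, forall i, exists2 C, C \in X & F i * e C = F i}].
Proof.
move=> /subsetP sX oX; have two0 := odd_card_two_neq0 oK.
pose S := [set C : {group gT} | (#|B / C|%g <= 4)%N].
have /fin_all_exists[h hP] C : exists h : bool -> A, C \in X -> C \notin S ->
    [/\ forall b : bool, central_idempotent (h b), h true * h false = 0,
        h true + h false = e C, forall b : bool, h b * e C = h b
      & #|K| = 3 %[mod 8] -> forall b : bool, root_spanned B (h b)].
  have [CX|_] := boolP (C \in X); last by exists (fun=> 0).
  have [CS|CS] := boolP (C \in S); first by exists (fun=> 0).
  have [j jE] := p_natP (quotient_pgroup C (pgroupS (subsetT B) pG)).
  case: j jE => [|[|[|k]]] jE; try by rewrite inE jE in CS.
  have [h hP] := cocyclic_split oK pG sMB nMB (sX C CX) jE (fun g h => gcomm h (sX C CX)).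
  by exists h.
exists ({group gT} * bool)%type, (refined_index X S), (refined_family S e h); split.
- apply: (orthogonal_family_refine oX) => C; first by move=> b CX CS; case: (hP C CX CS).
  + by move=> CX CS; case: (hP C CX CS).
  + by move=> CX CS; case: (hP C CX CS).
  by move=> b CX CS; case: (hP C CX CS).
- rewrite -(card_refined_index X S); congr (_ + _)%N; apply: eq_card => C.
  by rewrite !inE.
- move=> K3 [C b]; rewrite inE /refined_family /= => /andP[CX _]; case: ifP => [CS|/negbT CS].
    by apply: (root_spanned_small oK pG sMB nMB K3 (sX C CX)); rewrite inE in CS.
  by case: (hP C CX CS) => _ _ _ _; apply.
move=> [C b]; rewrite inE /refined_family /= => /andP[CX _]; exists C => //.
case: ifP => [_|/negbT CS]; last by case: (hP C CX CS).
by case: oX => cX _ _; case: (cX C CX).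
Qed.

End FiniteRefinement.

(** * The group algebra of a group of type D5 *)

Section D5Components.

Variables (m1 m2 m3 : nat) (gT : finGroupType) (t1 t2 t3 x y : gT).
Hypotheses (hm1 : (3 <= m1)%N) (hG : type_D5 m1 m2 m3 t1 t2 t3 x y).

Local Open Scope group_scope.

Local Notation G := [set: gT]%G.
Local Notation s := (t1 ^+ (2 ^ m1.-1)).
Local Notation Q := (cocyclic G G^`(1)%G).
Local Notation Z := ('Z(G)%G).

Definition D5_center_cocyclic := [set C in cocyclic Z 1%G | ~~ (G^`(1) \subset C)].
Local Notation W := D5_center_cocyclic.

Let pG : 2.-group [set: gT]. Proof. exact: (D5_pgroup hG). Qed.
Let dG1 : G^`(1)%G \subset G. Proof. exact: der_sub. Qed.
Let dG2 : G^`(1) \subset G^`(1)%G. Proof. exact: subxx. Qed.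
Let nG (C : {group gT}) : G^`(1)%G \subset C -> C \subset G -> C <| [set: gT].
Proof. by move=> h1 h2; apply: (@sub_der1_normal gT G). Qed.
Let dZ1 : 1%G \subset Z. Proof. exact: sub1G. Qed.
Let dZ2 : Z^`(1) \subset 1%G. Proof. by rewrite (derG1P (center_abelian G)). Qed.
Let nZ (C : {group gT}) : 1%G \subset C -> C \subset Z -> C <| [set: gT].
Proof. by move=> _; apply: central_normal. Qed.

Lemma D5_der1_center : G^`(1) \subset Z.
Proof. by rewrite (D5_der1 hG) cycle_subG; apply: D5_s_center hG. Qed.

Lemma card_D5_quotient_cocyclic : #|Q| = num_cyclic_subgroups (G / G^`(1))%G.
Proof. exact: (card_cocyclic pG dG1 dG2 nG). Qed.

(** The subgroups of Z(G) with cyclic quotient that contain G' are those counted for Z(G) / G'; the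
    others form [W]. *)
Lemma card_D5_center_cocyclic :
  (#|W| + num_cyclic_subgroups (Z / G^`(1))%G = num_cyclic_subgroups Z)%N.
Proof.
have <- : num_cyclic_subgroups (Z / 1)%G = num_cyclic_subgroups Z.
  have ZN : Z \subset 'N(1) by rewrite norm1 subsetT.
  rewrite -(num_cyclic_subgroups_injm (injm_restrm ZN (coset1_injm gT))).
  by congr num_cyclic_subgroups; apply: val_inj; rewrite /= morphim_restrm setIid.
rewrite -(card_cocyclic pG dZ1 dZ2 nZ).
have -> : num_cyclic_subgroups (Z / G^`(1))%G = #|cocyclic Z G^`(1)%G|.
  apply/esym/(card_cocyclic pG D5_der1_center) => [|C _].
    exact: subset_trans dZ2 (sub1G _).
  by apply: nZ; apply: sub1G.
rewrite -(cocyclic_above Z (sub1G G^`(1)%G)) addnC.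
rewrite -[RHS](cardsID [set C : {group gT} | G^`(1) \subset C]).
by congr (_ + _)%N; apply: eq_card => C; rewrite !inE // andbC.
Qed.

(** The order of t1 modulo C divides |Z(G) / C|; if that were at most 2^(m1 - 1), then s would lie
    in C. *)
Lemma D5_center_cocyclic_index C : C \in W -> exists k, #|Z / C| = (2 ^ k.+3)%N.
Proof.
case/setIdP => cC sC; have [_ CZ nCZ _] := cocyclicP cC.
have [k kE] := p_natP (quotient_pgroup C (pgroupS (subsetT Z) pG)).
suff m1k : (m1.-1 < k)%N by exists (k - 3)%N; rewrite kE; congr (2 ^ _)%N; lia.
rewrite ltnNge; apply: contra sC => km1; rewrite (D5_der1 hG) cycle_subG.
have [_ _ _ [t1Z _ _] _] := hG; have ZN := subsetP (normal_norm nCZ).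
apply: coset_idr; first by rewrite groupX ?ZN.
rewrite morphX ?ZN //=; apply/eqP; rewrite -order_dvdn.
apply: dvdn_trans (dvdn_exp2l 2 km1); rewrite -kE.
by rewrite order_dvdG ?mem_quotient.
Qed.

Section OverField.

Variable K : fieldType.
Hypothesis two_neq0 : (2%:R != 0 :> K)%R.
Local Notation A := (group_algebra K gT).
Local Notation delta g := (ga_delta K g : A).
Local Notation hat := (hat K).
Local Open Scope ring_scope.

Lemma D5_quotient_family : orthogonal_family Q (cocyclic_idem K G) (hat G^`(1)%g).
Proof. exact: (cocyclic_family two_neq0 pG dG1 dG2 nG). Qed.

Lemma D5_center_family : orthogonal_family W (cocyclic_idem K Z) (1 - hat G^`(1)%g).
Proof.
rewrite -(hat1 K gT).
exact: (cocyclic_family_outside two_neq0 pG dZ1 dZ2 nZ (sub1G _) D5_der1_center).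
Qed.

(** Commutators lie in C, hence act trivially on [cocyclic_idem K G C]. *)
Lemma D5_quotient_comm C g h : C \in Q ->
  delta h * (delta g * cocyclic_idem K G C) = delta g * cocyclic_idem K G C * delta h.
Proof.
move=> cC; have [dC _ _ _] := cocyclicP cC.
have [_ ec _] := cocyclic_idem_central two_neq0 pG dG1 nG cC.
rewrite -[RHS]mulrA ec !mulrA !ga_deltaM (commgC h g) -(ga_deltaM K (g * h)%g).
rewrite -[LHS]mulrA (cocyclic_idem_delta K cC) //.
by apply: (subsetP dC); rewrite mem_commg ?in_setT.
Qed.

Lemma center_delta z (a : A) : z \in Z -> delta z * a = a * delta z.
Proof.
move=> zZ; apply: ga_central_delta => g; rewrite !ga_deltaM.
by rewrite (center_commute g zZ).
Qed.

Lemma D5_center_s C : C \in W ->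
  delta s * cocyclic_idem K Z C = - cocyclic_idem K Z C.
Proof.
case/setIdP => cC; rewrite (D5_der1 hG) cycle_subG => sC.
apply: (cocyclic_idem_delta_opp two_neq0 pG nZ cC) => //; first exact: D5_s_center hG.
by rewrite (D5_s2 hm1 hG).
Qed.

Lemma D5_quaternion (e : A) : central_idempotent e -> root_spanned Z e ->
  delta s * e = - e ->
  quaternion_algebra (subvs_of (peirce e)) /\ matrix2_algebra (subvs_of (peirce e)).
Proof.
move=> ce re se; have [_ _ _ [t1Z t2Z t3Z] [x2 y2 _]] := hG.
(* The central element [t] is chosen with t^2 = s, which acts as -1. *)
apply: (quaternion_component two_neq0 ce (Z := Z) (x := x) (y := y)
  (t := (t1 ^+ (2 ^ m1.-2))%g)) => //.
- by move=> z a; apply: center_delta.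
- by rewrite x2.
- by rewrite y2.
- exact: D5_cover hG.
- by rewrite (D5_xy hG) -ga_deltaM -mulrA se mulrN.
- exact: groupX.
by rewrite -expgM -expnSr; have -> : m1.-2.+1 = m1.-1 by lia.
Qed.

End OverField.

End D5Components.

Section RationalComponents.

Variables (gT : finGroupType) (B M : {group gT}).
Hypotheses (pG : (2.-group [set: gT])%g) (sMB : M \subset B)
  (nMB : forall C : {group gT}, M \subset C -> C \subset B -> (C <| [set: gT])%g).

Lemma root_spanned_rat C : C \in cocyclic B M ->
  root_spanned B (cocyclic_idem rat B C).
Proof.
move=> cC; have [_ CB nCB _] := cocyclicP cC.
have [[|k] kE] := p_natP (quotient_pgroup C (pgroupS (subsetT B) pG)); last first.
  exact: (root_spanned_irreducible _ pG sMB nMB cC kE (irreducible_rat_XnaddC k)).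
have CE : C = B.
  by apply/eqP; rewrite -val_eqE eqEsubset CB -quotient_sub1 ?normal_norm // subG1 trivg_card1 kE.
by rewrite CE in cC *; apply: root_spanned_whole cC.
Qed.

End RationalComponents.

Section D5Decompositions.

Variables (m1 m2 m3 : nat) (gT : finGroupType) (t1 t2 t3 x y : gT).
Hypotheses (hm1 : (3 <= m1)%N) (hm2 : (3 <= m2)%N) (hm3 : (3 <= m3)%N)
  (hG : type_D5 m1 m2 m3 t1 t2 t3 x y).

Local Notation G := [set: gT]%G.
Local Notation s := (t1 ^+ (2 ^ m1.-1))%g.
Local Notation Q := (cocyclic G G^`(1)%G).
Local Notation W := (D5_center_cocyclic gT).

Let pG : (2.-group [set: gT])%g. Proof. exact: (D5_pgroup hG). Qed.
Let dG1 : G^`(1)%G \subset G. Proof. exact: der_sub. Qed.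
Let nG (C : {group gT}) : G^`(1)%G \subset C -> C \subset G -> (C <| [set: gT])%g.
Proof. by move=> h1 h2; apply: (@sub_der1_normal gT G). Qed.
Let dZ1 : 1%G \subset 'Z(G)%G. Proof. exact: sub1G. Qed.
Let nZ (C : {group gT}) : 1%G \subset C -> C \subset 'Z(G)%G -> (C <| [set: gT])%g.
Proof. by move=> _; apply: central_normal. Qed.

Lemma D5_rat_direct_sum :
  direct_sum_of (group_algebra rat gT) #|Q| (@field_algebra rat) #|W| (@quaternion_algebra rat).
Proof.
have two0 : (2%:R != 0 :> rat)%R by [].
have oQ := D5_quotient_family hG two0; have oW := D5_center_family hG two0.
apply: (orthogonal_family_direct_sum oQ oW) => C cC.
  have [cF _ _] := oQ; apply: (field_component (cF C cC)).
  exact: (root_spanned_rat pG dG1 nG).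
have [cF _ _] := oW; have [] := @D5_quaternion _ _ _ _ _ _ _ _ _ hm1 hG _ two0 _ (cF C cC) => //.
  by case/setIdP: cC => cC _; apply: (root_spanned_rat pG dZ1 nZ).
exact: (D5_center_s hm1 hG two0).
Qed.

Lemma D5_finite_families (K : finFieldType) : odd #|K| ->
  exists (T1 T2 : finType) (Y1 : {set T1}) (Y2 : {set T2})
      (F1 : T1 -> group_algebra K gT) (F2 : T2 -> group_algebra K gT) p,
    [/\ orthogonal_family Y1 F1 p, orthogonal_family Y2 F2 (1 - p)%R,
        (#|Y1| + 36 = 2 * #|Q|)%N, #|Y2| = (2 * #|W|)%N
      & #|K| = 3 %[mod 8] ->
        {in Y1, forall i, field_algebra (subvs_of (peirce (F1 i)))} /\
        {in Y2, forall i, quaternion_algebra (subvs_of (peirce (F2 i))) /\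
                          matrix2_algebra (subvs_of (peirce (F2 i)))}].
Proof.
move=> oK; have two0 := odd_card_two_neq0 oK.
have oQ := D5_quotient_family hG two0; have oW := D5_center_family hG two0.
have [T1 [Y1 [F1 [o1 c1 r1 _]]]] := cocyclic_family_refine oK pG dG1 nG
  (fun C g h cC _ => D5_quotient_comm hG two0 g h cC) (subxx _) oQ.
have zcomm C g h : C \in cocyclic 'Z(G)%G 1%G -> g \in 'Z(G)%G ->
    (ga_delta K h * (ga_delta K g * cocyclic_idem K 'Z(G)%G C) =
     ga_delta K g * cocyclic_idem K 'Z(G)%G C * ga_delta K h)%R.
  move=> cC gZ; have [_ ec _] := cocyclic_idem_central two0 pG dZ1 nZ cC.
  by rewrite -[RHS]mulrA ec !mulrA (center_delta _ gZ).
have sW : W \subset cocyclic 'Z(G)%G 1%G by apply/subsetP => C /setIdP[].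
have [T2 [Y2 [F2 [o2 c2 r2 f2]]]] := cocyclic_family_refine oK pG dZ1 nZ zcomm sW oW.
exists T1, T2, Y1, Y2, F1, F2, (hat K G^`(1)%g); split=> //.
- by rewrite -c1 (D5_small_cocyclic hm1 hm2 hm3 hG).
- rewrite -c2 [X in (_ + X)%N](_ : _ = 0%N) ?addn0 //; apply: eq_card0 => C.
  apply/negbTE/negP => /setIdP[/(D5_center_cocyclic_index hm1 hG)[k ->]].
  by rewrite -[4%N]/(2 ^ 2)%N leq_exp2l.
move=> K3; split=> i iY.
  by case: o1 => cF _ _; apply: (field_component (cF i iY)); apply: r1.
case: o2 => cF _ _; apply: (D5_quaternion hm1 hG two0 (cF i iY)); first exact: r2.
have [C CW FE] := f2 i iY; have [_ Fc _] := cF i iY.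
by rewrite -FE Fc mulrA (D5_center_s hm1 hG two0) // mulNr.
Qed.

End D5Decompositions.

Local Open Scope group_scope.

Theorem theorem7p2 (m1 m2 m3 : nat)
    (gT : finGroupType) (t1 t2 t3 x y : gT)
    (L : splittingFieldType rat) (zeta : L)
    (hm1 : (3 <= m1)%N) (hm2 : (3 <= m2)%N) (hm3 : (3 <= m3)%N)
    (hG : type_D5 m1 m2 m3 t1 t2 t3 x y)
    (hzeta : ((exponent [set: gT]).-primitive_root zeta)%R) :
  let G := [set: gT]%G in
  let s := t1 ^+ (2 ^ m1.-1) in
  let N1 := num_cyclic_subgroups 'Z(G)%G in
  let N2 := #|K_classes_involving zeta G s x| in
  let N3 := #|K_classes_involving zeta G s y| in
  let N4 := #|K_classes_involving zeta G s (x * y)| in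
  let N := (N1 + N2 + N3 + N4)%N in
  let N0 := num_cyclic_subgroups (G / G^`(1))%G in
  [/\ (N0 <= N)%N, (36 <= 2 * N0)%N,
      direct_sum_of (group_algebra rat gT)
        N0 (@field_algebra rat)
        (N - N0) (@quaternion_algebra rat)
    & forall K : finFieldType, odd #|K| ->
      [/\ exists (n : nat) (B : 'I_n -> {aspace group_algebra K gT}),
            wedderburn_decomposition B,
          forall (n : nat) (B : 'I_n -> {aspace group_algebra K gT}),
            wedderburn_decomposition B -> (2 * N - 36 <= n)%N
        & #|K| = 3 %[mod 8] ->
          (forall (n : nat) (B : 'I_n -> {aspace group_algebra K gT}),
            wedderburn_decomposition B -> n = (2 * N - 36)%N) /\
          direct_sum_of (group_algebra K gT)
            (2 * N0 - 36) (@field_algebra K)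
            (2 * (N - N0))
            (fun A => quaternion_algebra A /\ matrix2_algebra A)]].
Proof.
move=> G s N1 N2 N3 N4 N N0.
have QE : #|cocyclic G G^`(1)%G| = N0 := card_D5_quotient_cocyclic hG.
(* With c the number of cyclic subgroups of Z(G) / G', N0 = c + N2 + N3 + N4 and N1 = #|W| + c. *)
have NE : N = (N0 + #|D5_center_cocyclic gT|)%N.
  have := D5_num_cyclic_involving hm1 hG hzeta; have := card_D5_center_cocyclic hG.
  by rewrite -/G -/s -/N0 -/N1 -/N2 -/N3 -/N4 /N; lia.
have WE : (N - N0)%N = #|D5_center_cocyclic gT| by rewrite NE addKn.
have sQ : (36 <= N0)%N.
  rewrite -QE -(D5_small_cocyclic hm1 hm2 hm3 hG); apply/subset_leq_card/subsetP => C.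
  by case/setIdP.
split; [lia | lia | by rewrite WE -QE; apply: D5_rat_direct_sum hm1 hG |] => K oK.
have cG0 := cardG_neq0 (odd_card_two_neq0 oK) (D5_pgroup hG).
have [T1 [T2 [Y1 [Y2 [F1 [F2 [p [o1 o2 c1 c2 sF]]]]]]]] :=
  D5_finite_families hm1 hm2 hm3 hG oK.
rewrite QE in c1; rewrite -WE in c2.
have d := orthogonal_family_decomposition o1 o2.
(* The two families have 2 N0 - 36 and 2 (N - N0) members. *)
have cY : #|{: 'I_#|Y1| + 'I_#|Y2|}| = (2 * N - 36)%N.
  by rewrite card_sum !card_ord; lia.
split; first exact: ga_wedderburn_exists.
  by move=> n B wB; rewrite -cY; apply: wedderburn_card_ge wB d.
move=> K3; have [s1 s2] := sF K3; split.
  move=> n B wB; rewrite -cY; apply: wedderburn_card_eq wB d _ => -[i|i].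
    exact/field_algebra_simple/s1/enum_valP.
  by have [[]] := s2 _ (enum_valP i).
have <- : #|Y1| = (2 * N0 - 36)%N by lia.
by rewrite -c2; apply: orthogonal_family_direct_sum o1 o2 s1 s2.
Qed.
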